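(* Let $\gamma_0$ be a non-degenerate periodic orbit of Hill's problem (Hamiltonian $\hat H_0$) with period $T_0$ and energy $\hat H_0=h$, and let $x_0$ be its point of intersection with a surface of section through $\gamma_0$. Then, for all sufficiently small $\mu>0$, there exists a smooth family of periodic orbits $\gamma_\mu$ of the circular restricted three-body problem (Hamiltonian $H_\mu$) with the following properties (asymptotics as $\mu\to 0^+$): 1. The location $x_\mu$ of $\gamma_\mu$ on a (correspondingly translated and scaled) surface of section satisfies $$x_\mu-m_\mu=\mu^{1/3}x_0+O(\mu^{2/3}),\qquad m_\mu=(1-\mu,0,0,0,1-\mu,0).$$ 2. The period of $\gamma_\mu$ satisfies $T_\mu=T_0+O(\mu^{1/3})$. 3. The Jacobi energy (the value of $H_\mu$ on $\gamma_\mu$) is $$c(\mu)=\mu^{2/3}h-(1-\mu)-\frac{(1-\mu)^2}{2}.$$ 4. The Floquet multipliers of $\gamma_\mu$ change continuously with respect to $\mu$ (including at $\mu=0$, where they are those of $\gamma_0$). 5. If $\gamma_0$ is symmetric with respect to $r_y$ (respectively $r_{yz}$), then $\gamma_\mu$ is also symmetric with respect to $r_y$ (respectively $r_{yz}$).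
   Context: Coordinates on phase space $\mathbb{R}^3\times\mathbb{R}^3$ are $(\mathbf q,\mathbf p)=(q_1,q_2,q_3,p_1,p_2,p_3)$. A Hamiltonian $H$ generates $\dot{\mathbf q}=\partial_{\mathbf p}H$, $\dot{\mathbf p}=-\partial_{\mathbf q}H$, on the open set where $H$ is smooth (away from collisions). CR3BP with mass ratio $\mu$: $$H_\mu=\tfrac12|\mathbf p|^2+p_1q_2-p_2q_1-\frac{\mu}{|\mathbf q-(1-\mu,0,0)|}-\frac{1-\mu}{|\mathbf q-(-\mu,0,0)|}.$$ Hill's problem: $$\hat H_0=\tfrac12|\mathbf p|^2-\frac1{|\mathbf q|}+p_1q_2-p_2q_1+\tfrac12|\mathbf q|^2-\tfrac32q_1^2.$$ A surface of section is a hypersurface $S$ inside an energy level, transverse to the Hamiltonian vector field. Points of the rescaled coordinates (in which $\hat H_0$ is written) are sent to CR3BP coordinates by $x\mapsto \mu^{1/3}x+m_\mu$; the surface of section for $\gamma_\mu$ corresponds, under this map, to a surface of section in the rescaled coordinates through $x_0$. Non-degenerate: for a periodic orbit $\gamma$ on an energy level $\Sigma$ and the Poincaré return map $\psi$ on a surface of section $S\subset\Sigma$ fixing $\gamma(0)$, $\gamma$ is non-degenerate if $\det(d\psi-\mathrm{id})\neq0$ at $\gamma(0)$. Floquet multipliers of a $T$-periodic orbit $\gamma$: the eigenvalues of the monodromy matrix $d\phi^T(\gamma(0))$, $\phi^t$ being the Hamiltonian flow. Symmetries: $r_y(\mathbf q,\mathbf p)=(q_1,-q_2,q_3,-p_1,p_2,-p_3)$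 and $r_{yz}(\mathbf q,\mathbf p)=(q_1,-q_2,-q_3,-p_1,p_2,p_3)$; both reverse the Hamiltonian flows of $H_\mu$ and $\hat H_0$. A periodic orbit $\gamma$ is symmetric with respect to an involution $r$ if, after a time shift, $r(\gamma(t))=\gamma(-t)$ for all $t$. *)

(* Defs.v *)
From HB Require Import structures.
From mathcomp Require Import all_boot all_order all_algebra.
From mathcomp Require Import all_classical all_reals all_analysis.
From mathcomp Require Import complex.
Set Implicit Arguments.
Unset Strict Implicit.
Unset Printing Implicit Defensive.
Import Order.TTheory GRing.Theory Num.Theory.
Import numFieldNormedType.Exports.
Local Open Scope classical_set_scope.
Local Open Scope ring_scope.

(* [f] is of class C^k on [A], which is meant to be an open subset of a
   finite-dimensional space [V]: the partial differentials [x |-> 'd f x v]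
   are required to be C^(k-1) for every direction [v]. *)
Fixpoint class_C (R : realType) (V W : normedModType R) (k : nat)
    (A : set V) (f : V -> W) : Prop :=
  match k with
  | 0%N => forall x, A x -> {for x, continuous f}
  | k'.+1 => (forall x, A x -> differentiable f x) /\
             forall v : V, class_C k' A (fun x => 'd f x v)
  end.

Definition smooth_on (R : realType) (V W : normedModType R)
    (A : set V) (f : V -> W) : Prop :=
  forall k, class_C k A f.

(* [(q1, q2, q3, p1, p2, p3)] as a row vector. *)
Notation phase R := 'rV[R]_6.

Definition mk_phase (R : realType) (q1 q2 q3 p1 p2 p3 : R) : phase R :=
  \row_(i < 6) nth 0 [:: q1; q2; q3; p1; p2; p3] i.

Section Coordinates.
Variable R : realType.
Implicit Type x : phase R.
Definition q1 x : R := x ord0 (inord 0).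
Definition q2 x : R := x ord0 (inord 1).
Definition q3 x : R := x ord0 (inord 2).
Definition p1 x : R := x ord0 (inord 3).
Definition p2 x : R := x ord0 (inord 4).
Definition p3 x : R := x ord0 (inord 5).
End Coordinates.

(* A Hamiltonian together with the open set on which it is smooth. *)
Record ham_system (R : realType) := HamSystem {
  hdom : set (phase R);
  ham : phase R -> R }.

Section HamiltonianDynamics.
Variable R : realType.
Implicit Types (S : ham_system R) (x y : phase R) (c : R -> phase R) (t T : R).

Definition ham_field S x : phase R :=
  let d k : R := 'D_(delta_mx ord0 (inord k)) (ham S) x in
  mk_phase (d 3) (d 4) (d 5) (- d 0) (- d 1) (- d 2).

Definition solves_at S c t : Prop :=
  hdom S (c t) /\ is_derive t (1 : R) c (ham_field S (c t)).

(* The graph of the time-[t] map of the (local) flow, for [0 <= t]. *)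
Definition flows_to S x t y : Prop :=
  exists c, [/\ c 0 = x, c t = y & forall u, 0 <= u <= t -> solves_at S c u].

(* The point reached from [x] after time [t >= 0]; solutions being unique, it is
   the only one. The value where the trajectory does not last until [t] is junk. *)
Definition flow S t x : phase R := xget x [set y | flows_to S x t y].

(* [T] is some period, not necessarily the least one. *)
Definition periodic_orbit S c T : Prop :=
  [/\ 0 < T, forall t, solves_at S c t & forall t, c (t + T) = c t].

Definition least_period c T : Prop :=
  forall T', 0 < T' -> (forall t, c (t + T') = c t) -> T <= T'.

Definition level_section S (h : R) (U : set (phase R)) (s : phase R -> R) :
    set (phase R) :=
  [set x | [/\ U x, ham S x = h & s x = 0]].

(* [level_section S h U s] is a surface of section in the energy level [h]. Its
   tangent space at [x] is [ker ('d (ham S) x) `&` ker ('d s x)]; as the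
   Hamiltonian vector field lies in [ker ('d (ham S) x)], the last condition is
   transversality, and it also makes both differentials independent. *)
Definition surface_of_section S (h : R) (U : set (phase R))
    (s : phase R -> R) : Prop :=
  [/\ open U, U `<=` hdom S, smooth_on U s &
      forall x, level_section S h U s x -> 'd s x (ham_field S x) != 0].

(* The rows of [B] form a basis of the tangent space at [x] of the section. *)
Definition tangent_basis S (s : phase R -> R) x (B : 'M[R]_(4, 6)) : Prop :=
  row_free B /\
  forall v : phase R, (v <= B)%MS <-> 'd (ham S) x v = 0 /\ 'd s x v = 0.

(* [psi] is the return map near [x] of the section [level_section S h U s], for
   a [T]-periodic orbit through [x]; [tau] is the return time. As maps on the
   section, both are given through smooth extensions to an open set [W]. *)
Definition return_map S (h : R) (U : set (phase R)) (s : phase R -> R)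
    (W : set (phase R)) (tau : phase R -> R) (psi : phase R -> phase R)
    x T : Prop :=
  [/\ open W /\ W x, smooth_on W tau, smooth_on W psi, tau x = T /\ psi x = x &
      forall y, W y -> level_section S h U s y ->
        [/\ 0 < tau y, flows_to S y (tau y) (psi y) &
            level_section S h U s (psi y)]].

(* [M] is the matrix, in a basis [B] of the tangent space of the section at
   [c 0], of the differential of the return map (matrices act on row vectors). *)
Definition nondegenerate_orbit S c T : Prop :=
  exists U s W tau psi (B : 'M[R]_(4, 6)) (M : 'M[R]_4),
  [/\ surface_of_section S (ham S (c 0)) U s /\
        level_section S (ham S (c 0)) U s (c 0),
      return_map S (ham S (c 0)) U s W tau psi (c 0) T,
      tangent_basis S s (c 0) B,
      B *m 'J psi (c 0) = M *m B &
      \det (M - 1%:M) != 0].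

Definition monodromy S c T : 'M[R]_6 := 'J (flow S T) (c 0).

(* [l] lists the eigenvalues with their algebraic multiplicities. *)
Definition floquet_multipliers S c T (l : 6.-tuple R[i]) : Prop :=
  map_poly (real_complex R) (char_poly (monodromy S c T))
    = \prod_(z <- l) ('X - z%:P).

Definition symmetric_orbit (r : phase R -> phase R) c : Prop :=
  exists t0, forall t, r (c (t0 + t)) = c (t0 - t).

End HamiltonianDynamics.

(* Continuity on [I] of an unordered [n]-tuple of complex numbers, for the
   matching distance; [P mu l] says that [l] is an enumeration of the tuple
   at [mu]. *)
Definition continuous_unordered (R : realType) (n : nat) (I : set R)
    (P : R -> n.-tuple R[i] -> Prop) : Prop :=
  forall mu, I mu -> exists2 l, P mu l &
  forall e : R, 0 < e -> \forall nu \near mu, I nu ->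
    exists2 l', P nu l' &
      forall i, `|tnth l' i - tnth l i| < (e%:C)%C.

Section ThreeBody.
Variable R : realType.
Implicit Types (mu h : R) (x y : phase R).

Definition enorm3 (a b c : R) : R := Num.sqrt (a ^+ 2 + b ^+ 2 + c ^+ 2).

Definition kinetic x : R := (p1 x ^+ 2 + p2 x ^+ 2 + p3 x ^+ 2) / 2.

Definition cr3bp_ham mu x : R :=
  kinetic x + p1 x * q2 x - p2 x * q1 x
  - mu / enorm3 (q1 x - (1 - mu)) (q2 x) (q3 x)
  - (1 - mu) / enorm3 (q1 x + mu) (q2 x) (q3 x).

Definition cr3bp mu : ham_system R := HamSystem
  [set x | enorm3 (q1 x - (1 - mu)) (q2 x) (q3 x) != 0 /\
           enorm3 (q1 x + mu) (q2 x) (q3 x) != 0]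
  (cr3bp_ham mu).

Definition hill_ham x : R :=
  kinetic x - 1 / enorm3 (q1 x) (q2 x) (q3 x)
  + p1 x * q2 x - p2 x * q1 x
  + (q1 x ^+ 2 + q2 x ^+ 2 + q3 x ^+ 2) / 2 - 3 / 2 * q1 x ^+ 2.

Definition hill : ham_system R := HamSystem
  [set x | enorm3 (q1 x) (q2 x) (q3 x) != 0] hill_ham.

Definition m_shift mu : phase R := mk_phase (1 - mu) 0 0 0 (1 - mu) 0.

(* From the rescaled coordinates to those of the CR3BP, and back. *)
Definition of_rescaled mu x : phase R := mu `^ (3^-1) *: x + m_shift mu.
Definition to_rescaled mu y : phase R := (mu `^ (3^-1))^-1 *: (y - m_shift mu).

Definition jacobi_energy h mu : R :=
  mu `^ (2 / 3) * h - (1 - mu) - (1 - mu) ^+ 2 / 2.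

Definition r_y x : phase R :=
  mk_phase (q1 x) (- q2 x) (q3 x) (- p1 x) (p2 x) (- p3 x).
Definition r_yz x : phase R :=
  mk_phase (q1 x) (- q2 x) (- q3 x) (- p1 x) (p2 x) (p3 x).

End ThreeBody.

(* Main.v *)
(* Put [e = mu^(1/3)]. In the rescaled coordinates the CR3BP Hamiltonian, up to an
   additive constant and the factor [e^2], extends smoothly through [e = 0], where
   it is Hill's Hamiltonian, and time is not rescaled; hence the flow is a smooth
   function of [(t, e, x)], smooth dependence being proved by induction on the order
   of differentiability, the variational equation being an equation of the same kind.
   For a fixed [w] transverse to the energy level, consider the map
   [(e, x, T, lambda) |-> (Phi_T(e, x) - x + lambda w, s x, H_e x - h)].
   Non-degeneracy makes its partial differential in [(x, T, lambda)] injective at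
   [(0, x0, T0, 0)], so that its zeros form a smooth curve, on which energy
   conservation forces [lambda = 0]: these are the periodic orbits. Differentiability
   at [e = 0] gives the asymptotics. Uniqueness gives the symmetry, as the reflection
   of an orbit of the family is again a nearby closed orbit of the same energy. The
   period stays minimal because early returns are excluded by transversality near the
   times [0] and [T0], and by compactness in between. The multipliers are continuous
   because the roots of a monic polynomial depend continuously on its coefficients. *)
Require Import Defs.
From HB Require Import structures.
From mathcomp Require Import all_boot all_order all_algebra.
From mathcomp Require Import all_classical all_reals all_analysis.
From mathcomp Require Import complex.
From mathcomp Require Import ring lra.
Set Implicit Arguments.
Unset Strict Implicit.
Unset Printing Implicit Defensive.
Import Order.TTheory GRing.Theory Num.Theory.
Import numFieldNormedType.Exports.
Local Open Scope classical_set_scope.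
Local Open Scope ring_scope.

(** The homothety by [e] multiplies the symplectic form by [e^2], the same factor as for the
    Hamiltonian, whence the unchanged time. Hill's problem is the value at [e = 0] of a family that
    is smooth in [e], not in [mu]; hence errors in powers of [mu^(1/3)]. One theorem on autonomous
    fields carries the analysis: the smoothness of the time-one map in the initial point. Freezing
    parameters and final time as coordinates of the state turns it into joint smoothness of the
    flow, and the implicit function theorem is derived from it. Product spaces arise at each step,
    so arbitrary finite-dimensional normed spaces are treated, through coordinates. The fixed-point
    equation of the flow is always degenerate at a periodic orbit: the monodromy fixes the field and
    preserves the differential of the energy. The unknown period and the section equation remove the
    first degeneracy, [lambda] and the energy equation the second. Moreover, non-degeneracy is given
    through some section, a priori unrelated to that of the statement, and a return map controlled
    only on it; it is first turned into a condition on the monodromy, the field and the energy. *)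

(** * Reflexive comparison of linear combinations *)

Section LinearCombinations.
Context {R : comNzRingType} {V : lmodType R}.

Inductive lexpr :=
  | LVar of nat | LZero | LAdd of lexpr & lexpr | LOpp of lexpr
  | LScale of R & lexpr.

Fixpoint leval (env : seq V) (e : lexpr) : V :=
  match e with
  | LVar i => env`_i
  | LZero => 0
  | LAdd a b => leval env a + leval env b
  | LOpp a => - leval env a
  | LScale k a => k *: leval env a
  end.

Fixpoint lcoef (i : nat) (e : lexpr) : R :=
  match e with
  | LVar j => if eqn j i then 1 else 0
  | LZero => 0
  | LAdd a b => lcoef i a + lcoef i b
  | LOpp a => - lcoef i a
  | LScale k a => k * lcoef i a
  end.

Lemma leval_coef env e : leval env e = \sum_(i < size env) lcoef i e *: env`_i.
Proof.
elim: e => [j||a IHa b IHb|a IHa|k a IHa] /=.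
- case: (ltnP j (size env)) => [j_lt|env_le].
    rewrite (bigD1 (Ordinal j_lt)) //= eqnE eqxx scale1r big1 ?addr0// => i.
    by rewrite -val_eqE /= eq_sym => /negPf ->; rewrite scale0r.
  rewrite nth_default// big1// => i _; case: ifP => [/eqP ji|]; rewrite ?scale0r//.
  by have := leq_trans (ltn_ord i) env_le; rewrite ji ltnn.
- by rewrite big1// => i _; rewrite scale0r.
- by rewrite IHa IHb -big_split; apply: eq_bigr => i _; rewrite scalerDl.
- by rewrite IHa -sumrN; apply: eq_bigr => i _; rewrite scaleNr.
- by rewrite IHa scaler_sumr; apply: eq_bigr => i _; rewrite scalerA.
Qed.

(** The hypothesis computes to a conjunction of scalar equations, one per atom, which [ring] can
    solve; this is why coefficients compare indices by the reducible [eqn]. *)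
Lemma leval_eq env a b :
  foldr (fun i P => lcoef i a = lcoef i b /\ P) True (iota 0 (size env)) ->
  leval env a = leval env b.
Proof.
move=> ab; rewrite !leval_coef; apply: eq_bigr => i _; congr (_ *: _).
have : (i : nat) \in iota 0 (size env) by rewrite mem_iota /=.
elim: (iota _ _) ab => //= j l IHl [abj abl]; rewrite inE => /predU1P[->//|].
exact: IHl.
Qed.

End LinearCombinations.

Ltac lmem x l :=
  match l with nil => constr:(false) | cons x _ => constr:(true)
  | cons _ ?l' => lmem x l' end.
Ltac lindex x l :=
  match l with cons x _ => constr:(0%N)
  | cons _ ?l' => let n := lindex x l' in constr:(S n) end.
Ltac latoms l t :=
  lazymatch t with
  | (?a + ?b)%R => let l1 := latoms l a in latoms l1 b
  | (- ?a)%R => latoms l a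
  | (?k *: ?a)%R => latoms l a
  | 0%R => l
  | _ => let m := lmem t l in
    lazymatch m with true => l | false => constr:(cons t l) end
  end.
Ltac lquote R l t :=
  lazymatch t with
  | (?a + ?b)%R => let ea := lquote R l a in let eb := lquote R l b in
     constr:(@LAdd R ea eb)
  | (- ?a)%R => let ea := lquote R l a in constr:(@LOpp R ea)
  | (?k *: ?a)%R => let ea := lquote R l a in constr:(@LScale R k ea)
  | 0%R => constr:(@LZero R)
  | _ => let n := lindex t l in constr:(@LVar R n)
  end.
(* Decides equalities of linear combinations, the coefficients being compared
   by [ring]. *)
Ltac lincomb R :=
  lazymatch goal with |- @eq ?T ?a ?b =>
    let l0 := latoms (@nil T) a in let l := latoms l0 b in
    let ea := lquote R l a in let eb := lquote R l b in
    change (leval l ea = leval l eb); apply: leval_eq;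
    cbn [foldr iota size lcoef eqn]; repeat split; ring
  end.

(** * Calculus of differentials and of derivatives of curves *)

Section Differentials.
Context {R : realType}.
Implicit Types U V W : normedModType R.

(** Entry point for explicit estimates: the differentials that are built by hand, up to that of the
    time-one map, are established through this form without little-o. *)
Lemma is_diff_eps V W (f : V -> W) (x : V) (J : {linear V -> W}) :
  continuous J ->
  (forall e : R, 0 < e -> \forall v \near 0, `|f (v + x) - f x - J v| <= e * `|v|) ->
  is_diff x f J.
Proof.
move=> Jc fJ.
have fxE : f \o shift x = cst (f x) + J +o_ (0 : V) id.
  apply/eqaddoP => _ /posnumP[e]; have := fJ e%:num [gt0 of e%:num].
  by apply: filterS => v; rewrite !fctE /= opprD addrA.
have dJ : 'd f x = J :> (V -> W) by exact: diff_unique.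
apply: DiffDef => //.
by apply/diff_locallyP; rewrite dJ.
Qed.

Lemma is_diff_differentiable V W (f df : V -> W) (x : V) :
  is_diff x f df -> differentiable f x.
Proof. by move=> fdf; exact: (@ex_diff _ _ _ _ _ _ _ fdf). Qed.

Lemma is_diffE V W (f df : V -> W) (x : V) : is_diff x f df -> 'd f x = df :> (V -> W).
Proof. by move=> fdf; exact: diff_val. Qed.

Lemma is_diff_near_le V W (f df : V -> W) (x : V) (e : R) :
  is_diff x f df -> 0 < e ->
  \forall v \near 0, `|f (v + x) - f x - df v| <= e * `|v|.
Proof.
move=> fdf e0; have /diff_locally fE := is_diff_differentiable fdf.
rewrite (is_diffE fdf) in fE.
have /eqaddoP/(_ e e0) := fE.
by apply: filterS => v; rewrite !fctE /= opprD addrA.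
Qed.

Lemma is_diff_near_eq V W (f g df : V -> W) (x : V) :
  (\forall y \near x, f y = g y) -> is_diff x f df -> is_diff x g df.
Proof.
move=> fg fdf; have dfE := is_diffE fdf.
rewrite -dfE; apply: is_diff_eps.
  by apply: diff_continuous; exact: is_diff_differentiable fdf.
move=> e e0; have := is_diff_near_le fdf e0.
have fg0 : \forall v \near (0:V), f (v + x) = g (v + x).
  by move: fg; rewrite (near_shift 0) /=; apply: filterS => v; rewrite subr0 /=.
rewrite -dfE; apply: filterS2 fg0 => v <-.
by rewrite (nbhs_singleton fg).
Qed.

Lemma near_eq_diff V W (f g : V -> W) (x : V) :
  (\forall y \near x, f y = g y) -> differentiable f x ->
  'd g x = 'd f x :> (V -> W).
Proof.
move=> fg df; apply: is_diffE; apply: is_diff_near_eq fg _.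
exact: differentiableP.
Qed.

Lemma near_eq_differentiable V W (f g : V -> W) (x : V) :
  (\forall y \near x, f y = g y) -> differentiable f x -> differentiable g x.
Proof.
move=> fg /differentiableP df.
exact: is_diff_differentiable (is_diff_near_eq fg df).
Qed.

Lemma is_derive_diff V (c : R -> V) (t : R) (d : V) :
  is_derive t (1 : R) c d -> is_diff t c (fun h => h *: d).
Proof.
move=> [cd cE]; have /derivable1_diffP dc := cd.
apply: DiffDef => //; apply/funext => h /=.
by rewrite -cE deriveE// -{1}[h]mulr1 -linearZ.
Qed.

Lemma is_diff_derive V W (f df : V -> W) (x v : V) :
  is_diff x f df -> is_derive x v f (df v).
Proof.
move=> fdf; have dfx := is_diff_differentiable fdf.
apply: DeriveDef; first exact: diff_derivable.
by rewrite deriveE// (is_diffE fdf).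
Qed.

Lemma is_derive_comp_diff V W (f df : V -> W) (c : R -> V) (t : R) (d : V) :
  is_derive t (1 : R) c d -> is_diff (c t) f df ->
  is_derive t (1 : R) (f \o c) (df d).
Proof.
move=> /is_derive_diff cd fdf.
have := is_diff_derive (1 : R) (is_diff_comp cd fdf).
by rewrite /= scale1r.
Qed.

Lemma is_derive_comp_real V (c : R -> V) (g : R -> R) (t g' : R) (d : V) :
  is_derive t (1 : R) g g' -> is_derive (g t) (1 : R) c d ->
  is_derive t (1 : R) (c \o g) (g' *: d).
Proof.
move=> gd /is_derive_diff cd.
exact: is_derive_comp_diff cd.
Qed.

Lemma is_derive_continuous V (c : R -> V) (t : R) (d : V) :
  is_derive t (1 : R) c d -> {for t, continuous c}.
Proof.
move=> /is_derive_diff cd; apply: differentiable_continuous.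
exact: is_diff_differentiable cd.
Qed.

Lemma is_diff_linear V W (l : {linear V -> W}) (x : V) :
  continuous l -> is_diff x l l.
Proof.
move=> lc; apply: DiffDef; first exact: linear_differentiable.
exact: diff_lin.
Qed.

Lemma is_derive_linear V W (l : {linear V -> W}) (c : R -> V) (t : R) (d : V) :
  continuous l -> is_derive t (1 : R) c d ->
  is_derive t (1 : R) (l \o c) (l d).
Proof. by move=> lc cd; apply: is_derive_comp_diff cd _; exact: is_diff_linear. Qed.

Lemma is_diff_scale V W (f df : V -> R) (g dg : V -> W) (x : V) :
  is_diff x f df -> is_diff x g dg ->
  is_diff x (fun y => f y *: g y) (fun v => f x *: dg v + df v *: g x).
Proof.
move=> fD gD.
have <- := is_diffE fD; have <- := is_diffE gD.
have fd := is_diff_differentiable fD.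
have gd := is_diff_differentiable gD.
pose J := fun v => f x *: 'd g x v + 'd f x v *: g x.
have Jlin : linear J.
  move=> a u v; rewrite /J (linearP ('d f x)) (linearP ('d g x)) /= scalerDl -scalerA.
  lincomb R.
pose JM := GRing.isLinear.Build _ _ _ _ _ Jlin.
pose JL : {linear _ -> _} := HB.pack J JM.
have dgc : continuous ('d g x) by exact: diff_continuous.
have Jc : continuous J.
  move=> u; apply: cvgD; first by apply: cvgZr; exact: dgc.
  by apply: cvgZl; exact: diff_continuous.
rewrite -/J -[J]/(JL : _ -> _); apply: is_diff_eps => // e e0.
have [k k0 kP] := linear_lipschitz dgc.
have fc : f (v + x) @[v --> 0] --> f x.
  have fxc : {for x, continuous f} by exact: differentiable_continuous.
  by rewrite cvg_comp_shift add0r.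
(* One third of [e] for each of the three terms of the decomposition below; the [+ 1] covers the
   case where [f x] or [g x] vanishes. *)
have e1 : 0 < e / 3 / (`|f x| + 1) by rewrite divr_gt0 ?divr_gt0 ?ltr_wpDl.
have e2 : 0 < e / 3 / (`|g x| + 1) by rewrite divr_gt0 ?divr_gt0 ?ltr_wpDl.
have e3 : 0 < e / 3 / k by rewrite divr_gt0 ?divr_gt0.
near=> v.
have -> : f (v + x) *: g (v + x) - f x *: g x - JL v =
  f (v + x) *: (g (v + x) - g x - 'd g x v) + (f (v + x) - f x - 'd f x v) *: g x
  + (f (v + x) - f x) *: 'd g x v.
  by rewrite [JL v]/(J v) /J; lincomb R.
have h1 : `|f (v + x) *: (g (v + x) - g x - 'd g x v)| <= e / 3 * `|v|.
  rewrite normrZ -[e / 3](@divfK _ (`|f x| + 1)) ?gt_eqF ?ltr_wpDl//.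
  rewrite [_ * (_ + 1)]mulrC -mulrA ler_pM//.
    apply: ltW; near: v; apply: (cvgr_lt `|f x|); last by rewrite ltrDl.
    exact: cvg_norm.
  by near: v; exact: is_diff_near_le.
have h2 : `|(f (v + x) - f x - 'd f x v) *: g x| <= e / 3 * `|v|.
  rewrite normrZ -[e / 3](@divfK _ (`|g x| + 1)) ?gt_eqF ?ltr_wpDl//.
  rewrite mulrAC ler_pM ?lerDl//.
  by near: v; exact: is_diff_near_le.
have h3 : `|(f (v + x) - f x) *: 'd g x v| <= e / 3 * `|v|.
  rewrite normrZ -[e / 3](@divfK _ k) ?gt_eqF// -[_ * k * _]mulrA ler_pM//.
  by rewrite distrC; near: v; move/cvgrPdist_le : fc; exact.
have -> : e * `|v| = e / 3 * `|v| + e / 3 * `|v| + e / 3 * `|v| by field.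
by rewrite (le_trans (ler_normD _ _))// lerD// (le_trans (ler_normD _ _))// lerD.
Unshelve. all: by end_near. Qed.

End Differentials.

(** A basis with continuous dual coordinates. Neither completeness nor a euclidean norm is at hand,
    so integration, limits and mean values are reduced to real functions through the [l i]. The
    property passes to products, which is needed for states made of time, parameter and position. *)
Class findim (R : realType) (V : normedModType R) : Prop := FinDim :
  exists n (e : 'I_n -> V) (l : 'I_n -> {linear V -> R}),
    [/\ forall i, continuous (l i), forall v, v = \sum_i l i v *: e i &
        forall i j, l i (e j) = (i == j)%:R].

(** * Finite dimension of the line, of row vectors and of products *)

Section FiniteDimension.
Context {R : realType}.

Global Instance findim_real : findim (R : normedModType R).
Proof.
exists 1%N, (fun=> 1), (fun=> idfun); split => [i x|v|i j].
- exact: cvg_id.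
- by rewrite big_ord1; exact: (esym (mulr1 v)).
- by rewrite !ord1 eqxx.
Qed.

Global Instance findim_rV n : findim ('rV[R]_n : normedModType R).
Proof.
have lin i : linear (fun v : 'rV[R]_n => v ord0 i : R).
  by move=> a u v; rewrite !mxE.
pose l i : {linear 'rV[R]_n -> R} :=
  HB.pack (fun v : 'rV[R]_n => v ord0 i : R) (GRing.isLinear.Build _ _ _ _ _ (lin i)).
exists n, (fun i => delta_mx ord0 i), l; split => [i|v|i j].
- exact: coord_continuous.
- exact: row_sum_delta.
- by rewrite /= mxE eqxx /= eq_sym.
Qed.

Global Instance findim_prod (V W : normedModType R) (fV : findim V) (fW : findim W) :
  findim ((V * W)%type : normedModType R).
Proof.
have [n [e [l [lc le ld]]]] := fV; have [m [f [k [kc kf kd]]]] := fW.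
have lin1 i : linear (fun v : V * W => l i v.1 : R).
  by move=> a u v; exact: (linearP (l i)).
have lin2 i : linear (fun v : V * W => k i v.2 : R).
  by move=> a u v; exact: (linearP (k i)).
pose L1 i : {linear (V * W)%type -> R} :=
  HB.pack (fun v : V * W => l i v.1 : R) (GRing.isLinear.Build _ _ _ _ _ (lin1 i)).
pose L2 i : {linear (V * W)%type -> R} :=
  HB.pack (fun v : V * W => k i v.2 : R) (GRing.isLinear.Build _ _ _ _ _ (lin2 i)).
pose E (i : 'I_(n + m)%N) : V * W :=
  match fintype.split i with inl j => (e j, 0 : W) | inr j => (0 : V, f j) end.
pose L (i : 'I_(n + m)%N) : {linear (V * W)%type -> R} :=
  match fintype.split i with inl j => L1 j | inr j => L2 j end.
have El i : E (lshift m i) = (e i, 0) by rewrite /E (unsplitK (inl i)).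
have Er i : E (rshift n i) = (0, f i) by rewrite /E (unsplitK (inr i)).
have Ll i : L (lshift m i) = L1 i by rewrite /L (unsplitK (inl i)).
have Lr i : L (rshift n i) = L2 i by rewrite /L (unsplitK (inr i)).
exists (n + m)%N, E, L; split => [i|[v w]|i j].
- case: (split_ordP i) => j ->; rewrite ?Ll ?Lr => x /=.
    by apply: continuous_comp; [exact: cvg_fst|exact: lc].
  by apply: continuous_comp; [exact: cvg_snd|exact: kc].
- rewrite big_split_ord /=.
  under eq_bigr do rewrite El Ll /=.
  under [X in _ = _ + X]eq_bigr do rewrite Er Lr /=.
  have -> : \sum_(i < n) l i v *: (e i, 0 : W) = (v, 0).
    apply: injective_projections; rewrite /= raddf_sum /=; first exact/esym/le.
    by rewrite big1// => i _; rewrite scaler0.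
  have -> : \sum_(i < m) k i w *: (0 : V, f i) = (0, w).
    apply: injective_projections; rewrite /= raddf_sum /=; last exact/esym/kf.
    by rewrite big1// => i _; rewrite scaler0.
  by apply: injective_projections; rewrite /= ?addr0 ?add0r.
- case: (split_ordP i) => i' ->; case: (split_ordP j) => j' ->.
  + by rewrite Ll El /= ld (inj_eq (@lshift_inj _ _)).
  + by rewrite Ll Er /= linear0 eq_lrshift.
  + by rewrite Lr El /= linear0 eq_rlshift.
  + by rewrite Lr Er /= kd (inj_eq (@rshift_inj _ _)).
Qed.

End FiniteDimension.

(** * Closure properties of the classes C^k *)

Section SmoothMaps.
Context {R : realType}.
Implicit Types U V W X : normedModType R.

Lemma open_near (T : topologicalType) (A : set T) x : open A -> A x -> \forall y \near x, A y.
Proof. by move=> oA Ax; exact: open_nbhs_nbhs. Qed.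

Lemma class_C_differentiable k V W (A : set V) (f : V -> W) x :
  class_C k.+1 A f -> A x -> differentiable f x.
Proof. by case=> fd _; exact: fd. Qed.

Lemma class_C_diff k V W (A : set V) (f : V -> W) v :
  class_C k.+1 A f -> class_C k A (fun x => 'd f x v).
Proof. by case=> _; exact. Qed.

Lemma class_CW k V W (A : set V) (f : V -> W) : class_C k.+1 A f -> class_C k A f.
Proof.
elim: k W f => [|k IHk] W f fA.
  by move=> x Ax; exact: differentiable_continuous (class_C_differentiable fA Ax).
split=> [x Ax|v]; first exact: class_C_differentiable fA Ax.
by apply: IHk; exact: class_C_diff.
Qed.

Lemma class_C_continuous k V W (A : set V) (f : V -> W) x :
  class_C k A f -> A x -> {for x, continuous f}.
Proof. by elim: k => [|k IHk] fA; [exact: fA|exact/IHk/class_CW]. Qed.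

Lemma class_C_ext k V W (A : set V) (f g : V -> W) : open A ->
  (forall x, A x -> f x = g x) -> class_C k A f -> class_C k A g.
Proof.
move=> oA; elim: k f g => [|k IHk] f g fg fA.
  move=> x Ax; have := fA x Ax.
  rewrite /prop_for /continuous_at (fg x Ax); apply: cvg_trans.
  apply: near_eq_cvg; have := open_near oA Ax.
  by apply: filterS => y Ay; rewrite fg.
have near_fg x : A x -> \forall y \near x, f y = g y.
  by move=> Ax; apply: filterS (open_near oA Ax); exact: fg.
split=> [x Ax|v].
  by apply: near_eq_differentiable (near_fg x Ax) _; exact: class_C_differentiable fA Ax.
apply: IHk (class_C_diff v fA) => x Ax.
by rewrite (near_eq_diff (near_fg x Ax))//; exact: class_C_differentiable fA Ax.
Qed.

Lemma class_C_sub k V W (A B : set V) (f : V -> W) :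
  B `<=` A -> class_C k A f -> class_C k B f.
Proof.
move=> BA; elim: k f => [|k IHk] f fA; first by move=> x /BA; exact: fA.
split=> [x /BA Ax|v]; first exact: class_C_differentiable fA Ax.
by apply: IHk; exact: class_C_diff.
Qed.

Lemma class_C_cst k V W (A : set V) (c : W) : class_C k A (fun=> c).
Proof.
elim: k c => [|k IHk] c; first by move=> x _; exact: cst_continuous.
split=> [x _|v]; first exact: differentiable_cst.
have -> : (fun x : V => 'd (fun=> c) x v) = (fun=> 0 : W); last exact: IHk.
by apply/funext => x; rewrite (diff_cst c x).
Qed.

Lemma class_C_lin k V W (A : set V) (l : {linear V -> W}) :
  continuous l -> class_C k A l.
Proof.
move=> lc; case: k => [|k]; first by move=> x _; exact: lc.
split=> [x _|v]; first exact: linear_differentiable.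
have -> : (fun x : V => 'd l x v) = (fun=> l v); last exact: class_C_cst.
by apply/funext => x; rewrite diff_lin.
Qed.

Lemma class_C_id k V (A : set V) : class_C k A (@id V).
Proof. by apply: (@class_C_lin k V V A idfun) => x; exact: cvg_id. Qed.

(** The common induction step of the closure properties: it suffices to know an explicit formula for
    the differential whose values in fixed directions are of class C^k. *)
Lemma class_C_step k V W (A : set V) (f : V -> W) (df : V -> V -> W) : open A ->
  (forall x, A x -> is_diff x f (df x)) ->
  (forall v, class_C k A (df ^~ v)) -> class_C k.+1 A f.
Proof.
move=> oA fdf dfA; split=> [x Ax|v]; first exact: is_diff_differentiable (fdf x Ax).
by apply: class_C_ext (dfA v) => // x Ax; rewrite (is_diffE (fdf x Ax)).
Qed.

Lemma class_C_is_diff k V W (A : set V) (f : V -> W) x :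
  class_C k.+1 A f -> A x -> is_diff x f ('d f x).
Proof. by move=> fA Ax; apply: differentiableP; exact: class_C_differentiable fA Ax. Qed.

Lemma class_C_add k V W (A : set V) (f g : V -> W) : open A ->
  class_C k A f -> class_C k A g -> class_C k A (fun x => f x + g x).
Proof.
move=> oA; elim: k f g => [|k IHk] f g fA gA.
  by move=> x Ax; apply: cvgD; [exact: fA|exact: gA].
apply: (@class_C_step _ _ _ _ _ (fun x v => 'd f x v + 'd g x v)) => // [x Ax|v].
  exact: is_diffD (class_C_is_diff fA Ax) (class_C_is_diff gA Ax).
by apply: IHk; exact: class_C_diff.
Qed.

Lemma class_C_comp_lin k V W X (A : set V) (f : V -> W) (l : {linear W -> X}) :
  open A -> continuous l -> class_C k A f -> class_C k A (l \o f).
Proof.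
move=> oA lc; elim: k f => [|k IHk] f fA.
  by move=> x Ax; apply: continuous_comp; [exact: fA|exact: lc].
apply: (@class_C_step _ _ _ _ _ (fun x => l \o 'd f x)) => // [x Ax|v].
  by apply: is_diff_comp; [exact: (class_C_is_diff fA Ax)|exact: is_diff_linear].
exact: IHk (class_C_diff v fA).
Qed.

Lemma class_C_opp k V W (A : set V) (f : V -> W) : open A ->
  class_C k A f -> class_C k A (fun x => - f x).
Proof.
move=> oA; elim: k f => [|k IHk] f fA.
  by move=> x Ax; apply: cvgN; exact: fA.
apply: (@class_C_step _ _ _ _ _ (fun x v => - 'd f x v)) => // [x Ax|v].
  exact: is_diffN (class_C_is_diff fA Ax).
by apply: IHk; exact: class_C_diff.
Qed.

Lemma class_C_sum k V W (A : set V) (I : Type) (r : seq I) (P : pred I) (f : I -> V -> W) :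
  open A -> (forall i, class_C k A (f i)) ->
  class_C k A (fun x => \sum_(i <- r | P i) f i x).
Proof.
move=> oA fA; elim: r => [|i r IHr].
  by under [X in class_C _ _ X]eq_fun do rewrite big_nil; exact: class_C_cst.
under [X in class_C _ _ X]eq_fun do rewrite big_cons.
by case: (P i) => //; exact: class_C_add.
Qed.

Lemma class_C_scale k V W (A : set V) (f : V -> R) (g : V -> W) : open A ->
  class_C k A f -> class_C k A g -> class_C k A (fun x => f x *: g x).
Proof.
move=> oA; elim: k f g => [|k IHk] f g fA gA.
  by move=> x Ax; apply: cvgZ; [exact: fA|exact: gA].
apply: (@class_C_step _ _ _ _ _ (fun x v => f x *: 'd g x v + 'd f x v *: g x))
    => // [x Ax|v].
  exact: is_diff_scale (class_C_is_diff fA Ax) (class_C_is_diff gA Ax).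
apply: class_C_add => //.
  exact: IHk (class_CW fA) (class_C_diff v gA).
exact: IHk (class_C_diff v fA) (class_CW gA).
Qed.

Lemma class_C_mul k V (A : set V) (f g : V -> R) : open A ->
  class_C k A f -> class_C k A g -> class_C k A (fun x => f x * g x).
Proof. exact: class_C_scale. Qed.

Lemma class_C_pair k V W X (A : set V) (f : V -> W) (g : V -> X) : open A ->
  class_C k A f -> class_C k A g -> class_C k A (fun x => (f x, g x)).
Proof.
move=> oA; elim: k f g => [|k IHk] f g fA gA.
  by move=> x Ax; apply: cvg_pair; [exact: fA|exact: gA].
apply: (@class_C_step _ _ _ _ _ (fun x v => ('d f x v, 'd g x v))) => // [x Ax|v].
  exact: is_diff_pair (class_C_is_diff fA Ax) (class_C_is_diff gA Ax).
by apply: IHk; exact: class_C_diff.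
Qed.

Lemma class_C_fst k V W X (A : set V) (f : V -> W * X) : open A ->
  class_C k A f -> class_C k A (fun x => (f x).1).
Proof.
by move=> oA; apply: (@class_C_comp_lin _ _ _ _ _ _ fst) => // x; exact: cvg_fst.
Qed.

Lemma class_C_snd k V W X (A : set V) (f : V -> W * X) : open A ->
  class_C k A f -> class_C k A (fun x => (f x).2).
Proof.
by move=> oA; apply: (@class_C_comp_lin _ _ _ _ _ _ snd) => // x; exact: cvg_snd.
Qed.

(** Class C^k controls differentials in fixed directions, whereas the chain rule applies ['d g] to
    the moving vector ['d f x v]. Expanding this vector in a basis of [W] gives a sum of products,
    to which the induction hypothesis applies. *)
Lemma class_C_comp k V W X (fW : findim W) (A : set V) (B : set W) (f : V -> W) (g : W -> X) :
  open A -> (forall x, A x -> B (f x)) ->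
  class_C k A f -> class_C k B g -> class_C k A (fun x => g (f x)).
Proof.
move=> oA AB; have [n [e [l [lc le _]]]] := fW.
elim: k X f g AB => [|k IHk] X f g AB fA gB.
  by move=> x Ax; apply: continuous_comp; [exact: fA|exact/gB/AB].
apply: (@class_C_step _ _ _ _ _ (fun x => 'd g (f x) \o 'd f x)) => // [x Ax|v].
  exact: is_diff_comp (class_C_is_diff fA Ax) (class_C_is_diff gB (AB x Ax)).
have -> : (fun x => ('d g (f x) \o 'd f x) v) =
    (fun x => \sum_i l i ('d f x v) *: 'd g (f x) (e i)).
  apply/funext => x /=; rewrite [in LHS](le ('d f x v)) linear_sum.
  by apply: eq_bigr => i _; rewrite linearZ.
apply: class_C_sum => // i; apply: class_C_scale => //.
  by apply: (class_C_comp_lin oA (lc i)); exact: class_C_diff.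
by apply: (IHk _ f (fun y => 'd g y (e i))) => //; [exact: class_CW|exact: class_C_diff].
Qed.

Lemma class_C_is_derive k W (A : set R) (f df : R -> W) : open A ->
  (forall x, A x -> is_derive x (1 : R) f (df x)) -> class_C k A df -> class_C k.+1 A f.
Proof.
move=> oA fdf dfA.
apply: (@class_C_step k R W A f (fun x h => h *: df x)) => // [x Ax|v].
  exact: is_derive_diff (fdf x Ax).
by apply: class_C_scale => //; exact: class_C_cst.
Qed.

Lemma open_neq0 : open [set x : R | x != 0].
Proof. exact: open_neq. Qed.

Lemma class_C_inv_real k : class_C k [set x : R | x != 0] (fun x => x^-1).
Proof.
elim: k => [|k IHk]; first by move=> x x0; exact: inv_continuous.
apply: (@class_C_is_derive _ _ _ _ (fun x : R => - (x^-1 * x^-1))).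
- exact: open_neq0.
- move=> x x0; apply: is_derive_eq (is_deriveV x0 (is_derive_id x (1 : R))) _.
  by rewrite expr2 invfM scaleNr -[_ *: _]/(_ * _) mulr1.
- by apply: class_C_opp; [exact: open_neq0|apply: class_C_mul => //; exact: open_neq0].
Qed.

Lemma class_C_sqrt_real k : class_C k [set x : R | 0 < x] Num.sqrt.
Proof.
elim: k => [|k IHk]; first by move=> x _; exact: sqrt_continuous.
apply: (@class_C_is_derive _ _ _ _ (fun x : R => (2 * Num.sqrt x)^-1)).
- exact: open_gt.
- apply: (@class_C_comp _ _ _ _ _ _ [set x : R | x != 0] (fun x : R => 2 * Num.sqrt x)) => //.
  + by move=> x /= x0; rewrite mulf_neq0// gt_eqF// sqrtr_gt0.
  + by apply: class_C_mul => //; exact: class_C_cst.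
  + exact: class_C_inv_real.
Qed.

Lemma class_C_powR_real k (a : R) : class_C k [set x : R | 0 < x] (fun x => x `^ a).
Proof.
elim: k a => [|k IHk] a.
  by move=> x x0; apply: is_derive_continuous; exact: is_derive1_powR.
apply: (@class_C_is_derive _ _ _ _ (fun x : R => a * x `^ (a - 1))).
- exact: open_gt.
- by apply: class_C_mul; [exact: open_gt|exact: class_C_cst|exact: IHk].
Qed.

Lemma class_C_inv k V (A : set V) (f : V -> R) : open A ->
  (forall x, A x -> f x != 0) -> class_C k A f -> class_C k A (fun x => (f x)^-1).
Proof.
move=> oA f0 fA.
by apply: (@class_C_comp _ _ _ _ _ _ _ f _ oA f0 fA); exact: class_C_inv_real.
Qed.

Lemma class_C_sqrt k V (A : set V) (f : V -> R) : open A ->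
  (forall x, A x -> 0 < f x) -> class_C k A f -> class_C k A (fun x => Num.sqrt (f x)).
Proof.
move=> oA f0 fA.
by apply: (@class_C_comp _ _ _ _ _ _ _ f _ oA f0 fA); exact: class_C_sqrt_real.
Qed.

Lemma class_C_exp k V (A : set V) (f : V -> R) n : open A ->
  class_C k A f -> class_C k A (fun x => f x ^+ n).
Proof.
move=> oA fA; elim: n => [|n IHn].
  by under [X in class_C _ _ X]eq_fun do rewrite expr0; exact: class_C_cst.
by under [X in class_C _ _ X]eq_fun do rewrite exprS; exact: class_C_mul.
Qed.

Lemma class_C_prod k V (A : set V) (I : Type) (r : seq I) (P : pred I) (f : I -> V -> R) :
  open A -> (forall i, class_C k A (f i)) ->
  class_C k A (fun x => \prod_(i <- r | P i) f i x).
Proof.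
move=> oA fA; elim: r => [|i r IHr].
  by under [X in class_C _ _ X]eq_fun do rewrite big_nil; exact: class_C_cst.
under [X in class_C _ _ X]eq_fun do rewrite big_cons.
by case: (P i) => //; exact: class_C_mul.
Qed.

End SmoothMaps.

(** * Mean value inequality, strict differentiability, Gronwall's inequality *)

Section MeanValue.
Context {R : realType}.
Implicit Types U V W X : normedModType R.

Lemma is_derive_within_continuous (f df : R -> R) (a b : R) :
  (forall t, a <= t <= b -> is_derive t (1 : R) f (df t)) ->
  {within `[a, b], continuous f}.
Proof.
move=> fdf; apply: derivable_within_continuous => t; rewrite in_itv /= => tab.
by have := fdf t tab; case.
Qed.

Lemma is_derive_ge0_le (f df : R -> R) (a b : R) : a <= b ->
  (forall t, a <= t <= b -> is_derive t (1 : R) f (df t)) ->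
  (forall t, a <= t <= b -> 0 <= df t) -> f a <= f b.
Proof.
move=> ab fdf df0; have fab : forall x, x \in `]a, b[%R -> is_derive x (1 : R) f (df x).
  by move=> x; rewrite in_itv /= => /andP[/ltW ax /ltW xb]; apply: fdf; rewrite ax.
have [c cab fE] := MVT_segment ab fab (is_derive_within_continuous fdf).
by rewrite -subr_ge0 fE mulr_ge0 ?subr_ge0// df0//; move: cab; rewrite in_itv.
Qed.

(** The constant [K], absent from the usual inequality, is the price of arguing coordinate by
    coordinate; it depends on the space only. The bound on the derivative is itself a derivative
    [dg], because [picard] integrates an exponential bound. *)
Lemma mean_value_le V (fV : findim V) : exists2 K : R, 0 < K &
  forall (f df : R -> V) (g dg : R -> R) (a b : R), a <= b ->
  (forall t, a <= t <= b -> is_derive t (1 : R) f (df t)) ->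
  (forall t, a <= t <= b -> is_derive t (1 : R) g (dg t)) ->
  (forall t, a <= t <= b -> `|df t| <= dg t) ->
  `|f b - f a| <= K * (g b - g a).
Proof.
have [n [e [l [lc le _]]]] := fV.
have kP i : exists k : R, 0 < k /\ forall v, `|l i v| <= k * `|v|.
  by have [k k0 kP] := linear_lipschitz (lc i); exists k.
pose k i := sval (cid (kP i)).
have k0 i : 0 < k i by rewrite /k; case: cid => ? [].
have kl i v : `|l i v| <= k i * `|v| by rewrite /k; case: cid => ? [].
(* The [1 +] keeps the constant positive, even in dimension 0. *)
exists (1 + \sum_i k i * `|e i|).
  by rewrite ltr_pwDl// sumr_ge0// => i _; rewrite mulr_ge0// ltW.
move=> f df g dg a b ab fD gD dfdg.
have dg0 t : a <= t <= b -> 0 <= dg t by move=> /dfdg; exact: le_trans.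
have gab : g a <= g b by apply: is_derive_ge0_le gD _.
suff lfle i : `|l i (f b - f a)| <= k i * (g b - g a).
  rewrite [f b - f a]le mulrDl mul1r mulr_suml.
  rewrite (le_trans (ler_norm_sum _ _ _))//.
  rewrite (@le_trans _ _ (\sum_i k i * `|e i| * (g b - g a)))//; last first.
    by rewrite lerDr subr_ge0.
  by apply: ler_sum => i _; rewrite normrZ mulrAC ler_wpM2r.
have lf t : a <= t <= b -> is_derive t (1 : R) (l i \o f) (l i (df t)).
  by move=> tab; apply: is_derive_linear => //; exact: fD.
have kg t : a <= t <= b -> is_derive t (1 : R) (fun t => k i * g t) (k i * dg t).
  by move=> tab; exact: is_deriveZ (gD t tab).
have lb t : a <= t <= b -> `|l i (df t)| <= k i * dg t.
  by move=> tab; rewrite (le_trans (kl _ _))// ler_pM2l// dfdg.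
(* Each half says that one of [k i * g + l i \o f] and [k i * g - l i \o f] does not decrease. *)
rewrite raddfB ler_norml; apply/andP; split.
- have h t : a <= t <= b ->
    is_derive t (1 : R) (fun t => k i * g t + l i (f t)) (k i * dg t + l i (df t)).
    by move=> tab; exact: is_deriveD (kg t tab) (lf t tab).
  have := @is_derive_ge0_le _ _ _ _ ab h _.
  rewrite -subr_ge0 => hh; rewrite -subr_ge0.
  suff : 0 <= k i * g b + l i (f b) - (k i * g a + l i (f a)) by lra.
  apply: hh => t tab; have := lb t tab; rewrite ler_norml => /andP[+ _].
  by rewrite -subr_ge0 opprK addrC.
- have h t : a <= t <= b ->
    is_derive t (1 : R) (fun t => k i * g t - l i (f t)) (k i * dg t - l i (df t)).
    by move=> tab; exact: is_deriveB (kg t tab) (lf t tab).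
  have := @is_derive_ge0_le _ _ _ _ ab h _.
  rewrite -subr_ge0 => hh; rewrite -subr_ge0.
  suff : 0 <= k i * g b - l i (f b) - (k i * g a - l i (f a)) by lra.
  by apply: hh => t tab; have := lb t tab; rewrite ler_norml => /andP[_]; rewrite subr_ge0.
Qed.

(** As [k] does not depend on [f], closeness of two differentials can be tested on a basis, that is,
    on the finitely many directional derivatives that [class_C] controls. *)
Lemma linear_le_basis V W (fV : findim V) : exists n (e : 'I_n -> V), exists2 k : R, 0 < k &
  forall (f : {linear V -> W}) (M : R), (forall i, `|f (e i)| <= M) ->
  forall v, `|f v| <= k * M * `|v|.
Proof.
have [n [e [l [lc le _]]]] := fV.
have kP i : exists k : R, 0 < k /\ forall v, `|l i v| <= k * `|v|.
  by have [k k0 kP] := linear_lipschitz (lc i); exists k.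
pose k i := sval (cid (kP i)).
have k0 i : 0 < k i by rewrite /k; case: cid => ? [].
have kl i v : `|l i v| <= k i * `|v| by rewrite /k; case: cid => ? [].
exists n, e, (1 + \sum_i k i).
  by rewrite ltr_pwDl// sumr_ge0// => i _; rewrite ltW.
move=> f M fM v.
(* In dimension 0 the hypothesis says nothing about the sign of [M]. *)
case: n => [|n] in e l lc le kP k k0 kl fM *.
  by rewrite (le v) big_ord0 linear0 !normr0 mulr0.
have M0 : 0 <= M by rewrite (le_trans _ (fM ord0)).
rewrite [in leLHS](le v) linear_sum (le_trans (ler_norm_sum _ _ _))//.
rewrite (@le_trans _ _ (\sum_i k i * M * `|v|))//.
  apply: ler_sum => i _; rewrite linearZ normrZ mulrAC ler_pM//; exact: kl.
rewrite -mulr_suml ler_wpM2r// -mulr_suml ler_wpM2r// lerDr//.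
Qed.

(** On a small ball the differential of [f - 'd f p] is small by continuity, and the mean value
    inequality along segments applies. This yields the local Lipschitz bounds for differential
    equations as well as the local injectivity used in uniqueness arguments. *)
Lemma strict_diff V W (fV : findim V) (fW : findim W) (A : set V) (f : V -> W) (p : V) (eta : R) :
  open A -> class_C 1 A f -> A p -> 0 < eta ->
  exists2 r : R, 0 < r & [/\ ball p r `<=` A,
    forall x v, ball p r x -> `|'d f x v - 'd f p v| <= eta * `|v| &
    forall x y, ball p r x -> ball p r y ->
      `|f x - f y - 'd f p (x - y)| <= eta * `|x - y|].
Proof.
move=> oA fA Ap eta0.
have [K K0 mv] := mean_value_le fW.
have [n [e [k k0 lb]]] := @linear_le_basis V W fV.
have dfc i : 'd f y (e i) @[y --> p] --> 'd f p (e i).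
  exact: (class_C_continuous (class_C_diff (e i) fA) Ap).
(* [k] comes from testing on a basis and [K] from the mean value inequality; with [K + 1], both
   [k * M] and [K * (k * M)] are at most [eta]. *)
pose M := eta / ((K + 1) * k).
have M0 : 0 < M by rewrite divr_gt0// mulr_gt0// addr_gt0.
have kM : k * M * (K + 1) = eta by rewrite /M; field; rewrite !gt_eqF// addr_gt0.
have nearM : \forall y \near p, A y /\ forall i, `|'d f y (e i) - 'd f p (e i)| <= M.
  have dfM : \forall y \near p, forall i, `|'d f y (e i) - 'd f p (e i)| <= M.
    apply: filter_forall => i.
    by have /cvgrPdist_le/(_ M M0) := dfc i; apply: filterS => y; rewrite distrC.
  by apply: filterS2 (open_near oA Ap) dfM.
have /nbhs_ballP[r /= r0 rP] := nearM; exists r => //.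
have dfle x v : ball p r x -> `|'d f x v - 'd f p v| <= k * M * `|v|.
  by move=> /rP[Ax le]; exact: (lb ('d f x \- 'd f p)).
split=> [y /rP[]//|x v px|x y px py].
  rewrite (le_trans (dfle _ _ px))// ler_wpM2r// -kM.
  by have := mulr_gt0 (mulr_gt0 k0 M0) K0; lra.
pose c t : V := y + t *: (x - y).
have cball (t : R) : 0 <= t <= 1 -> ball p r (c t).
  move=> /andP[t0 t1]; move: px py; rewrite -ball_normE /= => px py.
  have -> : p - c t = t *: (p - x) + (1 - t) *: (p - y) by rewrite /c; lincomb R.
  rewrite (le_lt_trans (ler_normD _ _))// !normrZ !ger0_norm ?subr_ge0//.
  (* The strict inequality is taken from the term with factor [t], which gives nothing at
     [t = 0]. *)
  have [->|tn0] := eqVneq t 0; first by rewrite mul0r add0r subr0 mul1r.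
  have -> : r = t * r + (1 - t) * r by ring.
  have tpos : 0 < t by rewrite lt_neqAle eq_sym tn0.
  have t1' : 0 <= 1 - t by rewrite subr_ge0.
  by apply: ltr_leD; [rewrite ltr_pM2l|rewrite ler_wpM2l// ltW].
have cD (t : R) : is_derive t (1 : R) c (x - y).
  have lD : is_derive t (1 : R) (fun t => t *: (x - y)) (1 *: (x - y)).
    have idD : is_diff t (fun t : R => t) id by exact: is_diff_id.
    have cstD : is_diff t (fun=> x - y : V) (fun=> 0) by exact: is_diff_cst.
    have := is_diff_derive (1 : R) (is_diff_scale idD cstD).
    by rewrite scaler0 add0r.
  have := is_deriveD (is_derive_cst y t (1 : R)) lD.
  by rewrite add0r scale1r.
pose g t := f (c t) - 'd f p (c t).
have gD (t : R) : 0 <= t <= 1 -> is_derive t (1 : R) g ('d f (c t) (x - y) - 'd f p (x - y)).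
  move=> t01; have [At _] := rP _ (cball t t01).
  apply: is_deriveB.
    exact: is_derive_comp_diff (cD t) (class_C_is_diff fA At).
  apply: is_derive_linear => //; apply: diff_continuous.
  exact: class_C_differentiable fA Ap.
have hD (t : R) : 0 <= t <= 1 ->
    is_derive t (1 : R) (fun t : R => k * M * `|x - y| * t) (k * M * `|x - y|).
  move=> _; apply: is_derive_eq (is_deriveZ _ (is_derive_id t (1 : R))) _.
  exact: mulr1.
have dgle (t : R) : 0 <= t <= 1 -> `|'d f (c t) (x - y) - 'd f p (x - y)| <= k * M * `|x - y|.
  by move=> t01; apply: dfle; exact: cball.
have := mv g _ _ _ 0 1 ler01 gD hD dgle.
have c1 : c 1 = x by rewrite /c; lincomb R.
have c0 : c 0 = y by rewrite /c; lincomb R.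
rewrite /g c1 c0 mulr0 subr0 mulr1.
have -> : f x - 'd f p x - (f y - 'd f p y) = f x - f y - 'd f p (x - y).
  by rewrite (linearB ('d f p)); lincomb R.
move=> /le_trans; apply; rewrite -kM.
by have := mulr_ge0 (ltW (mulr_gt0 k0 M0)) (normr_ge0 (x - y)); lra.
Qed.

Lemma gronwall_real (f df : R -> R) (a b : R) : 0 <= a -> 0 <= b ->
  (forall t : R, 0 <= t <= 1 -> is_derive t (1 : R) f (df t)) ->
  (forall t : R, 0 <= t <= 1 -> df t <= a * f t + b) ->
  forall t : R, 0 <= t <= 1 -> 0 <= f t -> f t <= expR a * (f 0 + b).
Proof.
move=> a0 b0 fD dfle t /andP[t0 t1] ft0.
(* This function does not decrease, because [df - a f <= b] and the exponential is at most 1. *)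
pose g (t : R) := b * t - f t * expR (- a * t).
have gD (u : R) : 0 <= u <= t -> is_derive u (1 : R) g
    (b - (df u - a * f u) * expR (- a * u)).
  move=> /andP[u0 ut].
  have u01 : 0 <= u <= 1 by rewrite u0 (le_trans ut).
  have eD : is_derive u (1 : R) (fun u : R => expR (- a * u)) (- a *: expR (- a * u)).
    apply: (@is_derive_comp_real R R expR (fun u : R => - a * u)).
    apply: is_derive_eq (is_deriveZ _ (is_derive_id u (1 : R))) _.
    exact: mulr1.
  have bD : is_derive u (1 : R) (fun u => b * u) b.
    apply: is_derive_eq (is_deriveZ _ (is_derive_id u (1 : R))) _.
    exact: mulr1.
  apply: is_derive_eq (is_deriveB bD (is_deriveM (fD u u01) eD)) _.
  by rewrite -![_ *: _]/(_ * _); ring.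
have : g 0 <= g t.
  apply: is_derive_ge0_le gD _ => // u /andP[u0 ut].
  have u01 : 0 <= u <= 1 by rewrite u0 (le_trans ut).
  have e0 := expR_ge0 (- a * u).
  have e1 : expR (- a * u) <= 1.
    by rewrite -expR0 ler_expR mulNr oppr_le0 mulr_ge0.
  have h : (df u - a * f u) * expR (- a * u) <= b * 1.
    rewrite (@le_trans _ _ (b * expR (- a * u)))//; last by rewrite ler_wpM2l.
    by rewrite ler_wpM2r// lerBlDl dfle.
  by rewrite subr_ge0 -[leRHS]mulr1.
rewrite /g !mulr0 expR0 mulr1 sub0r => h.
have fe : f t * expR (- a * t) <= f 0 + b.
  have : b * t <= b by rewrite -[leRHS]mulr1 ler_wpM2l.
  by lra.
have : f t = f t * expR (- a * t) * expR (a * t).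
  by rewrite -mulrA -expRD mulNr addNr expR0 mulr1.
move=> ->; rewrite mulrC (le_trans (ler_wpM2l (expR_ge0 _) fe))//.
rewrite ler_wpM2r//.
  rewrite (le_trans _ fe)// mulr_ge0// expR_ge0//.
by rewrite ler_expR -[leRHS]mulr1 ler_wpM2l.
Qed.

(** The norm of a curve need not be differentiable, so the real inequality is applied to [N], the
    sum of the squares of the coordinates, which is equivalent to the squared norm. *)
Lemma gronwall V (fV : findim V) (L : R) : exists2 B : R, 0 < B &
  forall (z dz : R -> V) (eta : R), 0 <= eta ->
  (forall t : R, 0 <= t <= 1 -> is_derive t (1 : R) z (dz t)) ->
  (forall t : R, 0 <= t <= 1 -> `|dz t| <= L * `|z t| + eta) ->
  forall t : R, 0 <= t <= 1 -> `|z t| <= B * (`|z 0| + eta).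
Proof.
have [n [e [l [lc le _]]]] := fV.
have kP i : exists k : R, 0 < k /\ forall v, `|l i v| <= k * `|v|.
  by have [k k0 kP] := linear_lipschitz (lc i); exists k.
pose k i := sval (cid (kP i)).
have k0 i : 0 < k i by rewrite /k; case: cid => ? [].
have kl i v : `|l i v| <= k i * `|v| by rewrite /k; case: cid => ? [].
pose N v := \sum_i l i v ^+ 2.
pose E := \sum_i `|e i|; pose C := \sum_i k i ^+ 2.
have E0 : 0 <= E by rewrite sumr_ge0.
have C0 : 0 <= C by rewrite sumr_ge0// => i _; rewrite sqr_ge0.
have N0 v : 0 <= N v by rewrite sumr_ge0// => i _; rewrite sqr_ge0.
have NC v : N v <= C * `|v| ^+ 2.
  rewrite mulr_suml ler_sum// => i _.
  by rewrite -exprMn -real_normK ?num_real// lerXn2r ?nnegrE ?mulr_ge0 ?(ltW (k0 i)).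
have EN v : `|v| ^+ 2 <= E ^+ 2 * N v.
  have lN i : `|l i v| <= Num.sqrt (N v).
    rewrite -sqrtr_sqr ler_wsqrtr// /N (bigD1 i)//= lerDl.
    by rewrite sumr_ge0// => j _; rewrite sqr_ge0.
  have : `|v| <= E * Num.sqrt (N v).
    rewrite [in leLHS](le v) (le_trans (ler_norm_sum _ _ _))// mulr_suml ler_sum// => i _.
    by rewrite normrZ mulrC ler_wpM2l.
  move=> h; rewrite -[N v]sqr_sqrtr// -exprMn lerXn2r ?nnegrE//.
  by rewrite mulr_ge0// sqrtr_ge0.
(* The derivative of [N \o z] is at most [2 C |z| |dz|]; bounding [2 |z| eta] by [|z|^2 + eta^2]
   leaves [C (2 |L| + 1) |z|^2 + C eta^2], and [|z|^2 <= E^2 N]. *)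
pose a := C * (2 * `|L| + 1) * E ^+ 2.
have a0 : 0 <= a by rewrite !mulr_ge0 ?sqr_ge0// addr_ge0 ?mulr_ge0.
pose X := E ^+ 2 * (expR a * C).
have X0 : 0 <= X by rewrite !mulr_ge0 ?sqr_ge0 ?expR_ge0.
(* The squared norm is bounded with the factor [X]; since [X <= (1 + X)^2], no square root is
   needed. *)
exists (1 + X); first by rewrite ltr_pwDl.
move=> z dz eta eta0 zD dzle t t01.
pose dN t := \sum_i (l i (z t) * l i (dz t) + l i (z t) * l i (dz t)).
have ND (u : R) : 0 <= u <= 1 -> is_derive u (1 : R) (N \o z) (dN u).
  move=> u01.
  have -> : N \o z = \sum_i ((l i \o z) * (l i \o z)).
    by apply/funext => w; rewrite fct_sumE.
  apply: is_derive_sum => i.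
  have lz := is_derive_linear (lc i) (zD u u01).
  exact: (is_deriveM lz lz).
have dNle (u : R) : 0 <= u <= 1 -> dN u <= a * (N \o z) u + C * eta ^+ 2.
  move=> u01; have dzu := dzle u u01.
  have zu0 := normr_ge0 (z u).
  have h1 : dN u <= C * (2 * (`|z u| * `|dz u|)).
    rewrite mulr_suml ler_sum// => i _.
    have : l i (z u) * l i (dz u) <= k i ^+ 2 * (`|z u| * `|dz u|).
      by rewrite (le_trans (ler_norm _))// normrM expr2 mulrACA ler_pM.
    lra.
  rewrite (le_trans h1)// -mulrA -mulrA -mulrDr ler_wpM2l//=.
  have h2 : `|z u| * `|dz u| <= `|z u| * (`|L| * `|z u| + eta).
    rewrite ler_wpM2l// (le_trans dzu)// lerD2r.
    by rewrite ler_wpM2r// ler_norm.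
  have h3 := EN (z u); have L0 := normr_ge0 L.
  have h4 : 2 * (`|z u| * eta) <= `|z u| ^+ 2 + eta ^+ 2.
    by have := sqr_ge0 (`|z u| - eta); nra.
  have h5 : (2 * `|L| + 1) * `|z u| ^+ 2 <= (2 * `|L| + 1) * (E ^+ 2 * N (z u)).
    by rewrite ler_wpM2l// addr_ge0// mulr_ge0.
  nra.
have /= Nt := gronwall_real a0 (mulr_ge0 C0 (sqr_ge0 eta)) ND dNle t01 (N0 _).
have s0 : 0 <= `|z 0| + eta by rewrite addr_ge0.
have zt2 : `|z t| ^+ 2 <= X * (`|z 0| + eta) ^+ 2.
  have h : N (z t) <= expR a * (C * (`|z 0| + eta) ^+ 2).
    apply: le_trans Nt _; rewrite ler_wpM2l ?expR_ge0//.
    have := NC (z 0); have := mulr_ge0 C0 (mulr_ge0 (normr_ge0 (z 0)) eta0).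
    nra.
  have -> : X * (`|z 0| + eta) ^+ 2 = E ^+ 2 * (expR a * (C * (`|z 0| + eta) ^+ 2)).
    by rewrite /X; ring.
  by apply: (le_trans (EN _)); apply: ler_wpM2l => //; exact: sqr_ge0.
rewrite -(@ler_sqr _ `|z t|) ?nnegrE// ?mulr_ge0// ?addr_ge0//.
rewrite (le_trans zt2)// exprMn ler_wpM2r ?sqr_ge0//.
nra.
Qed.

End MeanValue.

(** * Integration of curves and limits of geometric sequences *)

Section Antiderivatives.
Context {R : realType}.

Lemma antiderivative_real (f : R -> R) : continuous f ->
  exists F : R -> R, F 0 = 0 /\ forall t : R, 0 <= t <= 1 -> is_derive t (1 : R) F (f t).
Proof.
(* Integrating from -1, inside [-1, 2], makes 0 and 1 interior points, where the derivative is
   two-sided. *)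
move=> fc; pose F x : R := (\int[@lebesgue_measure R]_(t in `[(- 1)%R, x]) f t)%R.
exists (fun x => F x - F 0); split; first by rewrite subrr.
move=> t /andP[t0 t1].
have fi : (@lebesgue_measure R).-integrable `[(- 1)%R, 2%R] (EFin \o f).
  apply: continuous_compact_integrable; first exact: segment_compact.
  exact: continuous_subspaceT.
have t2 : t < 2 by rewrite (le_lt_trans t1)// ltr1n.
have t_1 : - 1 < t by rewrite (lt_le_trans _ t0)// ltrN10.
have [FD FE] := continuous_FTC1_closed t2 fi t_1 (fc t).
have FD' : is_derive t (1 : R) F (f t) by apply: DeriveDef; [exact: FD|rewrite -derive1E].
have := is_deriveB FD' (is_derive_cst (F 0) t (1 : R)).
by rewrite subr0.
Qed.

Lemma antiderivative (V : normedModType R) (fV : findim V) (f : R -> V) : continuous f ->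
  exists F : R -> V, F 0 = 0 /\ forall t : R, 0 <= t <= 1 -> is_derive t (1 : R) F (f t).
Proof.
have [n [e [l [lc le _]]]] := fV.
move=> fc.
have lfc i : continuous (l i \o f).
  by move=> t; apply: continuous_comp; [exact: fc|exact: lc].
pose G i := sval (cid (antiderivative_real (lfc i))).
have G0 i : G i 0 = 0 by rewrite /G; case: cid => ? [].
have GD i (t : R) : 0 <= t <= 1 -> is_derive t (1 : R) (G i) (l i (f t)).
  by have [_] := svalP (cid (antiderivative_real (lfc i))); apply.
exists (\sum_i (fun t => G i t *: e i)); split.
  by rewrite fct_sumE big1// => i _; rewrite G0 scale0r.
move=> t t01; rewrite [f t]le; apply: is_derive_sum => i.
have GDi := is_derive_diff (GD i t t01).
have cD : is_diff t (fun=> e i) (fun=> 0) by exact: is_diff_cst.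
have := is_diff_derive (1 : R) (is_diff_scale GDi cD).
by rewrite scaler0 add0r scale1r.
Qed.

(* The limit of the coordinates is the supremum of [v n - 2 M / 2 ^ n]. *)
Lemma geometric_limit (V : normedModType R) (fV : findim V) : exists2 K : R, 0 < K &
  forall (v : nat -> V) (M : R), 0 <= M ->
  (forall n, `|v n.+1 - v n| <= M / 2 ^+ n) ->
  exists l, forall n, `|v n - l| <= K * M / 2 ^+ n.
Proof.
have real_limit (v : nat -> R) (M : R) : 0 <= M ->
    (forall n, `|v n.+1 - v n| <= M / 2 ^+ n) ->
    exists l, forall n, `|v n - l| <= 2 * M / 2 ^+ n.
  move=> M0 vM; pose d n : R := 2 * M / 2 ^+ n.
  have d0 n : 0 <= d n by rewrite /d divr_ge0 ?mulr_ge0 ?exprn_ge0.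
  have dS n : d n.+1 = d n - M / 2 ^+ n.
    rewrite /d exprS; field; rewrite expf_neq0//.
  have vS n : v n - M / 2 ^+ n <= v n.+1 <= v n + M / 2 ^+ n.
    by have := vM n; rewrite ler_norml; move/andP=> [? ?]; apply/andP; split; lra.
  have incr n m : v n - d n <= v (n + m)%N - d (n + m)%N.
    elim: m => [|m IHm]; first by rewrite addn0.
    rewrite addnS (le_trans IHm)// dS; have := vS (n + m)%N; lra.
  have decr n m : v (n + m)%N + d (n + m)%N <= v n + d n.
    elim: m => [|m IHm]; first by rewrite addn0.
    rewrite addnS (le_trans _ IHm)// dS; have := vS (n + m)%N; lra.
  have ub n m : v n - d n <= v m + d m.
    have := incr n m; have := decr m n; rewrite addnC; have := d0 (n + m)%N; lra.
  pose E := [set v n - d n | n in [set: nat]].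
  have E0 : E !=set0 by exists (v 0%N - d 0%N), 0%N.
  exists (sup E) => n; rewrite ler_norml.
  have l1 : v n - d n <= sup E.
    apply: ub_le_sup; last by exists n.
    by exists (v 0%N + d 0%N) => _ [m _ <-]; exact: ub.
  have l2 : sup E <= v n + d n by apply: ge_sup => // _ [m _ <-]; exact: ub.
  by rewrite -/(d n); apply/andP; split; lra.
have [n [e [l [lc le _]]]] := fV.
have kP i : exists k : R, 0 < k /\ forall v, `|l i v| <= k * `|v|.
  by have [k k0 kP] := linear_lipschitz (lc i); exists k.
pose k i := sval (cid (kP i)).
have k0 i : 0 < k i by rewrite /k; case: cid => ? [].
have kl i v : `|l i v| <= k i * `|v| by rewrite /k; case: cid => ? [].
exists (1 + \sum_i 2 * k i * `|e i|).
  by rewrite ltr_pwDl// sumr_ge0// => i _; rewrite !mulr_ge0// ltW.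
move=> v M M0 vM.
have vi i : exists li, forall m, `|l i (v m) - li| <= 2 * (k i * M) / 2 ^+ m.
  apply: real_limit => [|m]; first by rewrite mulr_ge0// ltW.
  rewrite -raddfB (le_trans (kl _ _))// -mulrA ler_wpM2l ?vM//.
  exact: ltW.
pose c i := sval (cid (vi i)).
have cP i m : `|l i (v m) - c i| <= 2 * (k i * M) / 2 ^+ m.
  by rewrite /c; case: cid.
exists (\sum_i c i *: e i) => m.
rewrite [v m]le -sumrB (le_trans (ler_norm_sum _ _ _))// mulrDl mul1r mulrDl.
rewrite (@le_trans _ _ (\sum_i 2 * k i * `|e i| * M / 2 ^+ m))//; last first.
  by rewrite mulr_suml mulr_suml lerDr divr_ge0// exprn_ge0.
apply: ler_sum => i _; rewrite -scalerBl normrZ.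
have -> : 2 * k i * `|e i| * M / 2 ^+ m = 2 * (k i * M) / 2 ^+ m * `|e i| by ring.
by rewrite ler_wpM2r.
Qed.

End Antiderivatives.

(** * Picard iteration for globally Lipschitz equations *)

Section GlobalSolutions.
Context {R : realType}.

(** The retraction of the line onto [0, 1], with absolute values for an immediate proof of
    continuity. It turns curves controlled on [0, 1] into continuous functions on the line. *)
Definition clamp (t : R) : R := (`|t| - `|t - 1| + 1) / 2.

Lemma clamp_itv t : 0 <= clamp t <= 1.
Proof.
rewrite /clamp; have [t0|t0] := ger0P t; have [t1|t1] := ger0P (t - 1).
all: by apply/andP; split; lra.
Qed.

Lemma clamp_id t : 0 <= t <= 1 -> clamp t = t.
Proof.
by move=> /andP[t0 t1]; rewrite /clamp ger0_norm// ler0_norm ?subr_le0//; lra.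
Qed.

Lemma clamp_continuous : continuous clamp.
Proof.
move=> t; apply: cvgMl; apply: cvgD; last exact: cvg_cst.
apply: cvgB; apply: cvg_norm; first exact: cvg_id.
by apply: cvgB; [exact: cvg_id|exact: cvg_cst].
Qed.

Lemma continuous_clamp (V : topologicalType) (y : R -> V) :
  (forall t, 0 <= t <= 1 -> {for t, continuous y}) -> continuous (y \o clamp).
Proof.
move=> yc t; apply: continuous_comp; first exact: clamp_continuous.
exact/yc/clamp_itv.
Qed.

(** Successive iterates are compared with [expR (A * t)]: for this weight the integral operator
    contracts by 1/2 on all of [0, 1], whatever [L] is, so that the interval need not be subdivided.
    The first hypothesis on [F] is just what makes the integrands continuous. *)
Lemma picard (V : normedModType R) (fV : findim V) (F : R -> V -> V) (L : R) (z0 : V) :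
  (forall z, continuous z -> continuous (fun t => F t (z t))) ->
  (forall t x y, `|F t x - F t y| <= L * `|x - y|) ->
  exists z : R -> V, z 0 = z0 /\
    forall t : R, 0 <= t <= 1 -> is_derive t (1 : R) z (F t (z t)).
Proof.
move=> Fc; wlog L0 : L / 0 < L.
  move=> wL FL; apply: (wL (`|L| + 1)); first by rewrite ltr_wpDl.
  move=> t x y; rewrite (le_trans (FL _ _ _))// ler_wpM2r//.
  by rewrite (le_trans (ler_norm _))// lerDl.
move=> FL.
have stepP (w : R -> V) : continuous w -> exists u : R -> V, u 0 = z0 /\
    forall t : R, 0 <= t <= 1 -> is_derive t (1 : R) u (F t (w t)).
  move=> /Fc /(antiderivative fV)[G [G0 GD]].
  exists (fun t => z0 + G t); split; first by rewrite G0 addr0.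
  move=> t t01; have := is_deriveD (is_derive_cst z0 t (1 : R)) (GD t t01).
  by rewrite add0r.
pose step (w : {w : R -> V | continuous w}) : R -> V :=
  sval (cid (stepP _ (svalP w))).
have step0 w : step w 0 = z0 by rewrite /step; case: cid => ? [].
have stepD w (t : R) : 0 <= t <= 1 -> is_derive t (1 : R) (step w) (F t (sval w t)).
  by have [_] := svalP (cid (stepP _ (svalP w))); apply.
have stepc w : continuous (step w \o clamp).
  by apply: continuous_clamp => t /(stepD w); exact: is_derive_continuous.
(* Each iterate carries its continuity, which the next integration requires, and is clamped because
   antiderivatives are controlled on [0, 1] only. *)
pose W := fix W n : {w : R -> V | continuous w} := match n with
  | 0%N => exist (fun w => continuous w) (fun=> z0) (fun x => @cst_continuous R V z0 x)
  | n'.+1 => exist (fun w => continuous w) (step (W n') \o clamp) (@stepc (W n')) end.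
have WS n t : 0 <= t <= 1 -> sval (W n.+1) t = step (W n) t.
  by move=> t01 /=; rewrite clamp_id.
have [K K0 mv] := mean_value_le fV.
(* With this rate, [K] times the antiderivative [L / A * expR (A * s)] is half the weight. *)
pose A := 2 * (K * L); have A0 : 0 < A by rewrite !mulr_gt0.
have [C C0 CP] : exists2 C : R, 0 <= C &
    forall t, 0 <= t <= 1 -> `|sval (W 1%N) t - z0| <= C.
  have [c _ cP] := @EVT_max R (fun t => `|sval (W 1%N) t - z0|) 0 1 ler01
    (continuous_subspaceT (fun t => cvg_norm (cvgB (svalP (W 1%N) t) (cvg_cst z0)))).
  by exists `|sval (W 1%N) c - z0| => // t t01; apply: cP; rewrite in_itv.
have WC n t : 0 <= t <= 1 ->
    `|sval (W n.+1) t - sval (W n) t| <= C / 2 ^+ n * expR (A * t).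
  elim: n t => [|n IHn] t t01.
    rewrite expr0 divr1 (le_trans (CP t t01))// -[leLHS]mulr1 ler_wpM2l//.
    have /andP[t0 _] := t01.
    by rewrite -expR0 ler_expR mulr_ge0// ltW.
  rewrite WS// [sval (W n.+1) t]WS//.
  have /andP[t0 t1] := t01.
  have dD (s : R) : 0 <= s <= t -> is_derive s (1 : R)
      (fun s => step (W n.+1) s - step (W n) s)
      (F s (sval (W n.+1) s) - F s (sval (W n) s)).
    move=> /andP[s0 st]; have s01 : 0 <= s <= 1 by rewrite s0 (le_trans st).
    exact: is_deriveB (stepD _ s s01) (stepD _ s s01).
  pose g (s : R) := L * (C / 2 ^+ n) / A * expR (A * s).
  have gD (s : R) : 0 <= s <= t -> is_derive s (1 : R) g (L * (C / 2 ^+ n * expR (A * s))).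
    move=> _; have eD : is_derive s (1 : R) (fun u : R => expR (A * u)) (A *: expR (A * s)).
      apply: (@is_derive_comp_real R R expR (fun u : R => A * u)).
      apply: is_derive_eq (is_deriveZ _ (is_derive_id s (1 : R))) _.
      exact: mulr1.
    apply: is_derive_eq (is_deriveZ _ eD) _.
    by rewrite -![_ *: _]/(_ * _); field; rewrite expf_neq0 ?gt_eqF.
  have dg (s : R) : 0 <= s <= t -> `|F s (sval (W n.+1) s) - F s (sval (W n) s)| <=
      L * (C / 2 ^+ n * expR (A * s)).
    move=> /andP[s0 st]; have s01 : 0 <= s <= 1 by rewrite s0 (le_trans st).
    by rewrite (le_trans (FL _ _ _))// ler_wpM2l ?IHn// ltW.
  have := mv _ _ _ _ 0 t t0 dD gD dg.
  rewrite !step0 subrr subr0 => /le_trans; apply.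
  rewrite (@le_trans _ _ (K * g t))//.
    rewrite ler_wpM2l ?(ltW K0)// gerBl /g mulr_ge0 ?expR_ge0//.
    by rewrite divr_ge0 ?(ltW A0)// mulr_ge0 ?(ltW L0)// divr_ge0// exprn_ge0.
  rewrite le_eqVlt; apply/orP; left; apply/eqP; rewrite /g /A exprS.
  by field; rewrite expf_neq0 ?gt_eqF.
have [K' K'0 lim] := geometric_limit fV.
pose M := C * expR A.
have M0 : 0 <= M by rewrite mulr_ge0// expR_ge0.
have limP t : exists z, forall n, `|sval (W n) (clamp t) - z| <= K' * M / 2 ^+ n.
  apply: lim => // n; have c01 := clamp_itv t.
  have -> : M / 2 ^+ n = C / 2 ^+ n * expR A by rewrite /M; ring.
  apply: le_trans (WC n _ c01) _; apply: ler_wpM2l; first by rewrite divr_ge0 ?exprn_ge0.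
  by rewrite ler_expR -[leRHS]mulr1 ler_wpM2l ?(ltW A0)//; case/andP: c01.
pose z t := sval (cid (limP t)).
have zP t n : `|sval (W n) (clamp t) - z t| <= K' * M / 2 ^+ n.
  by rewrite /z; case: cid.
have small (a e : R) : 0 <= a -> 0 < e -> exists n, a / 2 ^+ n <= e.
  move=> a0 e0; exists (Num.bound (a / e)).
  have /archi_boundP h : 0 <= a / e by rewrite divr_ge0// ltW.
  rewrite ler_pdivrMr ?exprn_gt0// mulrC -ler_pdivrMr//.
  rewrite (le_trans (ltW h))// -natrX ler_nat ltnW//; exact: ltn_expl.
have zc : continuous z.
  move=> t; apply/cvgrPdist_le => e e0.
  have [n nP] := small (K' * M) (e / 3) (mulr_ge0 (ltW K'0) M0) (divr_gt0 e0 (ltr0Sn _ 2)).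
  have Wc : {for t, continuous (sval (W n) \o clamp)}.
    by apply: continuous_comp; [exact: clamp_continuous|exact: (svalP (W n))].
  have e3 : 0 < e / 3 by rewrite divr_gt0.
  move/cvgrPdist_le : Wc => /(_ _ e3); apply: filterS => s /= h.
  have -> : z t - z s = - (sval (W n) (clamp t) - z t) +
     (sval (W n) (clamp t) - sval (W n) (clamp s)) + (sval (W n) (clamp s) - z s).
    by lincomb R.
  have h1 := le_trans (zP t n) nP; have h2 := le_trans (zP s n) nP.
  have := ler_normD (- (sval (W n) (clamp t) - z t) +
     (sval (W n) (clamp t) - sval (W n) (clamp s))) (sval (W n) (clamp s) - z s).
  have := ler_normD (- (sval (W n) (clamp t) - z t))
     (sval (W n) (clamp t) - sval (W n) (clamp s)).
  rewrite normrN; lra.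
(* The limit [z] is only known to be continuous; one more integration gives a differentiable [v],
   which agrees with [z] on [0, 1]. *)
have [v [v0 vD]] := stepP z zc; exists v; split => //.
suff vz t : 0 <= t <= 1 -> v t = z t by move=> t t01; rewrite vz//; exact: vD.
move=> t01; apply/eqP; rewrite -subr_eq0 -normr_le0; apply/ler_addgt0Pr => e e0.
rewrite add0r.
pose B := K * L * K' * M + K' * M.
have B0 : 0 <= B by rewrite addr_ge0// !mulr_ge0// ltW.
have [n nP] := small B e B0 e0; rewrite (le_trans _ nP)//.
have /andP[t0 t1] := t01.
have dD (s : R) : 0 <= s <= t -> is_derive s (1 : R)
    (fun s => v s - step (W n) s) (F s (z s) - F s (sval (W n) s)).
  move=> /andP[s0 st]; have s01 : 0 <= s <= 1 by rewrite s0 (le_trans st).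
  exact: is_deriveB (vD s s01) (stepD _ s s01).
have gD (s : R) : 0 <= s <= t ->
    is_derive s (1 : R) (fun s : R => L * (K' * M / 2 ^+ n) * s) (L * (K' * M / 2 ^+ n)).
  move=> _; apply: is_derive_eq (is_deriveZ _ (is_derive_id s (1 : R))) _.
  exact: mulr1.
have dg (s : R) : 0 <= s <= t -> `|F s (z s) - F s (sval (W n) s)| <= L * (K' * M / 2 ^+ n).
  move=> /andP[s0 st]; have s01 : 0 <= s <= 1 by rewrite s0 (le_trans st).
  rewrite (le_trans (FL _ _ _))// ler_wpM2l ?(ltW L0)//.
  by rewrite distrC -{1}(clamp_id s01) zP.
have := mv _ _ _ _ 0 t t0 dD gD dg.
rewrite v0 step0 subrr subr0 mulr0 subr0 -(WS _ _ t01) => h1.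
have h2 := zP t n.+1; rewrite (clamp_id t01) in h2.
have -> : v t - z t = (v t - sval (W n.+1) t) + (sval (W n.+1) t - z t) by lincomb R.
rewrite (le_trans (ler_normD _ _))// /B mulrDl lerD//.
  rewrite (le_trans h1)//.
  have -> : K * (L * (K' * M / 2 ^+ n) * t) = K * L * K' * M / 2 ^+ n * t by ring.
  by rewrite -[leRHS]mulr1 ler_wpM2l// divr_ge0 ?exprn_ge0// !mulr_ge0// ltW.
rewrite (le_trans h2)// ler_wpM2l ?mulr_ge0 ?(ltW K'0)// lef_pV2 ?posrE ?exprn_gt0//.
by rewrite exprS ler_peMl ?exprn_ge0// ler1n.
Qed.

End GlobalSolutions.

(** * Solutions on the unit interval: uniqueness, continuity and differentiability in the initial
    point *)

Section UnitSolutions.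
Context {R : realType}.

(** Compactness of the segment as a tube lemma: what holds locally in time holds at all times at
    once. It provides uniform constants along solutions and, later, excludes early returns. *)
Lemma near_itv (F : set_system R) (P : R -> R -> Prop) (a b : R) : Filter F ->
  (forall t : R, a <= t <= b -> \forall t' \near t & i \near F, P i t') ->
  \forall i \near F, forall t, a <= t <= b -> P i t.
Proof.
move=> FF Pnear; have /compact_near_coveringP cov := @segment_compact R a b.
apply: filterS (cov R F P FF _) => [i iP t t01|t]; first by apply: iP; rewrite /= in_itv.
by rewrite /= in_itv; exact: Pnear.
Qed.

(** Time is normalized to [0, 1]; other times are reached by scaling the field. Derivatives are
    two-sided at both ends. *)
Definition unit_solution (V : normedModType R) (A : set V) (Y : V -> V) (y : R -> V) :=
  forall t : R, 0 <= t <= 1 -> A (y t) /\ is_derive t (1 : R) y (Y (y t)).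

Definition unit_domain (V : normedModType R) (A : set V) (Y : V -> V) : set V :=
  [set x | exists2 y, y 0 = x & unit_solution A Y y].

(** Outside [unit_domain] the value is the default [x]. *)
Definition time_one (V : normedModType R) (A : set V) (Y : V -> V) (x : V) : V :=
  xget x [set z | exists y, [/\ y 0 = x, y 1 = z & unit_solution A Y y]].

Lemma near_norm_lt (V : normedModType R) (x : V) (e : R) :
  0 < e -> \forall y \near x, `|x - y| < e.
Proof. by move=> e0; apply/nbhs_ballP; exists e => // y; rewrite -ball_normE. Qed.

Section Field.
Context {V : normedModType R} {fV : findim V} {A : set V} {Y : V -> V}.
Hypotheses (oA : open A) (YA : class_C 1 A Y).

Lemma unit_solution_continuous y t :
  unit_solution A Y y -> 0 <= t <= 1 -> {for t, continuous y}.
Proof. by move=> yS t01; have [_] := yS t t01; exact: is_derive_continuous. Qed.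

Lemma ball_half (p x : V) (r s : R) : ball p (r / 2) x -> s <= r / 2 -> ball x s `<=` ball p r.
Proof.
move=> px sr z xz; apply: ball_split px _.
exact: le_ball xz.
Qed.

Lemma diff_bound p : A p -> exists2 k : R, 0 < k & forall v, `|'d Y p v| <= k * `|v|.
Proof.
move=> Ap; apply: linear_lipschitz; apply: diff_continuous.
exact: class_C_differentiable YA Ap.
Qed.

(** One number serves as Lipschitz constant and as inverse radius of the tube, so that the
    compactness argument has a single parameter tending to infinity. *)
Lemma tube_lipschitz y : unit_solution A Y y -> exists2 N : R, 0 < N &
  forall t : R, 0 <= t <= 1 -> [/\ ball (y t) N^-1 `<=` A,
    forall x x', ball (y t) N^-1 x -> ball (y t) N^-1 x' ->
      `|Y x - Y x'| <= N * `|x - x'| &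
    forall v, `|'d Y (y t) v| <= N * `|v|].
Proof.
move=> yS.
have : \forall N \near +oo, forall t : R, 0 <= t <= 1 -> [/\ ball (y t) N^-1 `<=` A,
    forall x x', ball (y t) N^-1 x -> ball (y t) N^-1 x' ->
      `|Y x - Y x'| <= N * `|x - x'| &
    forall v, `|'d Y (y t) v| <= N * `|v|].
  apply: near_itv => t t01.
  have [At _] := yS t t01.
  have [r r0 [rA rd rL]] := strict_diff fV fV oA YA At ltr01.
  have [k k0 kP] := diff_bound At.
  near=> t' N; rewrite /=.
  have N0 : 0 < N by near: N; exact: nbhs_pinfty_gt.
  have Nr : N^-1 <= r / 2.
    have Nr0 : 2 / r <= N by near: N; exact: (nbhs_pinfty_ge (num_real _)).
    by rewrite -[r / 2]invrK invf_div lef_pV2 ?posrE ?divr_gt0.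
  have Nk : k + 1 <= N by near: N; exact: (nbhs_pinfty_ge (num_real _)).
  have yt : ball (y t) (r / 2) (y t').
    near: t'; have /cvg_ball/(_ (r / 2)) := unit_solution_continuous yS t01.
    by apply; rewrite divr_gt0.
  have sub := ball_half yt Nr.
  split=> [|x x' xB x'B|v]; first exact: subset_trans sub rA.
    have -> : Y x - Y x' = (Y x - Y x' - 'd Y (y t) (x - x')) + 'd Y (y t) (x - x').
      by rewrite subrK.
    rewrite (le_trans (ler_normD _ _))//.
    have := rL _ _ (sub _ xB) (sub _ x'B); have := kP (x - x').
    have : (k + 1) * `|x - x'| <= N * `|x - x'| by rewrite ler_wpM2r.
    lra.
  have -> : 'd Y (y t') v = ('d Y (y t') v - 'd Y (y t) v) + 'd Y (y t) v.
    by rewrite subrK.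
  rewrite (le_trans (ler_normD _ _))//.
  have ryt : ball (y t) r (y t') by apply: le_ball yt; rewrite ler_pdivrMr// ler_peMr ?ler1n// ltW.
  have := rd _ v ryt; have := kP v.
  have : (k + 1) * `|v| <= N * `|v| by rewrite ler_wpM2r.
  lra.
move=> h; have [N [N0 NP]] := filter_ex (filterI (nbhs_pinfty_gt (num_real (0 : R))) h).
by exists N.
Unshelve. all: by end_near. Qed.

(** First-order expansion of [Y], uniform along the orbit; it bounds the remainder in the
    variational equation. *)
Lemma tube_diff y (eta : R) : unit_solution A Y y -> 0 < eta -> exists2 r : R, 0 < r &
  forall t x, 0 <= t <= 1 -> ball (y t) r x ->
    `|Y x - Y (y t) - 'd Y (y t) (x - y t)| <= eta * `|x - y t|.
Proof.
move=> yS eta0; have e2 : 0 < eta / 2 by rewrite divr_gt0.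
have : \forall r \near 0^'+, forall t, 0 <= t <= 1 -> forall x, ball (y t) r x ->
    `|Y x - Y (y t) - 'd Y (y t) (x - y t)| <= eta * `|x - y t|.
  apply: near_itv => t t01.
  have [At _] := yS t t01.
  have [r r0 [rA rd rL]] := strict_diff fV fV oA YA At e2.
  near=> t' s => /= x xB.
  have sr : s <= r / 2.
    by near: s; apply: nbhs_right_le; rewrite divr_gt0.
  have yt : ball (y t) (r / 2) (y t').
    near: t'; have /cvg_ball/(_ (r / 2)) := unit_solution_continuous yS t01.
    by apply; rewrite divr_gt0.
  have ryt : ball (y t) r (y t') by apply: le_ball yt; rewrite ler_pdivrMr// ler_peMr ?ler1n// ltW.
  have rx := ball_half yt sr xB.
  have -> : Y x - Y (y t') - 'd Y (y t') (x - y t') =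
    (Y x - Y (y t') - 'd Y (y t) (x - y t')) -
    ('d Y (y t') (x - y t') - 'd Y (y t) (x - y t')) by lincomb R.
  rewrite (le_trans (ler_normB _ _))//.
  have := rL _ _ rx ryt; have := rd _ (x - y t') ryt; lra.
move=> h; have [r [r0 rP]] := filter_ex (filterI (nbhs_right_gt (0 : R)) h).
by exists r => // t x t01; exact: rP.
Unshelve. all: by end_near. Qed.

(** The two solutions are not known to stay close, so the Lipschitz bound is sought along this pair
    only: near a common point it is local, elsewhere the distance is bounded below and the field
    above. Compactness gives one constant, then Gronwall's inequality concludes. *)
Lemma unit_solution_unique y z : unit_solution A Y y -> unit_solution A Y z ->
  y 0 = z 0 -> forall t : R, 0 <= t <= 1 -> y t = z t.
Proof.
move=> yS zS yz0.
have : \forall N \near +oo, forall t : R, 0 <= t <= 1 ->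
    `|Y (y t) - Y (z t)| <= N * `|y t - z t|.
  apply: near_itv => t t01.
  have [At _] := yS t t01; have [Azt _] := zS t t01.
  have yc := unit_solution_continuous yS t01.
  have zc := unit_solution_continuous zS t01.
  have [yzt|yzt] := eqVneq (y t) (z t).
    have [r r0 [rA rd rL]] := strict_diff fV fV oA YA At ltr01.
    have [k k0 kP] := diff_bound At.
    near=> t' N; rewrite /=.
    have Nk : k + 1 <= N by near: N; exact: (nbhs_pinfty_ge (num_real _)).
    have yB : ball (y t) r (y t').
      by near: t'; have /cvg_ball/(_ r) := yc; exact.
    have zB : ball (y t) r (z t').
      by rewrite yzt; near: t'; have /cvg_ball/(_ r) := zc; exact.
    have -> : Y (y t') - Y (z t') = (Y (y t') - Y (z t') - 'd Y (y t) (y t' - z t')) +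
      'd Y (y t) (y t' - z t') by rewrite subrK.
    rewrite (le_trans (ler_normD _ _))//.
    have := rL _ _ yB zB; have := kP (y t' - z t').
    have : (k + 1) * `|y t' - z t'| <= N * `|y t' - z t'| by rewrite ler_wpM2r.
    lra.
  have d0 : 0 < `|y t - z t| by rewrite normr_gt0 subr_eq0.
  have dc : `|y s - z s| @[s --> t] --> `|y t - z t| by apply: cvg_norm; exact: (cvgB yc zc).
  have Yc : `|Y (y s) - Y (z s)| @[s --> t] --> `|Y (y t) - Y (z t)|.
    apply: cvg_norm; apply: cvgB.
      exact: (continuous_comp yc (class_C_continuous YA At)).
    exact: (continuous_comp zc (class_C_continuous YA Azt)).
  pose M := `|Y (y t) - Y (z t)|.
  near=> t' N; rewrite /=.
  have N0 : 0 < N by near: N; exact: nbhs_pinfty_gt.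
  have dt : `|y t - z t| / 2 <= `|y t' - z t'|.
    near: t'; apply: (cvgr_ge _ dc); rewrite ltr_pdivrMr// ltr_pMr// ltr1n//.
  have Yt : `|Y (y t') - Y (z t')| <= M + 1.
    by near: t'; apply: (cvgr_le _ Yc); rewrite ltrDl.
  have NM : (M + 1) / (`|y t - z t| / 2) <= N.
    by near: N; exact: (nbhs_pinfty_ge (num_real _)).
  rewrite (le_trans Yt)//; move: NM; rewrite ler_pdivrMr ?divr_gt0// => /le_trans; apply.
  by rewrite ler_wpM2l// ltW.
move=> h; have [N NP] := filter_ex h.
have [B B0 gr] := gronwall fV N.
have dD (t : R) : 0 <= t <= 1 ->
    is_derive t (1 : R) (fun t => y t - z t) (Y (y t) - Y (z t)).
  move=> t01; have [_ yD] := yS t t01; have [_ zD] := zS t t01; exact: is_deriveB.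
have dle (t : R) : 0 <= t <= 1 -> `|Y (y t) - Y (z t)| <= N * `|y t - z t| + 0.
  by move=> t01; rewrite addr0; exact: NP.
move=> t t01; have := gr _ _ 0 (lexx 0) dD dle t t01.
by rewrite yz0 subrr normr0 addr0 mulr0 normr_le0 subr_eq0 => /eqP.
Unshelve. all: by end_near. Qed.

Lemma time_oneE y : unit_solution A Y y -> time_one A Y (y 0) = y 1.
Proof.
move=> yS; rewrite /time_one; case: xgetP => [z _ [y' [y'0 <- y'S]]|/(_ (y 1))].
  by apply: unit_solution_unique => //; rewrite ler01 lexx.
by case; exists y.
Qed.

(** The radial retraction onto the ball of radius [r]. It is 2-Lipschitz for every norm, and serves
    to cut a field off outside a tube. *)
Definition radial (r : R) (z : V) : V := (r / Num.max r `|z|) *: z.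

Lemma radial_id r z : 0 < r -> `|z| <= r -> radial r z = z.
Proof. by move=> r0 zr; rewrite /radial (max_idPl zr) divff ?gt_eqF// scale1r. Qed.

Lemma radial_norm r z : 0 < r -> `|radial r z| <= r.
Proof.
move=> r0; have m0 : 0 < Num.max r `|z| by rewrite lt_max r0.
rewrite /radial normrZ ger0_norm ?divr_ge0 ?(ltW r0)//; last exact: ltW.
by rewrite mulrAC ler_pdivrMr// ler_wpM2l ?(ltW r0)// le_max lexx orbT.
Qed.

Lemma radial_lipschitz r x z : 0 < r -> `|radial r x - radial r z| <= 2 * `|x - z|.
Proof.
move=> r0; set m := Num.max r `|x|; set n := Num.max r `|z|.
have m0 : 0 < m by rewrite lt_max r0.
have n0 : 0 < n by rewrite lt_max r0.
have rm : r <= m by rewrite le_max lexx.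
have zn : `|z| <= n by rewrite le_max lexx orbT.
have mn : `|n - m| <= `|x - z|.
  have h1 : `|x| <= `|x - z| + `|z| by rewrite -{1}[x](subrK z) ler_normD.
  have h2 : `|z| <= `|x - z| + `|x| by rewrite -{1}[z](subrK x) distrC ler_normD.
  have d0 := normr_ge0 (x - z).
  by rewrite /m /n ler_norml; case: (leP r `|x|) => rx; case: (leP r `|z|) => rz;
     apply/andP; split; lra.
have -> : radial r x - radial r z = (r / m) *: (x - z) + (r / m - r / n) *: z.
  by rewrite /radial -/m -/n; lincomb R.
rewrite (le_trans (ler_normD _ _))// mulr_natl mulr2n lerD//.
  rewrite normrZ ger0_norm ?divr_ge0 ?(ltW r0) ?(ltW m0)//.
  by rewrite -[leRHS]mul1r ler_wpM2r// ler_pdivrMr// mul1r.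
rewrite normrZ.
have -> : r / m - r / n = (r / m) * ((n - m) / n) by field; rewrite !gt_eqF.
rewrite !normrM (ger0_norm (ltW r0)) !normfV (gtr0_norm m0) (gtr0_norm n0).
have h1 : r / m <= 1 by rewrite ler_pdivrMr// mul1r.
have h2 : `|n - m| / n * `|z| <= `|x - z|.
  rewrite mulrAC ler_pdivrMr//; apply: ler_pM => //.
have -> : r / m * (`|n - m| / n) * `|z| = r / m * (`|n - m| / n * `|z|) by ring.
apply: (le_trans _ h2); apply: ler_piMl => //.
by rewrite mulr_ge0// divr_ge0// ltW.
Qed.

Lemma lipschitz_continuous (W : normedModType R) (f : V -> W) (L : R) :
  (forall x y, `|f x - f y| <= L * `|x - y|) -> continuous f.
Proof.
move=> fL x; apply/cvgrPdist_lt => e e0; near=> y.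
rewrite (le_lt_trans (fL _ _))//.
rewrite (@le_lt_trans _ _ ((`|L| + 1) * `|x - y|))//.
  by rewrite ler_wpM2r// (le_trans (ler_norm _))// lerDl.
rewrite -ltr_pdivlMl ?ltr_wpDl// mulrC.
near: y; apply: near_norm_lt; by rewrite divr_gt0// ltr_wpDl.
Unshelve. all: by end_near. Qed.

(** The deviation from [y] is sought as a solution of the equation cut off by [radial], which is
    globally Lipschitz and hence solvable. By Gronwall's inequality a small initial deviation stays
    below [r], where the cut-off is inactive. *)
Lemma near_unit_solution y : unit_solution A Y y -> exists (r B : R),
  [/\ 0 < r, 0 < B & forall x, `|x - y 0| < r -> exists z, [/\ z 0 = x, unit_solution A Y z &
    forall t : R, 0 <= t <= 1 -> `|z t - y t| <= B * `|x - y 0|]].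
Proof.
move=> yS; have [N N0 NP] := tube_lipschitz yS.
pose r := N^-1 / 2; have r0 : 0 < r by rewrite divr_gt0// invr_gt0.
have rN : r < N^-1 by rewrite /r ltr_pdivrMr// ltr_pMr ?invr_gt0// ltr1n.
pose F (t : R) (z : V) := Y (y (clamp t) + radial r z) - Y (y (clamp t)).
have inB t z : ball (y (clamp t)) N^-1 (y (clamp t) + radial r z).
  rewrite -ball_normE /= opprD addNKr normrN.
  by rewrite (le_lt_trans (radial_norm z r0)).
have cB t : ball (y (clamp t)) N^-1 (y (clamp t)) by apply: ballxx; rewrite invr_gt0.
have yc : continuous (y \o clamp).
  by apply: continuous_clamp => t t01; exact: unit_solution_continuous.
have YcA z : A z -> {for z, continuous Y} by move=> Az; exact: class_C_continuous YA Az.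
have Fc z : continuous z -> continuous (fun t => F t (z t)).
  move=> zc t; have [NA _ _] := NP _ (clamp_itv t).
  apply: cvgB; apply: continuous_comp.
  - apply: cvgD; first exact: yc.
    apply: continuous_comp; first exact: zc.
    by apply: lipschitz_continuous => u v; exact: radial_lipschitz.
  - by apply: YcA; exact/NA/inB.
  - exact: yc.
  - by apply: YcA; exact/NA/cB.
have FL t u v : `|F t u - F t v| <= N * 2 * `|u - v|.
  have [_ NL _] := NP _ (clamp_itv t).
  have -> : F t u - F t v = Y (y (clamp t) + radial r u) - Y (y (clamp t) + radial r v).
    by rewrite /F; lincomb R.
  rewrite (le_trans (NL _ _ (inB t u) (inB t v)))// -mulrA ler_pM2l//.
  have -> : y (clamp t) + radial r u - (y (clamp t) + radial r v) = radial r u - radial r v.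
    by lincomb R.
  exact: radial_lipschitz.
have [B B0 gr] := gronwall fV (N * 2).
exists (r / B), B; split => //; first by rewrite divr_gt0.
move=> x xr; have [z [z0 zD]] := picard fV (x - y 0) Fc FL.
have F0 t : F t 0 = 0 by rewrite /F /radial scaler0 addr0 subrr.
have zle t : 0 <= t <= 1 -> `|z t| <= B * `|x - y 0|.
  move=> t01; have := gr _ _ 0 (lexx _) zD _ t t01.
  rewrite z0 addr0; apply => s s01.
  by have := FL s (z s) 0; rewrite F0 !subr0 addr0.
have zr t : 0 <= t <= 1 -> `|z t| <= r.
  move=> t01; rewrite (le_trans (zle t t01))// mulrC -ler_pdivlMr//; exact: ltW.
exists (fun t => y t + z t); split => [|t t01|t t01].
- by rewrite z0 addrC subrK.
- have [NA _ _] := NP t t01.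
  have [_ yD] := yS t t01.
  have FE : F t (z t) = Y (y t + z t) - Y (y t).
    by rewrite /F (clamp_id t01) (radial_id r0 (zr _ t01)).
  split.
    have := inB t (z t); rewrite (clamp_id t01) (radial_id r0 (zr _ t01)); exact: NA.
  apply: is_derive_eq (is_deriveD yD (zD t t01)) _.
  by rewrite FE addrC subrK.
- by rewrite addrAC subrr add0r; exact: zle.
Qed.

Lemma unit_domain_open : open (unit_domain A Y).
Proof.
rewrite openE => x [y <- yS]; have [r [B [r0 B0 rP]]] := near_unit_solution yS.
apply/nbhs_ballP; exists r => // z; rewrite -ball_normE /= distrC => /rP[y' [y'0 y'S _]].
by exists y'.
Qed.

Lemma time_one_continuous x : unit_domain A Y x -> {for x, continuous (time_one A Y)}.
Proof.
move=> [y <- yS]; have [r [B [r0 B0 rP]]] := near_unit_solution yS.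
apply/cvgrPdist_lt => e e0; near=> x'.
have xr : `|x' - y 0| < r.
  by rewrite distrC; near: x'; exact: near_norm_lt.
have [z [z0 zS zB]] := rP _ xr.
rewrite (time_oneE yS) -z0 (time_oneE zS) distrC.
rewrite (le_lt_trans (zB 1 _))//; first by rewrite ler01 lexx.
rewrite mulrC -ltr_pdivlMr// distrC; near: x'.
by apply: near_norm_lt; rewrite divr_gt0.
Unshelve. all: by end_near. Qed.

Lemma variation y v : unit_solution A Y y -> exists w : R -> V, w 0 = v /\
  forall t : R, 0 <= t <= 1 -> is_derive t (1 : R) w ('d Y (y t) (w t)).
Proof.
move=> yS; have [N N0 NP] := tube_lipschitz yS.
have yc : continuous (y \o clamp).
  by apply: continuous_clamp => t t01; exact: unit_solution_continuous.
have [n [e [l [lc le _]]]] := fV.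
have Fc z : continuous z -> continuous (fun t => 'd Y (y (clamp t)) (z t)).
  move=> zc t.
  have -> : (fun t => 'd Y (y (clamp t)) (z t)) =
     (fun t => \sum_i l i (z t) *: 'd Y (y (clamp t)) (e i)).
    apply/funext => s; rewrite [in LHS](le (z s)) linear_sum.
    by apply: eq_bigr => i _; rewrite linearZ.
  apply: cvg_big => [|i _]; first exact: add_continuous.
  apply: cvgZ; first by apply: continuous_comp; [exact: zc|exact: lc].
  apply: (@continuous_comp _ _ _ (y \o clamp) (fun x => 'd Y x (e i))); first exact: yc.
  have [At _] := yS _ (clamp_itv t).
  exact: (class_C_continuous (class_C_diff (e i) YA) At).
have FL t u u' : `|'d Y (y (clamp t)) u - 'd Y (y (clamp t)) u'| <= N * `|u - u'|.
  by have [_ _ NL] := NP _ (clamp_itv t); rewrite -linearB.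
have [w [w0 wD]] := @picard R V fV (fun t z => 'd Y (y (clamp t)) z) N v Fc FL.
exists w; split => // t t01; have := wD t t01.
by rewrite (clamp_id t01).
Qed.

(** The differential sends [v] to the value at time 1 of the solution of the variational equation
    starting at [v], linear in [v] by uniqueness. The second part accepts any pair of solutions, so
    that explicit ones can be supplied, as for the time derivative of the flow. *)
Lemma time_one_diff x : unit_domain A Y x ->
  differentiable (time_one A Y) x /\
  forall y w v, y 0 = x -> unit_solution A Y y -> w 0 = v ->
    (forall t : R, 0 <= t <= 1 -> is_derive t (1 : R) w ('d Y (y t) (w t))) ->
    'd (time_one A Y) x v = w 1.
Proof.
move=> [y <- yS]; have [N N0 NP] := tube_lipschitz yS.
have [B B0 gr] := gronwall fV N.
have i01 : 0 <= (1 : R) <= 1 by apply/andP; split; [exact: ler01|exact: lexx].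
have dN (t : R) v : 0 <= t <= 1 -> `|'d Y (y t) v| <= N * `|v| + 0.
  by move=> t01; rewrite addr0; have [] := NP t t01.
have lin_bound (w : R -> V) :
    (forall t : R, 0 <= t <= 1 -> is_derive t (1 : R) w ('d Y (y t) (w t))) ->
    `|w 1| <= B * `|w 0|.
  move=> wD; have := gr _ _ 0 (lexx _) wD (fun t t01 => dN t (w t) t01) 1 i01.
  by rewrite addr0.
pose W v := sval (cid (variation v yS)).
have W0 v : W v 0 = v by rewrite /W; case: cid => ? [].
have WD v (t : R) : 0 <= t <= 1 -> is_derive t (1 : R) (W v) ('d Y (y t) (W v t)).
  by have [_] := svalP (cid (variation v yS)); apply.
have Wuniq w v : w 0 = v ->
    (forall t : R, 0 <= t <= 1 -> is_derive t (1 : R) w ('d Y (y t) (w t))) -> w 1 = W v 1.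
  move=> w0 wD; have := lin_bound (fun t => w t - W v t); rewrite w0 W0 subrr normr0 mulr0.
  rewrite normr_le0 subr_eq0 => h; apply/eqP/h => t t01.
  by apply: is_derive_eq (is_deriveB (wD t t01) (WD v t t01)) _; rewrite linearB.
have Wlin : linear (fun v => W v 1).
  move=> a u v; apply/esym; apply: (Wuniq (fun t => a *: W u t + W v t)).
    by rewrite !W0.
  move=> t t01.
  have := is_deriveD (is_deriveZ a (WD u t t01)) (WD v t t01).
  by move=> h; apply: is_derive_eq h _; rewrite linearP.
pose JM := GRing.isLinear.Build _ _ _ _ _ Wlin.
pose J : {linear V -> V} := HB.pack (fun v => W v 1) JM.
have Jb v : `|J v| <= B * `|v| by rewrite -[v in leRHS]W0; apply: lin_bound; exact: WD.
have Jc : continuous J.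
  by apply: (@lipschitz_continuous _ _ B) => u v; rewrite -linearB; exact: Jb.
have [r [C [r0 C0 rP]]] := near_unit_solution yS.
suff dJ : is_diff (y 0) (time_one A Y) J.
  split; first exact: is_diff_differentiable dJ.
  move=> y' w v y'0 y'S w0 wD; rewrite (is_diffE dJ) /=; apply/esym/Wuniq => //.
  move=> t t01; have := wD t t01.
  by rewrite (unit_solution_unique y'S yS y'0 t01).
apply: is_diff_eps => // e e0.
(* [C] bounds the deviation of the solutions by [C |v|] and [B] is Gronwall's constant, so the final
   error is [B * eta * C |v| = e |v|]. *)
have eta0 : 0 < e / (B * C) by rewrite divr_gt0// mulr_gt0.
have [s s0 sP] := tube_diff yS eta0.
near=> v.
have vr : `|v + y 0 - y 0| < r.
  by rewrite addrK; near: v; exact: nbhs0_lt.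
have vs : C * `|v| < s.
  rewrite mulrC -ltr_pdivlMr//; near: v; apply: nbhs0_lt; exact: divr_gt0.
have [z [z0 zS zC]] := rP _ vr; rewrite addrK in zC.
rewrite -{1}z0 (time_oneE zS) (time_oneE yS) /=.
pose d t := z t - y t - W v t.
pose dd t := Y (z t) - Y (y t) - 'd Y (y t) (W v t).
have dD (t : R) : 0 <= t <= 1 -> is_derive t (1 : R) d (dd t).
  move=> t01; have [_ zD] := zS t t01; have [_ yD] := yS t t01.
  exact: is_deriveB (is_deriveB zD yD) (WD v t t01).
have dle (t : R) : 0 <= t <= 1 -> `|dd t| <= N * `|d t| + e / (B * C) * (C * `|v|).
  move=> t01; have zyt := zC t t01.
  have -> : dd t = 'd Y (y t) (d t) + (Y (z t) - Y (y t) - 'd Y (y t) (z t - y t)).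
    by rewrite /dd /d (linearB ('d Y (y t))); lincomb R.
  rewrite (le_trans (ler_normD _ _))// lerD//.
    by have := dN t (d t) t01; rewrite addr0.
  rewrite (le_trans (sP t (z t) t01 _))//.
    by rewrite -ball_normE /= distrC (le_lt_trans zyt).
  by rewrite ler_wpM2l// ltW.
have := gr _ _ _ _ dD dle 1 i01; rewrite /d z0 W0 addrK subrr normr0 add0r.
move=> /(_ _)/le_trans; apply.
  by rewrite mulr_ge0 ?(ltW eta0)// mulr_ge0// ltW.
by rewrite le_eqVlt; apply/orP; left; apply/eqP; field; rewrite !gt_eqF.
Unshelve. all: by end_near. Qed.

End Field.
End UnitSolutions.

(** * Smoothness of the time-one map *)

Section SmoothTimeOne.
Context {R : realType}.

Definition tangent_field (V : normedModType R) (Y : V -> V) (p : V * V) : V * V :=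
  (Y p.1, 'd Y (p.1) p.2).

Lemma open_fst (V W : normedModType R) (A : set V) : open A ->
  open [set p : V * W | A p.1].
Proof. by move=> oA; apply: (@open_comp _ _ fst) => // x _; exact: cvg_fst. Qed.

Lemma open_snd (V W : normedModType R) (A : set W) : open A ->
  open [set p : V * W | A p.2].
Proof. by move=> oA; apply: (@open_comp _ _ snd) => // x _; exact: cvg_snd. Qed.

Lemma tangent_field_smooth (V : normedModType R) (fV : findim V) (A : set V) (Y : V -> V) :
  open A -> smooth_on A Y -> smooth_on [set p : V * V | A p.1] (tangent_field Y).
Proof.
move=> oA YA k; have [n [e [l [lc le _]]]] := fV.
have oA1 : open [set p : V * V | A p.1] by exact: open_fst.
have fstC j (B : set (V * V)) : class_C j B (@fst V V).
  by apply: (@class_C_lin _ j _ _ B fst) => x; exact: cvg_fst.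
have sndC j (B : set (V * V)) : class_C j B (@snd V V).
  by apply: (@class_C_lin _ j _ _ B snd) => x; exact: cvg_snd.
apply: class_C_pair => //.
  exact: (class_C_comp fV oA1 (fun p Ap => Ap) (fstC _ _) (YA k)).
have -> : (fun p : V * V => 'd Y (p.1) p.2) = (fun p => \sum_i l i p.2 *: 'd Y (p.1) (e i)).
  apply/funext => p; rewrite [in LHS](le p.2) linear_sum.
  by apply: eq_bigr => i _; rewrite linearZ.
apply: class_C_sum => // i; apply: class_C_scale => //.
  exact: (class_C_comp_lin oA1 (lc i) (sndC _ _)).
exact: (class_C_comp fV oA1 (fun p Ap => Ap) (fstC _ _) (class_C_diff (e i) (YA k.+1))).
Qed.

Lemma is_derive_pair (V W : normedModType R) (f : R -> V) (g : R -> W) (t : R) (a : V) (b : W) :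
  is_derive t (1 : R) f a -> is_derive t (1 : R) g b ->
  is_derive t (1 : R) (fun s => (f s, g s)) (a, b).
Proof.
move=> /is_derive_diff fD /is_derive_diff gD.
have := is_diff_derive (1 : R) (is_diff_pair fD gD).
by rewrite !scale1r.
Qed.

Lemma time_one_tangent (V : normedModType R) (fV : findim V) (A : set V) (Y : V -> V) x v :
  open A -> class_C 1 A Y -> class_C 1 [set p : V * V | A p.1] (tangent_field Y) ->
  unit_domain A Y x ->
  unit_domain [set p : V * V | A p.1] (tangent_field Y) (x, v) /\
  (time_one [set p : V * V | A p.1] (tangent_field Y) (x, v)).2 = 'd (time_one A Y) x v.
Proof.
move=> oA YA TA xD; have [_ dE] := time_one_diff oA YA xD.
have [y y0 yS] := xD; have [w [w0 wD]] := variation oA YA v yS.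
have yw : unit_solution [set p : V * V | A p.1] (tangent_field Y) (fun t => (y t, w t)).
  move=> t t01; have [At yD] := yS t t01; split => //.
  exact: is_derive_pair yD (wD t t01).
split; first by exists (fun t => (y t, w t)) => //; rewrite y0 w0.
rewrite (dE y w v y0 yS w0 wD).
have := time_oneE (fV := findim_prod fV fV) (open_fst oA) TA yw.
by rewrite y0 w0 => ->.
Qed.

(* The directional derivative of the time-one map of [Y] is read off the time-one
   map of the field [(x, v) |-> (Y x, 'd Y x v)], whence the induction. *)
Lemma time_one_smooth (V : normedModType R) (fV : findim V) (A : set V) (Y : V -> V) :
  open A -> smooth_on A Y -> smooth_on (unit_domain A Y) (time_one A Y).
Proof.
(* The space is generalized, since each step of the induction passes from [V] to [V * V]. *)
move=> oA YA k; elim: k V fV A Y oA YA => [|k IHk] V fV A Y oA YA.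
  by move=> x xD; exact: (time_one_continuous oA (YA 1%N) xD).
have oD := unit_domain_open (fV := fV) oA (YA 1%N).
split=> [x xD|v]; first by have [] := time_one_diff oA (YA 1%N) xD.
pose TA := [set p : V * V | A p.1].
have oTA : open TA by exact: open_fst.
have TY : smooth_on TA (tangent_field Y) by exact: tangent_field_smooth.
have oTD := unit_domain_open (fV := findim_prod fV fV) oTA (TY 1%N).
have TS := IHk _ (findim_prod fV fV) TA (tangent_field Y) oTA TY.
have tE x := @time_one_tangent V fV A Y x v oA (YA 1%N) (TY 1%N).
apply: (class_C_ext oD (fun x xD => (tE x xD).2)).
apply: class_C_snd => //.
apply: (class_C_comp _ oD (fun x xD => (tE x xD).1) _ TS).
by apply: class_C_pair => //; [exact: class_C_id|exact: class_C_cst].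
Qed.

End SmoothTimeOne.

(** * Joint smoothness of the flow in time, parameter and initial point *)

Section ParametrizedFlow.
Context {R : realType}.
Variables (E V : normedModType R) (fE : findim E) (fV : findim V).
Variables (A : set (E * V)) (X : E * V -> V).
Hypotheses (oA : open A) (XA : smooth_on A X).

(** Final time and parameter are constant coordinates of the state, so that smoothness in the
    initial point alone contains smoothness in all of them. Negative times are included. *)
Definition suspended_field (p : R * (E * V)) : R * (E * V) := (0, (0, p.1 *: X p.2)).

Definition suspended_dom : set (R * (E * V)) := [set p | A p.2].

(* Rescaling time to [0, 1] turns the final time into a further parameter. *)
Definition flow_dom : set (R * (E * V)) := unit_domain suspended_dom suspended_field.

Definition flow_map (p : R * (E * V)) : V := (time_one suspended_dom suspended_field p).2.2.

Let fP : findim ((R * (E * V))%type : normedModType R).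
Proof. exact: findim_prod findim_real (findim_prod fE fV). Qed.

Let oS : open suspended_dom. Proof. exact: open_snd. Qed.

Lemma suspended_field_smooth : smooth_on suspended_dom suspended_field.
Proof.
move=> k; apply: class_C_pair => //; first exact: class_C_cst.
apply: class_C_pair => //; first exact: class_C_cst.
apply: class_C_scale => //.
  by apply: class_C_fst => //; exact: class_C_id.
apply: (class_C_comp (findim_prod fE fV) oS (fun p Ap => Ap) _ (XA k)).
by apply: class_C_snd => //; exact: class_C_id.
Qed.

Lemma flow_dom_open : open flow_dom.
Proof. exact: (unit_domain_open (fV := fP) oS (suspended_field_smooth 1%N)). Qed.

Lemma flow_map_smooth : smooth_on flow_dom flow_map.
Proof.
move=> k; apply: class_C_snd; first exact: flow_dom_open.
apply: class_C_snd; first exact: flow_dom_open.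
exact: (time_one_smooth fP oS suspended_field_smooth).
Qed.

Lemma suspended_diff p : suspended_dom p ->
  is_diff p suspended_field (fun q => (0, (0, p.1 *: 'd X (p.2) q.2 + q.1 *: X p.2))).
Proof.
move=> Ap.
have fstD : is_diff p (fst : R * (E * V) -> R) fst.
  by apply: (@is_diff_linear _ _ _ fst) => x; exact: cvg_fst.
have sndD : is_diff p (snd : R * (E * V) -> E * V) snd.
  by apply: (@is_diff_linear _ _ _ snd) => x; exact: cvg_snd.
have XD := is_diff_comp sndD (class_C_is_diff (XA 1%N) Ap).
have c0 : is_diff p (fun=> 0 : R) (fun=> 0) by exact: is_diff_cst.
have c1 : is_diff p (fun=> 0 : E) (fun=> 0) by exact: is_diff_cst.
exact: (is_diff_pair c0 (is_diff_pair c1 (is_diff_scale fstD XD))).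
Qed.

Lemma is_derive0_cst (W : normedModType R) (fW : findim W) (f : R -> W) (b : R) :
  (forall t : R, 0 <= t <= b -> is_derive t (1 : R) f 0) ->
  forall t : R, 0 <= t <= b -> f t = f 0.
Proof.
move=> f0 t /andP[t0 tb]; have [K K0 mv] := mean_value_le fW.
have := mv f (fun=> 0) (fun=> 0) (fun=> 0) 0 t t0; rewrite subrr mulr0 => h.
apply/eqP; rewrite -subr_eq0 -normr_le0; apply: h => s /andP[s0 st]; last by rewrite normr0.
by apply: f0; rewrite s0 (le_trans st).
Qed.

Lemma is_derive_fst (W W' : normedModType R) (f : R -> W * W') (t : R) (d : W * W') :
  is_derive t (1 : R) f d -> is_derive t (1 : R) (fun s => (f s).1) d.1.
Proof.
by move=> fD; apply: (@is_derive_linear _ _ _ fst f t d _ fD) => x; exact: cvg_fst.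
Qed.

Lemma is_derive_snd (W W' : normedModType R) (f : R -> W * W') (t : R) (d : W * W') :
  is_derive t (1 : R) f d -> is_derive t (1 : R) (fun s => (f s).2) d.2.
Proof.
by move=> fD; apply: (@is_derive_linear _ _ _ snd f t d _ fD) => x; exact: cvg_snd.
Qed.

Lemma suspended_solution y : unit_solution suspended_dom suspended_field y ->
  forall u : R, 0 <= u <= 1 -> [/\ (y u).1 = (y 0).1, (y u).2.1 = (y 0).2.1,
    A ((y 0).2.1, (y u).2.2) &
    is_derive u (1 : R) (fun u => (y u).2.2) ((y 0).1 *: X ((y 0).2.1, (y u).2.2))].
Proof.
move=> yS.
have y1 u : 0 <= u <= 1 -> (y u).1 = (y 0).1.
  apply: (@is_derive0_cst _ findim_real (fun u => (y u).1)) => s s01.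
  by have [_ yD] := yS s s01; exact: (is_derive_fst yD).
have y2 u : 0 <= u <= 1 -> (y u).2.1 = (y 0).2.1.
  apply: (@is_derive0_cst _ fE (fun u => (y u).2.1)) => s s01.
  by have [_ yD] := yS s s01; exact: (is_derive_fst (is_derive_snd yD)).
move=> u u01; have [Ay yD] := yS u u01; split; [exact: y1|exact: y2| |].
  by rewrite -(y2 u u01) -surjective_pairing.
have := is_derive_snd (is_derive_snd yD).
by rewrite /= -(y1 u u01) -(y2 u u01) -surjective_pairing.
Qed.

Lemma flow_dom_star t e x s : flow_dom (t, (e, x)) -> 0 <= s <= 1 ->
  flow_dom (t * s, (e, x)).
Proof.
move=> [y y0 yS] /andP[s0 s1]; have yE := suspended_solution yS; rewrite y0 /= in yE.
exists (fun u => (t * s, (e, (y (s * u)).2.2))).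
  by rewrite mulr0 y0.
move=> u /andP[u0 u1].
have su : 0 <= s * u <= 1 by rewrite mulr_ge0//= mulr_ile1.
have [_ _ As yD] := yE _ su; split => //.
apply: (is_derive_pair (is_derive_cst _ _ _) (is_derive_pair (is_derive_cst _ _ _) _)).
have sD : is_derive u (1 : R) (fun u : R => s * u) s.
  apply: is_derive_eq (is_deriveZ _ (is_derive_id u (1 : R))) _.
  exact: mulr1.
have := is_derive_comp_real sD yD.
by rewrite scalerA [s * t]mulrC.
Qed.

(** Identifies the flow with a curve known to solve the equation; [t] may be negative. *)
Lemma flow_intro c t e :
  (forall u : R, 0 <= u <= 1 -> A (e, c (t * u)) /\
     is_derive (t * u) (1 : R) c (X (e, c (t * u)))) ->
  flow_dom (t, (e, c 0)) /\ flow_map (t, (e, c 0)) = c t.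
Proof.
move=> cS; pose y u : R * (E * V) := (t, (e, c (t * u))).
have yS : unit_solution suspended_dom suspended_field y.
  move=> u u01; have [Ac cD] := cS u u01; split => //.
  apply: (is_derive_pair (is_derive_cst _ _ _) (is_derive_pair (is_derive_cst _ _ _) _)).
  have tD : is_derive u (1 : R) (fun u : R => t * u) t.
    apply: is_derive_eq (is_deriveZ _ (is_derive_id u (1 : R))) _.
    exact: mulr1.
  exact: is_derive_comp_real tD cD.
have y0 : y 0 = (t, (e, c 0)) by rewrite /y mulr0.
split; first by exists y.
by rewrite /flow_map -y0 (time_oneE (fV := fP) oS (suspended_field_smooth 1%N) yS) /= mulr1.
Qed.

Lemma flow_zero e x : A (e, x) -> flow_dom (0, (e, x)) /\ flow_map (0, (e, x)) = x.
Proof.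
move=> Ax; have yS : unit_solution suspended_dom suspended_field (fun=> (0, (e, x))).
  move=> u _; split => //; apply: is_derive_eq (is_derive_cst _ _ _) _.
  by rewrite /suspended_field scale0r.
split; first by exists (fun=> (0, (e, x))).
by rewrite /flow_map (time_oneE (fV := fP) oS (suspended_field_smooth 1%N) yS).
Qed.

(* The derivative with respect to time comes from the solution
   [u |-> (1, 0, u X(e, c u))] of the variational equation. *)
Lemma flow_derive t e x : flow_dom (t, (e, x)) ->
  A (e, flow_map (t, (e, x))) /\
  is_derive t (1 : R) (fun s => flow_map (s, (e, x))) (X (e, flow_map (t, (e, x)))).
Proof.
move=> txD; have [y y0 yS] := txD.
have i01 : 0 <= (1 : R) <= 1 by apply/andP; split; [exact: ler01|exact: lexx].
have yE := suspended_solution yS; rewrite y0 /= in yE.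
have fE' : flow_map (t, (e, x)) = (y 1).2.2.
  by rewrite /flow_map -y0 (time_oneE (fV := fP) oS (suspended_field_smooth 1%N) yS).
split; first by rewrite fE'; have [] := yE _ i01.
have [Sd dE] := time_one_diff (fV := fP) oS (suspended_field_smooth 1%N) txD.
pose w u : R * (E * V) := (1, (0, u *: X (e, (y u).2.2))).
have w0 : w 0 = (1, (0, 0)) by rewrite /w scale0r.
have wD (u : R) : 0 <= u <= 1 ->
    is_derive u (1 : R) w ('d suspended_field (y u) (w u)).
  move=> u01; have [Ay _] := yS u u01.
  have [y1 y2 Ac cD] := yE u u01.
  rewrite (is_diffE (suspended_diff Ay)) /=.
  have yuE : (y u).2 = (e, (y u).2.2) by rewrite [LHS]surjective_pairing y2.
  apply: (is_derive_pair (is_derive_cst _ _ _) (is_derive_pair (is_derive_cst _ _ _) _)).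
  have ecD := is_derive_pair (is_derive_cst e u (1 : R)) cD.
  have XcD := is_derive_comp_diff ecD (class_C_is_diff (XA 1%N) Ac).
  have idD := is_derive_diff (is_derive_id u (1 : R)).
  have := is_diff_derive (1 : R) (is_diff_scale idD (is_derive_diff XcD)).
  move=> h; apply: is_derive_eq h _.
  rewrite y1 yuE !scale1r; congr (_ + _).
  have -> : ((0, t *: X (e, (y u).2.2)) : E * V) = t *: (0, X (e, (y u).2.2)).
    by apply: injective_projections; rewrite //= scaler0.
  have -> : ((0, u *: X (e, (y u).2.2)) : E * V) = u *: (0, X (e, (y u).2.2)).
    by apply: injective_projections; rewrite //= scaler0.
  by rewrite !linearZ /= !scalerA mulrC.
have dTE := dE y w _ y0 yS w0 wD.
have sD := is_derive_pair (is_derive_id t (1 : R)) (is_derive_cst (e, x) t (1 : R)).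
have := is_derive_comp_diff sD (differentiableP Sd).
move=> /is_derive_snd/is_derive_snd.
by rewrite dTE fE' /= scale1r.
Qed.

End ParametrizedFlow.

(** * Implicit function theorem *)

Section ImplicitFunction.
Context {R : realType}.

Lemma linear_scale_sub0 (V W : normedModType R) (f : {linear V -> W}) (a : R) (u v : V) :
  f u - f v = 0 -> f (a *: (u - v)) = 0.
Proof. by move=> fuv; rewrite linearZ linearB /= fuv scaler0. Qed.

Lemma class_C_det k (V : normedModType R) (A : set V) n (F : V -> 'M[R]_n) : open A ->
  (forall i j, class_C k A (fun x => F x i j)) -> class_C k A (fun x => \det (F x)).
Proof.
move=> oA FA; apply: class_C_sum => // s; apply: class_C_mul => //.
  exact: class_C_cst.
exact: class_C_prod.
Qed.

Lemma class_C_adj k (V : normedModType R) (A : set V) n (F : V -> 'M[R]_n) i j : open A ->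
  (forall i j, class_C k A (fun x => F x i j)) -> class_C k A (fun x => (\adj (F x)) i j).
Proof.
move=> oA FA; under [X in class_C _ _ X]eq_fun do rewrite mxE.
apply: class_C_mul => //; first exact: class_C_cst.
apply: class_C_det => // a b.
by under [X in class_C _ _ X]eq_fun do rewrite !mxE.
Qed.

(** Cramer's rule without division: preimages are polynomial in the entries of the matrix, so their
    smooth dependence on a base point is immediate. *)
Lemma linear_adj (V : normedModType R) n (e : 'I_n -> V) (l : 'I_n -> {linear V -> R})
    (f : {linear V -> V}) (w : V) :
  (forall v, v = \sum_i l i v *: e i) ->
  let M := \matrix_(i, j) l i (f (e j)) in
  f (\sum_j (\adj M *m \col_i l i w) j ord0 *: e j) = \det M *: w.
Proof.
move=> le M; rewrite linear_sum [RHS]le.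
have -> : \sum_j f ((\adj M *m \col_i l i w) j ord0 *: e j) =
   \sum_i (M *m (\adj M *m \col_i l i w)) i ord0 *: e i.
  transitivity (\sum_j \sum_i (M i j * (\adj M *m \col_i l i w) j ord0) *: e i).
    apply: eq_bigr => j _; rewrite linearZ /= [in LHS](le (f (e j))) scaler_sumr.
    by apply: eq_bigr => i _; rewrite scalerA mulrC [M i j]mxE.
  rewrite exchange_big; apply: eq_bigr => i _ /=.
  by rewrite -scaler_suml mxE.
apply: eq_bigr => i _; congr (_ *: _).
by rewrite mulmxA mul_mx_adj mul_scalar_mx linearZ !mxE.
Qed.

Lemma linear_det_neq0 (V : normedModType R) n (e : 'I_n -> V) (l : 'I_n -> {linear V -> R})
    (f : {linear V -> V}) :
  (forall v, v = \sum_i l i v *: e i) -> (forall i j, l i (e j) = (i == j)%:R) ->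
  (forall v, f v = 0 -> v = 0) -> \det (\matrix_(i, j) l i (f (e j))) != 0.
Proof.
move=> le ld finj; apply/negP; rewrite -det_tr => /det0P[v v0 vM].
have fv : f (\sum_j v ord0 j *: e j) = 0.
  rewrite [LHS]le big1// => i _; have /matrixP/(_ ord0 i) := vM.
  rewrite mxE mxE linear_sum raddf_sum => /= vi.
  rewrite (eq_bigr (fun j => v ord0 j * (\matrix_(i, j) l i (f (e j)))^T j i)).
    by rewrite vi scale0r.
  by move=> j _; rewrite !mxE !linearZ.
case/eqP: v0; apply/rowP => j; rewrite mxE.
have := finj _ fv => /(congr1 (l j)); rewrite linear0 linear_sum.
rewrite (bigD1 j)//= linearZ /= ld eqxx big1 ?addr0 => [|i ij].
  by rewrite -[_ *: _]/(_ * _) mulr1.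
by rewrite linearZ /= ld eq_sym (negPf ij) scaler0.
Qed.

Lemma injective_linear_bound (V : normedModType R) (fV : findim V) (f : {linear V -> V}) :
  (forall v, f v = 0 -> v = 0) ->
  exists2 C : R, 0 < C & forall v, `|v| <= C * `|f v|.
Proof.
have [n [e [l [lc le ld]]]] := fV; move=> finj.
have kP i : exists k : R, 0 < k /\ forall v, `|l i v| <= k * `|v|.
  by have [k k0 kP] := linear_lipschitz (lc i); exists k.
pose k i := sval (cid (kP i)).
have k0 i : 0 < k i by rewrite /k; case: cid => ? [].
have kl i v : `|l i v| <= k i * `|v| by rewrite /k; case: cid => ? [].
pose M := \matrix_(i, j) l i (f (e j)).
have M0 : \det M != 0 by exact: linear_det_neq0.
pose C := \sum_j \sum_i `|\adj M j i| * k i * `|e j|.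
have C0 : 0 <= C.
  by apply: sumr_ge0 => j _; apply: sumr_ge0 => i _; rewrite !mulr_ge0// ltW.
have CP w : `|\sum_j (\adj M *m \col_i l i w) j ord0 *: e j| <= C * `|w|.
  rewrite (le_trans (ler_norm_sum _ _ _))// mulr_suml; apply: ler_sum => j _.
  rewrite normrZ mxE mulr_suml (le_trans (ler_wpM2r _ (ler_norm_sum _ _ _)))//.
  rewrite !mulr_suml; apply: ler_sum => i _.
  rewrite (_ : (\col_i l i w) i ord0 = l i w) ?normrM; last by rewrite mxE.
  have -> : `|\adj M j i| * k i * `|e j| * `|w| = `|\adj M j i| * (k i * `|w|) * `|e j|.
    by ring.
  by rewrite ler_wpM2r// ler_wpM2l.
exists (1 + `|\det M|^-1 * C).
  by rewrite ltr_pwDl// mulr_ge0// invr_ge0.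
move=> v; have := linear_adj f (f v) le; rewrite -/M => /= fE.
have vE : v = (\det M)^-1 *: \sum_j (\adj M *m \col_i l i (f v)) j ord0 *: e j.
  apply/eqP; rewrite -subr_eq0; apply/eqP/finj.
  by rewrite linearB linearZ fE /= scalerA mulVf// scale1r subrr.
rewrite [in leLHS]vE normrZ normfV mulrDl mul1r -mulrA.
rewrite (@le_trans _ _ (`|\det M|^-1 * (C * `|f v|)))//.
  by rewrite ler_wpM2l// invr_ge0.
by rewrite lerDr.
Qed.

(* The implicit function is the solution of the Davidenko differential equation
   [z' = - (D_z G)^-1 (D_e G)]; its smoothness is that of the flow. *)
Theorem implicit_function (V : normedModType R) (fV : findim V) (A : set (R * V))
    (G : R * V -> V) (z0 : V) :
  open A -> smooth_on A G -> A (0, z0) -> G (0, z0) = 0 ->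
  (forall v, 'd G (0, z0) (0, v) = 0 -> v = 0) ->
  exists (e0 : R) (zeta : R -> V), [/\ 0 < e0,
    smooth_on [set e : R | `|e| < e0] zeta, zeta 0 = z0,
    forall e, `|e| < e0 -> A (e, zeta e) /\ G (e, zeta e) = 0 &
    \forall r \near 0^'+, forall e z, `|e| < r -> `|z - z0| < r ->
      G (e, z) = 0 -> z = zeta e].
Proof.
move=> oA GA A0 G0 Ginj; have [n [b [l [lc le ld]]]] := fV.
have fP : findim ((R * V)%type : normedModType R) by exact: findim_prod findim_real fV.
have inlin : linear (fun v : V => (0, v) : R * V).
  by move=> a u v; apply: injective_projections; rewrite //= scaler0 addr0.
pose inV : {linear V -> (R * V)%type} :=
  HB.pack (fun v : V => (0, v) : R * V) (GRing.isLinear.Build _ _ _ _ _ inlin).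
pose dG p : {linear V -> V} := 'd G p \o inV.
pose M p := \matrix_(i, j) l i (dG p (b j)).
pose dir : R * V := (1, 0).
(* By Cramer's rule, [eta p] solves [D_z G (eta p) = D_e G]; its opposite is the slope of the
   implicit curve. *)
pose eta p := (\det (M p))^-1 *:
  \sum_j (\adj (M p) *m \col_i l i ('d G p dir)) j ord0 *: b j.
pose A' := [set p | A p /\ \det (M p) != 0].
have Mk k i j : class_C k A (fun p => M p i j).
  under [X in class_C _ _ X]eq_fun do rewrite mxE.
  exact: (class_C_comp_lin oA (lc i) (class_C_diff (inV (b j)) (GA k.+1))).
have detk k : class_C k A (fun p => \det (M p)) by exact: class_C_det.
have oA' : open A'.
  rewrite openE => p [Ap p0]; rewrite /interior.
  have := class_C_continuous (detk 0%N) Ap.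
  move=> /(_ [set x : R | x != 0]) /(_ (open_near open_neq0 p0)) /= h.
  by apply: filterS2 (open_near oA Ap) h => q Aq q0; split.
have A'A : A' `<=` A by move=> p [].
have etak k : class_C k A' eta.
  apply: class_C_scale => //.
    apply: class_C_inv => // [p []//|]; exact: class_C_sub A'A (detk k).
  apply: class_C_sum => // j; apply: class_C_scale => //; last exact: class_C_cst.
  under [X in class_C _ _ X]eq_fun do rewrite mxE.
  apply: class_C_sum => // i; apply: class_C_mul => //.
    by apply: class_C_adj => // ? ?; apply: class_C_sub A'A _; exact: Mk.
  under [X in class_C _ _ X]eq_fun do rewrite mxE.
  apply: class_C_sub A'A _.
  exact: (class_C_comp_lin oA (lc i) (class_C_diff dir (GA k.+1))).
have etaE p : A' p -> 'd G p (0, eta p) = 'd G p dir.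
  move=> [Ap p0]; rewrite -[LHS]/(dG p (eta p)) /eta linearZ /=.
  have := linear_adj (dG p) ('d G p dir) le; rewrite -/(M p) /= => ->.
  by rewrite scalerA mulVf// scale1r.
have A'0 : A' (0, z0).
  by split => //; apply: linear_det_neq0 => //; exact: Ginj.
(* In a state [(e, (u, z))], the target [e] is frozen, [u] runs from 0 to [e] in unit time, and [z]
   follows the curve. *)
pose Y (q : R * (R * V)) : R * (R * V) := (0, (q.1, q.1 *: - eta q.2)).
pose S := [set q : R * (R * V) | A' q.2].
have oS : open S by exact: open_snd.
have YS : smooth_on S Y.
  have fstk k : class_C k S (fst : R * (R * V) -> R).
    by apply: class_C_fst => //; exact: class_C_id.
  move=> k; apply: class_C_pair => //; first exact: class_C_cst.
  apply: class_C_pair => //; apply: class_C_scale => //; apply: class_C_opp => //.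
  apply: (class_C_comp fP oS (fun q Sq => Sq) _ (etak k)).
  by apply: class_C_snd => //; exact: class_C_id.
have fQ : findim ((R * (R * V))%type : normedModType R) by exact: findim_prod findim_real fP.
pose D := unit_domain S Y.
have oD : open D by exact: (unit_domain_open (fV := fQ) oS (YS 1%N)).
have cstS : unit_solution S Y (fun=> (0, (0, z0))).
  move=> t _; split => //; apply: is_derive_eq (is_derive_cst _ _ _) _.
  by rewrite /Y scale0r.
have D0 : D (0, (0, z0)) by exists (fun=> (0, (0, z0))).
pose inj (e : R) : R * (R * V) := (e, (0, z0)).
have injk k (B : set R) : open B -> class_C k B inj.
  by move=> oB; apply: class_C_pair => //; [exact: class_C_id|exact: class_C_cst].
have /nbhs_ballP[e0 /= e00 eP] : \forall e \near (0 : R), D (inj e).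
  have injc : {for 0, continuous inj}.
    exact: (class_C_continuous (injk 0%N setT openT)).
  exact: (injc D (open_near oD D0)).
pose zeta e := (time_one S Y (inj e)).2.2.
have Dz e : `|e| < e0 -> D (inj e).
  by move=> ee; apply: eP; rewrite -ball_normE /= sub0r normrN.
have oB : open [set e : R | `|e| < e0].
  apply: (@open_comp _ _ (fun e : R => `|e|) [set x | x < e0]); last exact: open_lt.
  by move=> x _; exact: norm_continuous.
have zk k : class_C k [set e : R | `|e| < e0] zeta.
  apply: class_C_snd => //; apply: class_C_snd => //.
  exact: (class_C_comp fQ oB Dz (injk _ _ oB) (time_one_smooth fQ oS YS k)).
have z00 : zeta 0 = z0.
  by have := time_oneE (fV := fQ) oS (YS 1%N) cstS; rewrite /zeta /inj => ->.
have i01 : 0 <= (1 : R) <= 1 by apply/andP; split; [exact: ler01|exact: lexx].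
have zG e : `|e| < e0 -> A (e, zeta e) /\ G (e, zeta e) = 0.
  move=> /Dz[y y0 yS].
  have y1 u : 0 <= u <= 1 -> (y u).1 = e.
    rewrite -[e]/((inj e).1) -y0.
    apply: (@is_derive0_cst _ _ findim_real (fun u => (y u).1)) => s s01.
    by have [_ yD] := yS s s01; exact: (is_derive_fst yD).
  have y2 u : 0 <= u <= 1 -> (y u).2.1 - e * u = (y 0).2.1 - e * 0.
    apply: (@is_derive0_cst _ _ findim_real (fun u => (y u).2.1 - e * u)) => s s01.
    have [_ yD] := yS s s01.
    have eD : is_derive s (1 : R) (fun u : R => e * u) e.
      apply: is_derive_eq (is_deriveZ _ (is_derive_id s (1 : R))) _.
      exact: mulr1.
    apply: is_derive_eq (is_deriveB (is_derive_fst (is_derive_snd yD)) eD) _.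
    by rewrite /= (y1 s s01) subrr.
  (* The velocity is a multiple of [(1, - eta)], which lies in the kernel of the differential of
     [G]. *)
  have yG u : 0 <= u <= 1 -> G (y u).2 = G (y 0).2.
    apply: (@is_derive0_cst _ _ fV (fun u => G (y u).2)) => s s01.
    have [[Ay dy] yD] := yS s s01.
    apply: is_derive_eq
      (is_derive_comp_diff (is_derive_snd yD) (class_C_is_diff (GA 1%N) Ay)) _.
    have -> : (Y (y s)).2 = (y s).1 *: (dir - (0, eta (y s).2)).
      by apply: injective_projections; rewrite /= ?subr0 ?sub0r// -[_ *: _]/(_ * _) mulr1.
    have dE : 'd G ((y s).2) dir - 'd G ((y s).2) (0, eta (y s).2) = 0.
      have ee := etaE _ (conj Ay dy).
      exact: etrans (congr1 (fun x => 'd G ((y s).2) dir - x) ee) (subrr _).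
    exact: linear_scale_sub0.
  have zE : (e, zeta e) = (y 1).2.
    apply: injective_projections => /=.
      by have := y2 _ i01; rewrite y0 /= !mulr1 mulr0 subrr => /subr0_eq.
    by rewrite /zeta -y0 (time_oneE (fV := fQ) oS (YS 1%N) yS).
  rewrite zE (yG _ i01) y0; split => //.
  by have [[]] := yS _ i01.
exists e0, zeta; split => //.
(* Two zeros over the same [e] differ by a vertical vector. The partial differential expands it by
   at least [1 / C], while [G] differs from its differential by a map of Lipschitz constant
   [1 / (2 C)]. *)
have [C C0 CP] := injective_linear_bound fV (f := dG (0, z0)) Ginj.
have C2 : 0 < (2 * C)^-1 by rewrite invr_gt0 mulr_gt0.
have [r r0 [rA _ rL]] := strict_diff fP fV oA (GA 1%N) A0 C2.
have zc : zeta e @[e --> 0] --> z0.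
  rewrite -z00; apply: (class_C_continuous (zk 0%N)) => /=.
  by rewrite normr0.
have [d /= d0 dP] : \forall e \near (0 : R), `|z0 - zeta e| < r.
  by move/cvgrPdist_lt : zc => /(_ _ r0).
near=> s => e z es zs Gz.
have sr : s <= r by near: s; exact: nbhs_right_le.
have sd : s <= d by near: s; exact: nbhs_right_le.
have se : s <= e0 by near: s; exact: nbhs_right_le.
have [_ Gze] := zG e (lt_le_trans es se).
have B1 : ball (0, z0) r (e, z).
  split; rewrite /= -ball_normE /= ?sub0r ?normrN; first exact: lt_le_trans es sr.
  by rewrite distrC (lt_le_trans zs).
have B2 : ball (0, z0) r (e, zeta e).
  split; rewrite /= -ball_normE /= ?sub0r ?normrN; first exact: lt_le_trans es sr.
  by apply: dP; rewrite /= sub0r normrN (lt_le_trans es).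
have := rL _ _ B1 B2; rewrite Gz Gze subrr sub0r normrN.
have -> : (e, z) - (e, zeta e) = (0, z - zeta e).
  by apply: injective_projections; rewrite //= subrr.
move=> h; apply/eqP; rewrite -subr_eq0 -normr_le0.
have := CP (z - zeta e); rewrite -[dG _ _]/('d G (0, z0) (0, z - zeta e)) => h2.
have : `|z - zeta e| <= C * ((2 * C)^-1 * `|z - zeta e|).
  rewrite (le_trans h2)// ler_wpM2l ?(ltW C0)// (le_trans h)//.
  by rewrite prod_normE /= normr0 (max_idPr (normr_ge0 _)).
have -> : C * ((2 * C)^-1 * `|z - zeta e|) = `|z - zeta e| / 2 by field; rewrite gt_eqF.
by lra.
Unshelve. all: by end_near. Qed.

End ImplicitFunction.

(** * Continuous dependence of roots on coefficients *)

Section RootsOfPolynomials.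
Variable C : numClosedFieldType.
Implicit Types (z w : C) (r : seq C) (p q : {poly C}).

Lemma prod_norm_gt r z (eta : C) : 0 < eta -> r != [::] ->
  (forall w, w \in r -> eta < `|z - w|) -> eta ^+ size r < `|\prod_(w <- r) (z - w)|.
Proof.
move=> eta0; elim: r => [//|w r IHr _ rP].
rewrite big_cons normrM /= exprS.
have wP : eta < `|z - w| by apply: rP; rewrite inE eqxx.
have [->|r0] := eqVneq r [::]; first by rewrite big_nil normr1 expr0 !mulr1.
apply: ltr_pM => //; [exact: ltW|exact/exprn_ge0/ltW|].
by apply: IHr => // u ur; apply: rP; rewrite inE ur orbT.
Qed.

Lemma small_factor r z (eta : C) : 0 < eta -> r != [::] ->
  `|\prod_(w <- r) (z - w)| <= eta ^+ size r -> exists2 w, w \in r & `|z - w| <= eta.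
Proof.
move=> eta0 r0 rle; have [/hasP[]|/hasPn rP] := boolP (has (fun w => `|z - w| <= eta) r).
  by move=> w; exists w.
have h := @prod_norm_gt r z eta eta0 r0.
have : eta ^+ size r < eta ^+ size r.
  apply: lt_le_trans rle; apply: h => w /rP; rewrite real_ltNge//; first exact: gtr0_real.
by rewrite ltxx.
Qed.

(** The order of [C] is partial; [a b / (a + b)] replaces the minimum. *)
Lemma pos_min (a b : C) : 0 < a -> 0 < b -> exists2 c, 0 < c & c <= a /\ c <= b.
Proof.
move=> a0 b0; have ab0 : 0 < a + b by exact: addr_gt0.
exists (a * b / (a + b)); first by rewrite divr_gt0// mulr_gt0.
rewrite !ler_pdivrMr// !mulrDr; split.
  by rewrite lerDr mulr_ge0// ltW.
by rewrite [b * a]mulrC lerDl mulr_ge0// ltW.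
Qed.

Lemma coefXsubM z p i : (('X - z%:P) * p)`_i.+1 = p`_i - z * p`_i.+1.
Proof. by rewrite mulrBl coefB coefXM /= coefCM. Qed.

(* Backward recursion for the coefficients of the quotients by [X - z] and
   [X - w]. *)
Lemma quotient_coef_close (p1 q1 : {poly C}) z w n (d eta B : C) :
  (size p1 <= n)%N -> (size q1 <= n)%N -> 0 <= d -> 0 <= eta -> eta <= 1 ->
  `|z - w| <= eta -> (forall i, `|p1`_i| <= B) ->
  (forall i, `|(('X - w%:P) * q1)`_i - (('X - z%:P) * p1)`_i| <= d) ->
  forall i, `|q1`_i - p1`_i| <= (d + eta * B) * \sum_(j < n) (`|z| + 1) ^+ j.
Proof.
move=> sp sq d0 eta0 eta1 zw pB close.
have B0 : 0 <= B by exact: le_trans (pB 0%N).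
have D0 : 0 <= d + eta * B by rewrite addr_ge0// mulr_ge0.
have z1 : 0 <= `|z| + 1 by rewrite addr_ge0.
(* [k] counts coefficients from degree [n], from which on both quotients vanish; going down, [q_i]
   is the coefficient of degree [i + 1] of [(X - w) q] plus [w] times [q_{i+1}]. *)
have main k : forall i, (n - k <= i)%N ->
    `|q1`_i - p1`_i| <= (d + eta * B) * \sum_(j < k) (`|z| + 1) ^+ j.
  elim: k => [|k IHk] i.
    rewrite subn0 => ni; rewrite !nth_default ?(leq_trans sp)// ?(leq_trans sq)//.
    by rewrite subrr normr0 big_ord0 mulr0.
  move=> ki; have {}IHk := IHk i.+1.
  have ki' : (n - k <= i.+1)%N by move: ki; rewrite subnS; case: (n - k)%N.
  have := close i.+1; rewrite !coefXsubM => ci.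
  have -> : q1`_i - p1`_i = (q1`_i - w * q1`_i.+1 - (p1`_i - z * p1`_i.+1)) +
     (w * (q1`_i.+1 - p1`_i.+1) - (z - w) * p1`_i.+1) by ring.
  rewrite big_ord_recl expr0.
  have wz : `|w| <= `|z| + 1.
    have -> : w = z - (z - w) by ring.
    by rewrite (le_trans (ler_normB _ _))// lerD2l (le_trans zw).
  have h1 : `|w * (q1`_i.+1 - p1`_i.+1)| <=
      (`|z| + 1) * ((d + eta * B) * \sum_(j < k) (`|z| + 1) ^+ j).
    by rewrite normrM ler_pM// IHk.
  have h2 : `|(z - w) * p1`_i.+1| <= eta * B by rewrite normrM ler_pM.
  rewrite (le_trans (ler_normD _ _))//.
  have h3 := le_trans (ler_normB (w * (q1`_i.+1 - p1`_i.+1)) ((z - w) * p1`_i.+1))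
    (lerD h1 h2).
  rewrite (le_trans (lerD ci h3))// le_eqVlt; apply/orP; left; apply/eqP.
  have -> : \sum_(i < k) (`|z| + 1) ^+ (lift ord0 i) =
     (`|z| + 1) * \sum_(i < k) (`|z| + 1) ^+ i.
    by rewrite mulr_sumr; apply: eq_bigr => j _; rewrite -exprS.
  ring.
by move=> i; apply: main; rewrite subnn.
Qed.

Lemma monic_roots q : q \is monic -> exists2 r, size r = (size q).-1 &
  q = \prod_(w <- r) ('X - w%:P).
Proof.
move=> /monicP qm; have [r] := closed_field_poly_normal q.
rewrite qm scale1r => qE; exists r => //.
by rewrite qE size_prod_XsubC.
Qed.

(** If [z] is a root of the first polynomial, [q] is small at [z]; this value is the product of the
    differences between [z] and the roots of [q], so one root [w] is close to [z]. The quotients by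
    [X - z] and [X - w] have close coefficients, which allows induction on the list of roots. *)
Lemma roots_close r (e : C) : 0 < e -> exists2 d, 0 < d &
  forall q, q \is monic -> size q = (size r).+1 ->
  (forall i, `|q`_i - (\prod_(z <- r) ('X - z%:P))`_i| <= d) ->
  exists r', [/\ size r' = size r, q = \prod_(z <- r') ('X - z%:P) &
    forall i, `|r'`_i - r`_i| < e].
Proof.
move=> e0; elim: r => [|z r [d1 d10 IHr]].
  exists 1 => // q qm sq _; exists [::]; split=> [//||i].
    have [r' sr' ->] := monic_roots qm; move: sr'; rewrite sq.
    by case: r' => // _; rewrite !big_nil.
  by rewrite !nth_nil subrr normr0.
set p1 := \prod_(u <- r) ('X - u%:P); pose n := (size r).+1.
have sp1 : size p1 = n by rewrite size_prod_XsubC.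
pose B := \sum_(i < n) `|p1`_i|.
have pB i : `|p1`_i| <= B.
  have [ni|ni] := ltnP i n.
    by rewrite /B (bigD1 (Ordinal ni))//= lerDl sumr_ge0.
  by rewrite nth_default ?sp1// normr0 sumr_ge0.
have B0 : 0 <= B by rewrite sumr_ge0.
pose S := \sum_(j < n) (`|z| + 1) ^+ j.
have S0 : 0 < S.
  rewrite /S big_ord_recl expr0 ltr_pwDl//; apply: sumr_ge0 => i _.
  by apply: exprn_ge0; exact: addr_ge0.
(* [eta], the distance allowed between [z] and [w], is at most 1 and [e / 2], and small enough to
   move the quotient's coefficients by at most half of [d1]. Below, [d] makes the value at [z] at
   most [eta ^+ n] and contributes the other half. *)
have [c c0 [c1 ce]] := pos_min ltr01 (divr_gt0 e0 (ltr0Sn C 1)).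
have dS0 : 0 < d1 / (2 * (B + 1) * S).
  by rewrite divr_gt0// !mulr_gt0// ltr_wpDl.
have [eta eta0 [etac etaS]] := pos_min c0 dS0.
pose A := \sum_(j < n.+1) `|z| ^+ j.
have A0 : 0 < A.
  rewrite /A big_ord_recl expr0 ltr_pwDl//; apply: sumr_ge0 => i _.
  exact: exprn_ge0.
have etan : 0 < eta ^+ n / A by rewrite divr_gt0// exprn_gt0.
have dS1 : 0 < d1 / (2 * S) by rewrite divr_gt0// mulr_gt0.
have [d d0 [dA dS]] := pos_min etan dS1.
exists d => // q qm sq close.
have [t st qE] := monic_roots qm; rewrite sq /= in st.
have qz : `|\prod_(w <- t) (z - w)| <= eta ^+ size t.
  have <- : q.[z] = \prod_(w <- t) (z - w).
    by rewrite qE horner_prod; apply: eq_bigr => w _; rewrite hornerXsubC.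
  have pz : (\prod_(u <- z :: r) ('X - u%:P)).[z] = 0.
    by rewrite big_cons hornerM hornerXsubC subrr mul0r.
  set p := \prod_(u <- z :: r) ('X - u%:P) in pz close.
  have sp : size p = n.+1 by rewrite size_prod_XsubC.
  have hq : q.[z] = \sum_(j < n.+1) q`_j * z ^+ j by apply: horner_coef_wide; rewrite sq.
  have hp : p.[z] = \sum_(j < n.+1) p`_j * z ^+ j by apply: horner_coef_wide; rewrite sp.
  rewrite -[q.[z]]subr0 -pz hq hp -sumrB st.
  rewrite (le_trans (ler_norm_sum _ _ _))// (@le_trans _ _ (d * A))//.
    rewrite mulr_sumr; apply: ler_sum => j _.
    by rewrite -mulrBl normrM normrX ler_wpM2r// exprn_ge0.
  by rewrite -ler_pdivlMr.
have t0 : t != [::] by rewrite -size_eq0 st.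
have [w wt zw] := small_factor eta0 t0 qz.
have qE1 : q = ('X - w%:P) * \prod_(u <- rem w t) ('X - u%:P).
  by rewrite qE (big_rem w).
set q1 := \prod_(u <- rem w t) ('X - u%:P) in qE1.
have sq1 : size q1 = n by rewrite size_prod_XsubC size_rem// st.
have q1m : q1 \is monic by rewrite monic_prod_XsubC.
have eta1 : eta <= 1 by exact: le_trans c1.
have q1close i : `|q1`_i - p1`_i| <= d1.
  have close' j : `|(('X - w%:P) * q1)`_j - (('X - z%:P) * p1)`_j| <= d.
    by rewrite -qE1; have := close j; rewrite big_cons.
  have h := quotient_coef_close (eq_leq sp1) (eq_leq sq1) (ltW d0) (ltW eta0) eta1 zw
    pB close' i.
  apply: le_trans h _; rewrite -/S.
  have h1 : d * (2 * S) <= d1 by rewrite -ler_pdivlMr// mulr_gt0.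
  have h2 : eta * (2 * (B + 1) * S) <= d1.
    by rewrite -ler_pdivlMr// !mulr_gt0// ltr_wpDl.
  rewrite -(@ler_pM2r _ 2)// [leRHS]mulr_natr mulr2n.
  have -> : (d + eta * B) * S * 2 = d * (2 * S) + (eta * (2 * (B + 1) * S) - 2 * (eta * S)).
    by ring.
  rewrite lerD// (le_trans _ h2)// gerBl mulr_ge0// mulr_ge0// ltW//.
have [r' [sr' q1E r'close]] := IHr q1 q1m sq1 q1close.
exists (w :: r'); split=> [|| [|i]].
- by rewrite /= sr'.
- by rewrite qE1 q1E big_cons.
- rewrite /= distrC (le_lt_trans zw)// (le_lt_trans etac)// (le_lt_trans ce)//.
  by rewrite ltr_pdivrMr// ltr_pMr// ltr1n.
- exact: r'close.
Qed.

End RootsOfPolynomials.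

(** * Continuity of the eigenvalues of a matrix *)

Section ContinuityOfEigenvalues.
Context {R : realType}.

Lemma cvg_coefM (F : set_system R) (P Q : R -> {poly R}) (p q : {poly R}) : Filter F ->
  (forall i, (P t)`_i @[t --> F] --> p`_i) -> (forall i, (Q t)`_i @[t --> F] --> q`_i) ->
  forall i, (P t * Q t)`_i @[t --> F] --> (p * q)`_i.
Proof.
move=> FF Pp Qq i; under eq_fun do rewrite coefM; rewrite coefM.
by apply: cvg_big => [|j _]; [exact: add_continuous|exact: cvgM].
Qed.

Lemma cvg_coef_prod (F : set_system R) (I : Type) (r : seq I) (P : I -> R -> {poly R})
    (p : I -> {poly R}) : Filter F ->
  (forall i k, (P i t)`_k @[t --> F] --> (p i)`_k) ->
  forall k, (\prod_(i <- r) P i t)`_k @[t --> F] --> (\prod_(i <- r) p i)`_k.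
Proof.
move=> FF Pp; elim: r => [|i r IHr] k.
  by under eq_fun do rewrite big_nil; rewrite big_nil; exact: cvg_cst.
by under eq_fun do rewrite big_cons; rewrite big_cons; exact: cvg_coefM.
Qed.

Lemma cvg_char_poly n (F : set_system R) (M : R -> 'M[R]_n) (m : 'M[R]_n) : Filter F ->
  (forall i j, M t i j @[t --> F] --> m i j) ->
  forall k, (char_poly (M t))`_k @[t --> F] --> (char_poly m)`_k.
Proof.
move=> FF Mm; rewrite /char_poly /determinant => k.
under eq_fun do rewrite coef_sum; rewrite coef_sum.
apply: cvg_big => [|s _]; first exact: add_continuous.
apply: cvg_coefM => i; first exact: cvg_cst.
apply: cvg_coef_prod => {}i {}k; rewrite !mxE coefB coefC.
under eq_fun do rewrite !mxE coefB coefC.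
by apply: cvgB; [exact: cvg_cst|case: ifP => _; [exact: Mm|exact: cvg_cst]].
Qed.

Lemma norm_real_complex (x : R) : `|x%:C%C| = `|x|%:C%C.
Proof. by rewrite normc_def /= expr0n addr0 sqrtr_sqr. Qed.

Lemma continuous_eigenvalues n (I : set R) (M : R -> 'M[R]_n) :
  (forall mu, I mu -> forall i j, M nu i j @[nu --> within I (nbhs mu)] --> M mu i j) ->
  continuous_unordered I (fun mu (l : n.-tuple R[i]) =>
    map_poly (real_complex R) (char_poly (M mu)) = \prod_(z <- l) ('X - z%:P)).
Proof.
move=> Mc mu Imu.
pose p nu := map_poly (real_complex R) (char_poly (M nu)).
have pm nu : p nu \is monic by rewrite map_monic char_poly_monic.
have sp nu : size (p nu) = n.+1 by rewrite size_map_poly size_char_poly.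
have [r sr pE] := monic_roots (pm mu); rewrite sp /= in sr.
have sr' : size r == n by rewrite sr.
exists (Tuple sr') => // e e0.
have eC0 : 0 < e%:C%C :> R[i] by rewrite ltcR.
have [d d0 dP] := roots_close r eC0.
(* A positive complex number is real, so the tolerance can be compared with estimates on real
   coefficients. *)
pose dr := complex.Re d.
have dE : d = dr%:C%C.
  by move: d0; rewrite ltcE /= => /andP[/eqP d0 _]; rewrite /dr; move: d0; case: (d) => a b /= ->.
have dr0 : 0 < dr by move: d0; rewrite dE ltcR.
have close k : \forall nu \near mu, I nu ->
    `|(char_poly (M nu))`_k - (char_poly (M mu))`_k| <= dr.
  have WF : Filter (within I (nbhs mu)) by exact: within_filter.
  have := @cvg_char_poly n _ M (M mu) WF (Mc mu Imu) k.
  by move=> /cvgrPdist_le/(_ _ dr0); rewrite near_withinE; apply: filterS => nu + Inu => /(_ Inu);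
    rewrite distrC.
have closeI : \forall nu \near mu, forall k : 'I_n.+1, I nu ->
    `|(char_poly (M nu))`_k - (char_poly (M mu))`_k| <= dr.
  exact: (filter_forall (nbhs_filter mu) (fun k : 'I_n.+1 => close k)).
apply: filterS closeI => nu nuP Inu.
have [|k|r' [sr2 r'E r'close]] := dP (p nu) (pm nu).
- by rewrite sp sr.
- rewrite -pE !coef_map /= -rmorphB norm_real_complex dE lecR.
  have [kn|kn] := ltnP k n.+1; first exact: (nuP (Ordinal kn)).
  by rewrite !nth_default ?size_char_poly// subrr normr0 ltW.
have sr3 : size r' == n by rewrite sr2 sr.
exists (Tuple sr3) => // i.
by rewrite !(tnth_nth 0) /=.
Qed.

End ContinuityOfEigenvalues.

(** * Continuity of linear maps *)

Section LinearContinuity.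
Context {R : realType}.

Lemma linear_continuous_findim (V W : normedModType R) (fV : findim V) (f : {linear V -> W}) :
  continuous f.
Proof.
have [n [e [k k0 kP]]] := @linear_le_basis R V W fV.
apply: (@lipschitz_continuous _ _ _ _ (k * \sum_i `|f (e i)|)) => x y.
rewrite -linearB; apply: kP => i.
by rewrite (bigD1 i)//= lerDl sumr_ge0.
Qed.

End LinearContinuity.

(** * The rescaled Hamiltonian, its field and its symmetries *)

Section RescaledHamiltonian.
Context {R : realType}.
Implicit Types (x y v : phase R) (e mu : R) (p : R * phase R).

Definition phase_dir (k : nat) : phase R := delta_mx ord0 (inord k).

(** The Hamiltonian field as a function of the six partial derivatives, common to Hill's problem,
    the CR3BP and the rescaled family. *)
Definition symp_grad (d : nat -> R) : phase R :=
  mk_phase (d 3%N) (d 4%N) (d 5%N) (- d 0%N) (- d 1%N) (- d 2%N).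

Lemma mk_phase_coord (a b c d e f : R) : let x := mk_phase a b c d e f in
  ((q1 x = a) * (q2 x = b) * (q3 x = c) * (p1 x = d) * (p2 x = e) * (p3 x = f))%type.
Proof.
by rewrite /q1 /q2 /q3 /p1 /p2 /p3 !mxE !inordK.
Qed.

Lemma phase_eq x y : q1 x = q1 y -> q2 x = q2 y -> q3 x = q3 y ->
  p1 x = p1 y -> p2 x = p2 y -> p3 x = p3 y -> x = y.
Proof.
move=> h1 h2 h3 h4 h5 h6; apply/rowP => i.
have iE : i = inord i by rewrite inord_val.
rewrite iE; move: (ltn_ord i); case: (nat_of_ord i) => [|[|[|[|[|[|//]]]]]] _.
- exact: h1.
- exact: h2.
- exact: h3.
- exact: h4.
- exact: h5.
- exact: h6.
Qed.

Lemma coordD x y : (q1 (x + y) = q1 x + q1 y) * (q2 (x + y) = q2 x + q2 y) *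
  (q3 (x + y) = q3 x + q3 y) * (p1 (x + y) = p1 x + p1 y) * (p2 (x + y) = p2 x + p2 y) *
  (p3 (x + y) = p3 x + p3 y).
Proof. by rewrite /q1 /q2 /q3 /p1 /p2 /p3 !mxE. Qed.

Lemma coordZ e x : (q1 (e *: x) = e * q1 x) * (q2 (e *: x) = e * q2 x) *
  (q3 (e *: x) = e * q3 x) * (p1 (e *: x) = e * p1 x) * (p2 (e *: x) = e * p2 x) *
  (p3 (e *: x) = e * p3 x).
Proof. by rewrite /q1 /q2 /q3 /p1 /p2 /p3 !mxE. Qed.

Lemma coord_dir (j k : nat) : (j < 6)%N -> (k < 6)%N ->
  (phase_dir k) ord0 (inord j) = (j == k)%:R.
Proof. by move=> j6 k6; rewrite mxE eqxx /= -val_eqE /= !inordK. Qed.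

Lemma phase_expand x : x = q1 x *: phase_dir 0 + q2 x *: phase_dir 1 + q3 x *: phase_dir 2 +
  p1 x *: phase_dir 3 + p2 x *: phase_dir 4 + p3 x *: phase_dir 5.
Proof.
apply: phase_eq; rewrite !coordD !coordZ /q1 /q2 /q3 /p1 /p2 /p3 !coord_dir//=.
all: by rewrite !mulr1 !mulr0 ?addr0 ?add0r.
Qed.

(** Antisymmetry of the symplectic form, the source of energy conservation. *)
Lemma linear_symp_grad (l : {linear phase R -> R}) :
  l (symp_grad (fun k => l (phase_dir k))) = 0.
Proof.
have lZ a v : l (a *: v) = a * l v by rewrite linearZ.
rewrite [in LHS](phase_expand (symp_grad _)) !linearD !lZ /symp_grad !mk_phase_coord.
ring.
Qed.

Lemma symp_gradZ e (d : nat -> R) : symp_grad (fun k => e * d k) = e *: symp_grad d.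
Proof. by apply: phase_eq; rewrite !coordZ /symp_grad !mk_phase_coord ?mulrN. Qed.

Lemma ham_fieldE (S : ham_system R) x : differentiable (ham S) x ->
  ham_field S x = symp_grad (fun k => 'd (ham S) x (phase_dir k)).
Proof. by move=> dS; rewrite /ham_field /= !deriveE. Qed.

Lemma enorm3_eq0 (a b c : R) : (enorm3 a b c == 0) = (a ^+ 2 + b ^+ 2 + c ^+ 2 == 0).
Proof.
have n0 : 0 <= a ^+ 2 + b ^+ 2 + c ^+ 2 by rewrite !addr_ge0// sqr_ge0.
by rewrite /enorm3 sqrtr_eq0 le_eqVlt ltNge n0 orbF.
Qed.

Lemma enorm3_gt0 (a b c : R) : enorm3 a b c != 0 -> 0 < a ^+ 2 + b ^+ 2 + c ^+ 2.
Proof. by rewrite enorm3_eq0 lt_neqAle eq_sym => -> /=; rewrite !addr_ge0// sqr_ge0. Qed.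

(* With [r = |(1 + e q1, e q2, e q3)|] and [r^2 = 1 + e u], the expansion
   [1 / r = 1 - e u / 2 + (e u)^2 (r + 2) / (2 r (r + 1)^2)] is exact, so that the
   quotient by [e ^ 2] of the translated CR3BP Hamiltonian extends smoothly to
   [e = 0], where it is Hill's Hamiltonian. *)
Definition rescaled_ham p : R :=
  let e := p.1 in let x := p.2 in
  let n := q1 x ^+ 2 + q2 x ^+ 2 + q3 x ^+ 2 in
  let u := 2 * q1 x + e * n in
  let r := enorm3 (1 + e * q1 x) (e * q2 x) (e * q3 x) in
  kinetic x + p1 x * q2 x - p2 x * q1 x - 1 / enorm3 (q1 x) (q2 x) (q3 x)
  + (1 - e ^+ 3) * (n / 2 - u ^+ 2 * ((r + 2) / (2 * r * (r + 1) ^+ 2))).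

Definition rescaled_dom : set (R * phase R) :=
  [set p | enorm3 (q1 p.2) (q2 p.2) (q3 p.2) != 0 /\
     enorm3 (1 + p.1 * q1 p.2) (p.1 * q2 p.2) (p.1 * q3 p.2) != 0].

Definition rescaled_field p : phase R :=
  symp_grad (fun k => 'd rescaled_ham p (0, phase_dir k)).

Lemma class_C_phase_coord k (A : set (R * phase R)) (j : 'I_6) :
  open A -> class_C k A (fun p => p.2 ord0 j).
Proof.
move=> oA.
have lin : linear (fun x : phase R => x ord0 j : R) by move=> a u v; rewrite !mxE.
pose l : {linear phase R -> R} :=
  HB.pack (fun x : phase R => x ord0 j : R) (GRing.isLinear.Build _ _ _ _ _ lin).
have lc : continuous l by exact: coord_continuous.
have := @class_C_comp_lin _ k _ _ _ A snd l oA lc; apply.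
by apply: class_C_snd => //; exact: class_C_id.
Qed.

Lemma class_C_param k (A : set (R * phase R)) : open A -> class_C k A (fun p => p.1).
Proof. by move=> oA; apply: class_C_fst => //; exact: class_C_id. Qed.

Let n1 p := q1 p.2 ^+ 2 + q2 p.2 ^+ 2 + q3 p.2 ^+ 2.
Let n2 p := (1 + p.1 * q1 p.2) ^+ 2 + (p.1 * q2 p.2) ^+ 2 + (p.1 * q3 p.2) ^+ 2.

Lemma class_C_norms k A : open A -> class_C k A n1 /\ class_C k A n2.
Proof.
move=> oA; have co j := class_C_phase_coord k j oA; have pa := class_C_param k oA.
have pq j := class_C_mul oA pa (co j).
split; do 2?[apply: class_C_add => //]; apply: class_C_exp => //;
  try exact: co; try exact: pq.
by apply: class_C_add => //; [exact: class_C_cst|exact: pq].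
Qed.

Lemma rescaled_dom_gt0 p : rescaled_dom p <-> 0 < n1 p /\ 0 < n2 p.
Proof.
split=> [[/enorm3_gt0 h1 /enorm3_gt0 h2]//|[h1 h2]].
by split; rewrite enorm3_eq0 gt_eqF.
Qed.

Lemma rescaled_dom_open : open rescaled_dom.
Proof.
have [c1 c2] := class_C_norms 0 openT.
have -> : rescaled_dom = n1 @^-1` [set x | 0 < x] `&` n2 @^-1` [set x | 0 < x].
  by apply/seteqP; split => p /rescaled_dom_gt0.
apply: openI.
  by apply: open_comp => [p _|]; [exact: c1|exact: open_gt].
by apply: open_comp => [p _|]; [exact: c2|exact: open_gt].
Qed.

Lemma rescaled_ham_smooth : smooth_on rescaled_dom rescaled_ham.
Proof.
move=> k; have oD := rescaled_dom_open.
have co j := class_C_phase_coord k j oD; have pa := class_C_param k oD.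
have [c1 c2] := class_C_norms k oD.
have s1 : class_C k rescaled_dom (fun p => enorm3 (q1 p.2) (q2 p.2) (q3 p.2)).
  by apply: class_C_sqrt => // p /rescaled_dom_gt0[].
have s2 : class_C k rescaled_dom
    (fun p => enorm3 (1 + p.1 * q1 p.2) (p.1 * q2 p.2) (p.1 * q3 p.2)).
  by apply: class_C_sqrt => // p /rescaled_dom_gt0[].
have cst (c : R) := @class_C_cst _ k _ _ rescaled_dom c.
have sq j := class_C_exp 2 oD (co j).
have pq i j := class_C_mul oD (co i) (co j).
have r0 p : rescaled_dom p -> 0 < enorm3 (1 + p.1 * q1 p.2) (p.1 * q2 p.2) (p.1 * q3 p.2).
  by move=> [_ h]; rewrite lt_neqAle eq_sym h sqrtr_ge0.
apply: class_C_add => //.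
  apply: class_C_add => //.
    apply: class_C_add => //.
      apply: class_C_add => //.
        apply: class_C_mul => //.
        by do 2?[apply: class_C_add => //]; exact: sq.
      exact: pq.
    by apply: class_C_opp => //; exact: pq.
  apply: class_C_opp => //; apply: class_C_mul => //.
  by apply: class_C_inv => // p [].
apply: class_C_mul => //.
  by apply: class_C_add => //; apply: class_C_opp => //; exact: class_C_exp.
apply: class_C_add => //; first exact: class_C_mul.
apply: class_C_opp => //; apply: class_C_mul => //.
  apply: class_C_exp => //; apply: class_C_add => //; apply: class_C_mul => //.
  exact: co.
apply: class_C_mul => //; first exact: class_C_add.
apply: class_C_inv => // [p /r0 rp|].
  by rewrite !mulf_neq0 ?expf_neq0 ?gt_eqF// addr_gt0.
apply: class_C_mul => //; first exact: class_C_mul.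
by apply: class_C_exp => //; exact: class_C_add.
Qed.

Lemma rescaled_field_smooth : smooth_on rescaled_dom rescaled_field.
Proof.
move=> k; have oD := rescaled_dom_open.
have -> : rescaled_field = (fun p =>
  'd rescaled_ham p (0, phase_dir 3) *: phase_dir 0 +
  'd rescaled_ham p (0, phase_dir 4) *: phase_dir 1 +
  'd rescaled_ham p (0, phase_dir 5) *: phase_dir 2 +
  (- 'd rescaled_ham p (0, phase_dir 0)) *: phase_dir 3 +
  (- 'd rescaled_ham p (0, phase_dir 1)) *: phase_dir 4 +
  (- 'd rescaled_ham p (0, phase_dir 2)) *: phase_dir 5).
  by apply/funext => p; rewrite [LHS]phase_expand /rescaled_field /symp_grad !mk_phase_coord.
have dk (w : R * phase R) := class_C_diff w (rescaled_ham_smooth k.+1).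
have cst (c : phase R) := @class_C_cst _ k _ _ rescaled_dom c.
do 5?[apply: class_C_add => //]; apply: class_C_scale => //; try exact: dk.
all: by apply: class_C_opp => //; exact: dk.
Qed.

Lemma is_diff_slice p : rescaled_dom p ->
  is_diff (p.2) (fun x => rescaled_ham (p.1, x)) (fun v => 'd rescaled_ham p (0, v)).
Proof.
move=> Dp; have idD : is_diff (p.2) (fun x : phase R => x) id by exact: is_diff_id.
have cD : is_diff (p.2) (fun _ : phase R => p.1) (fun=> 0) by exact: is_diff_cst.
have HD : is_diff (p.1, p.2) rescaled_ham ('d rescaled_ham p).
  by rewrite -surjective_pairing; exact: (class_C_is_diff (rescaled_ham_smooth 1)).
exact: (is_diff_comp (is_diff_pair cD idD) HD).
Qed.

Lemma rescaled_field_energy p : 'd rescaled_ham p (0, rescaled_field p) = 0.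
Proof.
have lin : linear (fun v : phase R => 'd rescaled_ham p (0, v) : R).
  move=> a u v; have -> : ((0 : R), a *: u + v) = a *: ((0 : R), u) + ((0 : R), v).
    by apply: injective_projections; rewrite //= scaler0 addr0.
  by rewrite linearP.
pose l : {linear phase R -> R} :=
  HB.pack (fun v : phase R => 'd rescaled_ham p (0, v) : R)
    (GRing.isLinear.Build _ _ _ _ _ lin).
exact: (linear_symp_grad l).
Qed.

Lemma rescaled_ham0 x : rescaled_ham (0, x) = hill_ham x.
Proof.
rewrite /rescaled_ham /hill_ham /= !mul0r !addr0.
have -> : enorm3 1 0 0 = 1 :> R by rewrite /enorm3 !expr0n !addr0 expr1n sqrtr1.
by move: (1 / enorm3 _ _ _) => s; field.
Qed.

Lemma hill_dom x : hdom (hill R) x <-> rescaled_dom (0, x).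
Proof.
rewrite /rescaled_dom /= !mul0r addr0; split => [h|[]//]; split => //.
by rewrite /enorm3 !expr0n !addr0 expr1n sqrtr1 oner_neq0.
Qed.

Lemma hill_diff x : hdom (hill R) x ->
  is_diff x (ham (hill R)) (fun v => 'd rescaled_ham (0, x) (0, v)).
Proof.
move=> /hill_dom Dx; have := is_diff_slice Dx => /=.
by under eq_fun do rewrite rescaled_ham0.
Qed.

Lemma hill_fieldE x : hdom (hill R) x -> ham_field (hill R) x = rescaled_field (0, x).
Proof.
move=> /hill_diff dx; rewrite ham_fieldE; last exact: is_diff_differentiable dx.
by rewrite (is_diffE dx).
Qed.

Lemma cr3bp_rescaled e x : 0 < e ->
  enorm3 (1 + e * q1 x) (e * q2 x) (e * q3 x) != 0 ->
  cr3bp_ham (e ^+ 3) (e *: x + m_shift (e ^+ 3)) =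
  e ^+ 2 * rescaled_ham (e, x) - (1 - e ^+ 3) - (1 - e ^+ 3) ^+ 2 / 2.
Proof.
move=> e0 r0; rewrite /cr3bp_ham /rescaled_ham /kinetic /= !coordD !coordZ /m_shift !mk_phase_coord.
rewrite !addr0 addrK.
have -> : enorm3 (e * q1 x) (e * q2 x) (e * q3 x) = e * enorm3 (q1 x) (q2 x) (q3 x).
  rewrite /enorm3 !exprMn -!mulrDr sqrtrM ?sqr_ge0// sqrtr_sqr gtr0_norm//.
have -> : e * q1 x + (1 - e ^+ 3) + e ^+ 3 = 1 + e * q1 x by ring.
set s := enorm3 (q1 x) (q2 x) (q3 x).
set r := enorm3 (1 + e * q1 x) (e * q2 x) (e * q3 x) in r0 *.
set n := q1 x ^+ 2 + q2 x ^+ 2 + q3 x ^+ 2.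
have r_ge0 : 0 <= r by exact: sqrtr_ge0.
have r1 : r + 1 != 0 by rewrite gt_eqF// ltr_wpDl.
have r2 : r ^+ 2 = 1 + e * (2 * q1 x + e * n).
  rewrite /r /enorm3 sqr_sqrtr; last by rewrite !addr_ge0// sqr_ge0.
  by rewrite /n; ring.
(* Since [e u = r^2 - 1 = (r - 1) (r + 1)], the factor [(r + 1)^2] cancels. What remains is
   [r^2 / 2 - 3 / 2 + 1 / r], which restores the attraction [1 / r] of the distant mass. *)
have key : e ^+ 2 * ((2 * q1 x + e * n) ^+ 2 * ((r + 2) / (2 * r * (r + 1) ^+ 2))) =
    (r - 1) ^+ 2 * (r + 2) / (2 * r).
  have -> : e ^+ 2 * ((2 * q1 x + e * n) ^+ 2 * ((r + 2) / (2 * r * (r + 1) ^+ 2))) =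
    (e * (2 * q1 x + e * n)) ^+ 2 * ((r + 2) / (2 * r * (r + 1) ^+ 2)) by ring.
  have -> : e * (2 * q1 x + e * n) = (r - 1) * (r + 1).
    by rewrite -[LHS](addKr 1) -r2; ring.
  by field; rewrite r0.
have se : e ^+ 3 / (e * s) = e ^+ 2 * (1 / s).
  by rewrite invfM mulrA exprSr mulfK ?gt_eqF// div1r.
have e2n : e ^+ 2 * (n / 2) = (r ^+ 2 - 1) / 2 - e * q1 x by rewrite r2; field.
rewrite se; move: (1 / s) key => s1; move: (_ * ((r + 2) / _)) => W key.
have split_e2 K : e ^+ 2 * (K + (1 - e ^+ 3) * (n / 2 - W)) =
    e ^+ 2 * K + (1 - e ^+ 3) * (e ^+ 2 * (n / 2) - e ^+ 2 * W) by ring.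
by rewrite split_e2 key e2n; field; rewrite r0.
Qed.

(** The values 1 and -1 of [a] give [r_y] and [r_yz], which are thus treated together. *)
Definition refl (a : R) x : phase R :=
  mk_phase (q1 x) (- q2 x) (a * q3 x) (- p1 x) (p2 x) (- (a * p3 x)).

Lemma r_yE x : r_y x = refl 1 x.
Proof. by rewrite /r_y /refl !mul1r. Qed.

Lemma r_yzE x : r_yz x = refl (- 1) x.
Proof. by rewrite /r_yz /refl !mulN1r opprK. Qed.

Lemma refl_linear a : linear (refl a).
Proof.
move=> b u v; apply: phase_eq; rewrite /refl !(coordD, coordZ, mk_phase_coord).
all: ring.
Qed.

HB.instance Definition _ a := GRing.isLinear.Build R (phase R) (phase R) _ (refl a) (refl_linear a).

Lemma refl_continuous a : continuous (refl a).
Proof. exact: linear_continuous_findim. Qed.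

Lemma rescaled_dom_refl a e x : a ^+ 2 = 1 -> rescaled_dom (e, x) -> rescaled_dom (e, refl a x).
Proof.
move=> a1; rewrite /rescaled_dom /= /enorm3 /refl !mk_phase_coord.
by rewrite !mulrN !sqrrN mulrCA !exprMn a1 !mul1r.
Qed.

Lemma rescaled_ham_refl a e x : a ^+ 2 = 1 -> rescaled_ham (e, refl a x) = rescaled_ham (e, x).
Proof.
move=> a1; rewrite /rescaled_ham /kinetic /= /enorm3 /refl !mk_phase_coord.
by rewrite !mulrN !mulNr !sqrrN ![e * (a * _)]mulrCA ![(a * _) ^+ 2]exprMn a1 !mul1r opprK.
Qed.

Lemma symp_grad_refl (f g : nat -> R) a : f 0%N = 1 * g 0%N -> f 1%N = -1 * g 1%N ->
  f 2%N = a * g 2%N -> f 3%N = -1 * g 3%N -> f 4%N = 1 * g 4%N -> f 5%N = - a * g 5%N ->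
  symp_grad f = - refl a (symp_grad g).
Proof.
move=> f0 f1 f2 f3 f4 f5; rewrite -scaleN1r.
by apply: phase_eq; rewrite coordZ /refl /symp_grad !mk_phase_coord ?f0 ?f1 ?f2 ?f3 ?f4 ?f5; ring.
Qed.

Lemma sign_swap (f g : phase R -> R) (r : phase R -> phase R) (s : R) v :
  (forall w, f (r w) = g w) -> (forall b w, f (b *: w) = b * f w) ->
  r v = s *: v -> s ^+ 2 = 1 -> f v = s * g v.
Proof. by move=> fg fZ rv s1; rewrite -fg rv fZ mulrA -expr2 s1 mul1r. Qed.

(** The reflection preserves the Hamiltonian and is antisymplectic, so it reverses the field. In
    coordinates, it multiplies each basis direction by a sign, which the partial derivative in that
    direction inherits, and conjugate directions carry opposite signs. *)
Lemma rescaled_field_refl a e x : a ^+ 2 = 1 -> rescaled_dom (e, x) ->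
  rescaled_field (e, refl a x) = - refl a (rescaled_field (e, x)).
Proof.
move=> a1 Dx; have Drx := rescaled_dom_refl a1 Dx.
have dH v : 'd rescaled_ham (e, refl a x) (0, refl a v) = 'd rescaled_ham (e, x) (0, v).
  have rD : is_diff x (refl a) (refl a).
    by apply: (@is_diff_linear _ _ _ (refl a)); exact: refl_continuous.
  have := is_diff_comp rD (is_diff_slice Drx) => /= h.
  have hE : (fun y => rescaled_ham (e, y)) \o refl a = (fun y => rescaled_ham (e, y)).
    by apply/funext => y /=; exact: rescaled_ham_refl.
  rewrite hE in h.
  have := is_diffE (is_diff_slice Dx); rewrite (is_diffE h) => /(congr1 (fun f => f v)).
  by [].
have dlin b v : 'd rescaled_ham (e, refl a x) (0, b *: v) =
    b * 'd rescaled_ham (e, refl a x) (0, v).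
  have -> : ((0 : R), b *: v) = b *: ((0 : R), v).
    by apply: injective_projections; rewrite //= scaler0.
  by rewrite linearZ.
have dd s k := @sign_swap (fun v => 'd rescaled_ham (e, refl a x) (0, v))
  (fun v => 'd rescaled_ham (e, x) (0, v)) (refl a) s (phase_dir k) dH dlin.
have r1 : (-1 : R) ^+ 2 = 1 by rewrite sqrrN expr1n.
have ra : (- a) ^+ 2 = 1 by rewrite sqrrN.
have rdir s k : (k < 6)%N ->
    (nth 0 [:: 1; -1; a; -1; 1; - a] k = s) -> refl a (phase_dir k) = s *: phase_dir k.
  move=> k6 <-; apply: phase_eq; rewrite /refl !coordZ !mk_phase_coord;
    rewrite /q1 /q2 /q3 /p1 /p2 /p3 !coord_dir//;
    move: k k6 => [|[|[|[|[|[|]]]]]] //= _; ring.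
apply: symp_grad_refl.
- exact: (dd 1 _ (rdir 1 0%N isT erefl) (expr1n _ _)).
- exact: (dd (-1) _ (rdir (-1) 1%N isT erefl) r1).
- exact: (dd a _ (rdir a 2%N isT erefl) a1).
- exact: (dd (-1) _ (rdir (-1) 3%N isT erefl) r1).
- exact: (dd 1 _ (rdir 1 4%N isT erefl) (expr1n _ _)).
- exact: (dd (- a) _ (rdir (- a) 5%N isT erefl) ra).
Qed.

Lemma of_rescaled_refl mu a x : of_rescaled mu (refl a x) = refl a (of_rescaled mu x).
Proof.
apply: phase_eq; rewrite /of_rescaled /refl /m_shift !(coordD, coordZ, mk_phase_coord).
all: ring.
Qed.

End RescaledHamiltonian.

(** * Hill's problem and the CR3BP as members of the rescaled family *)

Section Conjugacy.
Context {R : realType}.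
Implicit Types (x y v : phase R) (e mu t : R).

Lemma cuberoot_gt0 mu : 0 < mu -> 0 < mu `^ 3^-1.
Proof. exact: powR_gt0. Qed.

Lemma cuberoot3 mu : 0 < mu -> (mu `^ 3^-1) ^+ 3 = mu.
Proof.
move=> mu0; rewrite -powR_mulrn ?powR_ge0// -powRrM mulVf ?pnatr_eq0//.
by rewrite powRr1// ltW.
Qed.

Lemma cuberoot2 mu : 0 < mu -> mu `^ (2 / 3) = (mu `^ 3^-1) ^+ 2.
Proof. by move=> mu0; rewrite -powR_mulrn ?powR_ge0// -powRrM mulrC. Qed.

Lemma of_rescaledK mu : 0 < mu -> cancel (of_rescaled mu) (to_rescaled mu).
Proof.
move=> mu0 x; rewrite /to_rescaled /of_rescaled addrK scalerA mulVf ?scale1r//.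
by rewrite gt_eqF// cuberoot_gt0.
Qed.

Lemma to_rescaledK mu : 0 < mu -> cancel (to_rescaled mu) (of_rescaled mu).
Proof.
move=> mu0 x; rewrite /to_rescaled /of_rescaled scalerA mulfV ?scale1r ?subrK//.
by rewrite gt_eqF// cuberoot_gt0.
Qed.

Lemma of_rescaled_diff mu x : is_diff x (of_rescaled mu) (fun v => mu `^ 3^-1 *: v).
Proof.
have idD : is_diff x (fun y : phase R => y) id by exact: is_diff_id.
have cD : is_diff x (fun _ : phase R => m_shift mu) (fun=> 0) by exact: is_diff_cst.
have := is_diffD (is_diffZ (mu `^ 3^-1) idD) cD.
by move=> h; apply: is_diff_eq h _; apply/funext => v; rewrite /= addr0.
Qed.

Lemma to_rescaled_diff mu y : is_diff y (to_rescaled mu) (fun v => (mu `^ 3^-1)^-1 *: v).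
Proof.
have idD : is_diff y (fun y : phase R => y) id by exact: is_diff_id.
have cD : is_diff y (fun _ : phase R => m_shift mu) (fun=> 0) by exact: is_diff_cst.
have := is_diffZ (mu `^ 3^-1)^-1 (is_diffB idD cD).
by move=> h; apply: is_diff_eq h _; apply/funext => v; rewrite /= subr0.
Qed.

Lemma cr3bp_dom mu x : 0 < mu ->
  hdom (cr3bp mu) (of_rescaled mu x) <-> rescaled_dom (mu `^ 3^-1, x).
Proof.
move=> mu0; have e0 := cuberoot_gt0 mu0.
rewrite /= /rescaled_dom /= /of_rescaled /m_shift !(coordD, coordZ, mk_phase_coord).
rewrite !addr0 addrK.
have -> : mu `^ 3^-1 * q1 x + (1 - mu) + mu = 1 + mu `^ 3^-1 * q1 x by ring.
set e := mu `^ 3^-1.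
have -> : enorm3 (e * q1 x) (e * q2 x) (e * q3 x) = e * enorm3 (q1 x) (q2 x) (q3 x).
  by rewrite /enorm3 !exprMn -!mulrDr sqrtrM ?sqr_ge0// sqrtr_sqr gtr0_norm.
by rewrite mulf_eq0 (gt_eqF e0).
Qed.

Lemma cr3bp_energy mu x : 0 < mu -> rescaled_dom (mu `^ 3^-1, x) ->
  ham (cr3bp mu) (of_rescaled mu x) = jacobi_energy (rescaled_ham (mu `^ 3^-1, x)) mu.
Proof.
move=> mu0 [_ r0]; have := cr3bp_rescaled (cuberoot_gt0 mu0) r0.
by rewrite (cuberoot3 mu0) /jacobi_energy (cuberoot2 mu0).
Qed.

Lemma cr3bp_diff mu x : 0 < mu -> rescaled_dom (mu `^ 3^-1, x) ->
  is_diff (of_rescaled mu x) (ham (cr3bp mu))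
    (fun v => mu `^ 3^-1 * 'd rescaled_ham (mu `^ 3^-1, x) (0, v)).
Proof.
move=> mu0 Dx; set e := mu `^ 3^-1; have e0 := cuberoot_gt0 mu0.
pose C := - (1 - mu) - (1 - mu) ^+ 2 / 2.
have tD := to_rescaled_diff mu (of_rescaled mu x).
have sD : is_diff (to_rescaled mu (of_rescaled mu x)) (fun y => rescaled_ham (e, y))
    (fun v => 'd rescaled_ham (e, x) (0, v)).
  by rewrite of_rescaledK//; exact: (is_diff_slice Dx).
have HD := is_diffZ (e ^+ 2) (is_diff_comp tD sD).
have CD : is_diff (of_rescaled mu x) (fun _ : phase R => C) (fun=> 0) by exact: is_diff_cst.
apply: is_diff_near_eq; last first.
  apply: is_diff_eq (is_diffD HD CD) _; apply/funext => v /=.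
  rewrite -[LHS]/(e ^+ 2 * 'd rescaled_ham (e, x) (0, e^-1 *: v) + 0) addr0.
  have -> : ((0 : R), e^-1 *: v) = e^-1 *: ((0 : R), v).
    by apply: injective_projections; rewrite //= scaler0.
  rewrite linearZ -[X in _ * X]/(e^-1 * 'd rescaled_ham (e, x) (0, v)).
  by rewrite mulrA expr2 mulfK// gt_eqF.
have : \forall y \near of_rescaled mu x, rescaled_dom (e, to_rescaled mu y).
  have tc : {for of_rescaled mu x, continuous (fun y => (e, to_rescaled mu y))}.
    apply: differentiable_continuous; apply: differentiable_pair => //.
  apply: (tc rescaled_dom); rewrite of_rescaledK//.
  exact: open_near rescaled_dom_open Dx.
apply: filterS => y Dy; have := cr3bp_energy mu0 Dy.
by rewrite to_rescaledK// /jacobi_energy (cuberoot2 mu0) -addrA => ->.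
Qed.

(** Of the factor [e^2] of the Hamiltonian, differentiation through [to_rescaled] leaves one [e], by
    which [of_rescaled] also scales velocities: solutions correspond with the same time. *)
Lemma cr3bp_fieldE mu x : 0 < mu -> rescaled_dom (mu `^ 3^-1, x) ->
  ham_field (cr3bp mu) (of_rescaled mu x) = mu `^ 3^-1 *: rescaled_field (mu `^ 3^-1, x).
Proof.
move=> mu0 Dx; have HD := cr3bp_diff mu0 Dx.
rewrite ham_fieldE; last exact: is_diff_differentiable HD.
rewrite (is_diffE HD); exact: symp_gradZ.
Qed.

Definition rescaled_solves e (c : R -> phase R) t :=
  rescaled_dom (e, c t) /\ is_derive t (1 : R) c (rescaled_field (e, c t)).

Lemma hill_solves c t : solves_at (hill R) c t <-> rescaled_solves 0 c t.
Proof.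
split=> [[Dc cD]|[Dc cD]].
  by split; [exact/hill_dom|rewrite -hill_fieldE].
have Dh : hdom (hill R) (c t) by exact/hill_dom.
by split => //; rewrite hill_fieldE.
Qed.

Lemma cr3bp_solves mu c t : 0 < mu ->
  solves_at (cr3bp mu) (fun s => of_rescaled mu (c s)) t <->
  rescaled_solves (mu `^ 3^-1) c t.
Proof.
move=> mu0; have e0 := cuberoot_gt0 mu0; split=> [[Dc cD]|[Dc cD]].
  have Dr : rescaled_dom (mu `^ 3^-1, c t) by exact/(cr3bp_dom _ mu0).
  split => //; have := is_derive_comp_diff cD (to_rescaled_diff mu _).
  rewrite cr3bp_fieldE// scalerA mulVf ?gt_eqF// scale1r.
  by congr is_derive; apply/funext => s; rewrite /= of_rescaledK.
split; first exact/(cr3bp_dom _ mu0).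
by rewrite cr3bp_fieldE//; exact: is_derive_comp_diff cD (of_rescaled_diff mu _).
Qed.

Local Notation Phi := (flow_map (@rescaled_dom R) rescaled_field).
Local Notation Dom := (flow_dom (@rescaled_dom R) rescaled_field).

Let fR := @findim_real R.
Let fX := @findim_rV R 6.
Let oD := @rescaled_dom_open R.
Let sX := @rescaled_field_smooth R.

Lemma rescaled_dom_flow_open : open Dom.
Proof. exact: (flow_dom_open fR fX oD sX). Qed.

Lemma rescaled_flow_smooth : smooth_on Dom Phi.
Proof. exact: (flow_map_smooth fR fX oD sX). Qed.

Lemma rescaled_flow_intro e c t :
  (forall u, 0 <= u <= 1 -> rescaled_solves e c (t * u)) ->
  Dom (t, (e, c 0)) /\ Phi (t, (e, c 0)) = c t.
Proof. by move=> cS; apply: (flow_intro fR fX oD sX) => u /cS[]. Qed.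

Lemma rescaled_flow_solves e x t : Dom (t, (e, x)) ->
  rescaled_solves e (fun s => Phi (s, (e, x))) t.
Proof. exact: (flow_derive fR fX oD sX). Qed.

Lemma rescaled_flow_star e x t s : Dom (t, (e, x)) -> 0 <= s <= 1 -> Dom (t * s, (e, x)).
Proof. exact: (flow_dom_star fR). Qed.

Lemma rescaled_flow0 e x : rescaled_dom (e, x) -> Dom (0, (e, x)) /\ Phi (0, (e, x)) = x.
Proof. exact: (flow_zero fR fX oD sX). Qed.

Lemma rescaled_flow_start e x t : Dom (t, (e, x)) -> rescaled_dom (e, x) /\ Phi (0, (e, x)) = x.
Proof.
move=> D; have [y y0 yS] := D.
have i0 : 0 <= (0 : R) <= 1 by rewrite lexx ler01.
have A0 : rescaled_dom (e, x) by have [A0 _] := yS 0 i0; move: A0; rewrite y0.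
by split=> //; have [] := rescaled_flow0 A0.
Qed.

Lemma flow_unit e x t u : Dom (t, (e, x)) -> 0 <= u <= t -> Dom (u, (e, x)).
Proof.
move=> D /andP[u0 ut]; have [t0|t0] := eqVneq t 0.
  by have -> : u = t by apply/eqP; rewrite eq_le ut t0.
have -> : u = t * (u / t) by rewrite mulrC divfK.
have tp : 0 < t by rewrite lt_neqAle eq_sym t0 (le_trans u0).
by apply: rescaled_flow_star; rewrite // divr_ge0 ?(ltW tp)// ler_pdivrMr// mul1r.
Qed.

Lemma flows_to_hill x t y : 0 <= t -> flows_to (hill R) x t y ->
  Dom (t, (0, x)) /\ Phi (t, (0, x)) = y.
Proof.
move=> t0 [c [<- <- cS]]; apply: rescaled_flow_intro => u /andP[u0 u1].
by apply/hill_solves/cS; rewrite mulr_ge0//= ler_piMr.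
Qed.

Lemma flow_hill x t : 0 <= t -> Dom (t, (0, x)) -> flow (hill R) t x = Phi (t, (0, x)).
Proof.
move=> t0 D; rewrite /flow; apply: xget_unique.
  exists (fun s => Phi (s, (0, x))); split => //; first by have [] := rescaled_flow_start D.
  move=> u u01; apply/hill_solves; exact: rescaled_flow_solves (flow_unit D u01).
by move=> y /(flows_to_hill t0)[].
Qed.

Lemma flow_cr3bp mu x t : 0 < mu -> 0 <= t -> Dom (t, (mu `^ 3^-1, x)) ->
  flow (cr3bp mu) t (of_rescaled mu x) = of_rescaled mu (Phi (t, (mu `^ 3^-1, x))).
Proof.
move=> mu0 t0 D; rewrite /flow; apply: xget_unique.
  exists (fun s => of_rescaled mu (Phi (s, (mu `^ 3^-1, x)))); split => //.
    by have [_ ->] := rescaled_flow_start D.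
  by move=> u u01; apply/(cr3bp_solves _ _ mu0); exact: rescaled_flow_solves (flow_unit D u01).
move=> y [c [c0 <- cS]].
pose c' s := to_rescaled mu (c s).
have cE : c = (fun s => of_rescaled mu (c' s)) by apply/funext => s; rewrite /c' to_rescaledK.
have c'0 : c' 0 = x by rewrite /c' c0 of_rescaledK.
have [u /andP[u0 u1]|_] := @rescaled_flow_intro (mu `^ 3^-1) c' t.
  apply/(cr3bp_solves _ _ mu0); rewrite -cE; apply: cS.
  by rewrite mulr_ge0//= ler_piMr.
by rewrite c'0 => ->; rewrite /c' to_rescaledK.
Qed.

(** The monodromy matrix of Hill's problem at [e = 0] and, the conjugation by a homothety
    cancelling, of the CR3BP at [e > 0]. A single smooth flow yields both, whence continuity at
    [e = 0]. *)
Definition flow_jacobian (p : R * (R * phase R)) : 'M[R]_6 :=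
  \matrix_(i, j) ('d Phi p (0, (0, delta_mx ord0 i))) ord0 j.

Lemma flow_slice_diff t e x : Dom (t, (e, x)) ->
  is_diff x (fun y => Phi (t, (e, y))) (fun v => 'd Phi (t, (e, x)) (0, (0, v))).
Proof.
move=> D; have idD : is_diff x (fun x : phase R => x) id by exact: is_diff_id.
have eD : is_diff x (fun _ : phase R => e) (fun=> 0) by exact: is_diff_cst.
have tD : is_diff x (fun _ : phase R => t) (fun=> 0) by exact: is_diff_cst.
exact: (is_diff_comp (is_diff_pair tD (is_diff_pair eD idD))
  (class_C_is_diff (rescaled_flow_smooth 1) D)).
Qed.

Lemma flow_dom_near t e x : Dom (t, (e, x)) -> \forall y \near x, Dom (t, (e, y)).
Proof.
move=> D; have c : {for x, continuous (fun y => (t, (e, y)))}.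
  apply: differentiable_continuous; apply: differentiable_pair; first exact: differentiable_cst.
  apply: differentiable_pair => //; exact: differentiable_cst.
exact: (c Dom (open_near rescaled_dom_flow_open D)).
Qed.

Lemma monodromy_hill t x : 0 <= t -> Dom (t, (0, x)) ->
  'J (flow (hill R) t) x = flow_jacobian (t, (0, x)).
Proof.
move=> t0 D; apply/matrixP => i j; rewrite !mxE.
have -> // : 'd (flow (hill R) t) x = (fun v => 'd Phi (t, (0, x)) (0, (0, v))) :> (_ -> _).
apply: is_diffE; apply: is_diff_near_eq (flow_slice_diff D).
by apply: filterS (flow_dom_near D) => y Dy; rewrite flow_hill.
Qed.

Lemma monodromy_cr3bp mu t x : 0 < mu -> 0 <= t -> Dom (t, (mu `^ 3^-1, x)) ->
  'J (flow (cr3bp mu) t) (of_rescaled mu x) = flow_jacobian (t, (mu `^ 3^-1, x)).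
Proof.
move=> mu0 t0 D; apply/matrixP => i j; rewrite !mxE; have e0 := cuberoot_gt0 mu0.
have -> // : 'd (flow (cr3bp mu) t) (of_rescaled mu x) =
  (fun v => 'd Phi (t, (mu `^ 3^-1, x)) (0, (0, v))) :> (_ -> _).
have tD := to_rescaled_diff mu (of_rescaled mu x).
have FD : is_diff (to_rescaled mu (of_rescaled mu x)) (fun y => Phi (t, (mu `^ 3^-1, y)))
    (fun v => 'd Phi (t, (mu `^ 3^-1, x)) (0, (0, v))).
  by rewrite of_rescaledK//; exact: (flow_slice_diff D).
have := is_diff_comp (is_diff_comp tD FD) (of_rescaled_diff mu _) => h.
apply: is_diffE; apply: is_diff_near_eq; last first.
  apply: is_diff_eq h _; apply/funext => v /=.
  have -> : ((0 : R), ((0 : R), (mu `^ 3^-1)^-1 *: v)) = (mu `^ 3^-1)^-1 *: ((0 : R), ((0 : R), v)).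
    by do 2?apply: injective_projections; rewrite //= scaler0.
  by rewrite linearZ /= scalerA mulfV ?scale1r// gt_eqF.
have tc : {for of_rescaled mu x, continuous (to_rescaled mu)}.
  exact: (differentiable_continuous (is_diff_differentiable tD)).
have : \forall y \near of_rescaled mu x, Dom (t, (mu `^ 3^-1, to_rescaled mu y)).
  by apply: (tc [set z | Dom (t, (mu `^ 3^-1, z))]); rewrite of_rescaledK//; exact: flow_dom_near.
by apply: filterS => y Dy /=; rewrite -{2}(to_rescaledK mu0 y) flow_cr3bp.
Qed.

End Conjugacy.

(** * Periodic solutions and energy conservation *)

Section PeriodicFlow.
Context {R : realType}.
Implicit Types (x y v : phase R) (e t T : R).

Local Notation Phi := (flow_map (@rescaled_dom R) rescaled_field).
Local Notation Dom := (flow_dom (@rescaled_dom R) rescaled_field).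

Lemma linear_snd_scale (U V W : normedModType R) (f : {linear (U * V)%type -> W}) (a : R) (v : V) :
  f (0, a *: v) = a *: f (0, v).
Proof. by rewrite -linearZ; congr (f (_, _)); rewrite scaler0. Qed.

Lemma is_derive_addl (V : normedModType R) (c : R -> V) (a t : R) (d : V) :
  is_derive (a + t) (1 : R) c d -> is_derive t (1 : R) (fun u => c (a + u)) d.
Proof.
move=> cD; have aD : is_derive t (1 : R) (fun u : R => a + u) 1.
  apply: is_derive_eq (is_deriveD (is_derive_cst a t 1) (is_derive_id t (1 : R))) _.
  by rewrite add0r.
by have := is_derive_comp_real aD cD; rewrite scale1r.
Qed.

Lemma rescaled_flow_shift e x T u : Dom (T, (e, x)) ->
  (forall r, 0 <= r <= 1 -> Dom (T + u * r, (e, x))) ->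
  Dom (u, (e, Phi (T, (e, x)))) /\ Phi (u, (e, Phi (T, (e, x)))) = Phi (T + u, (e, x)).
Proof.
move=> D Du; have [v v01|] := @rescaled_flow_intro R e (fun s => Phi (T + s, (e, x))) u.
- have [Dv PD] := rescaled_flow_solves (Du v v01); split => //.
  exact: is_derive_addl PD.
- by move=> D0 <-; move: D0; rewrite addr0.
Qed.

Lemma flow_dom_near_time e x T : Dom (T, (e, x)) ->
  \forall u \near (0 : R), forall r, 0 <= r <= 1 -> Dom (T + u * r, (e, x)).
Proof.
move=> D; have c : {for T, continuous (fun t => (t, (e, x)))}.
  apply: differentiable_continuous; apply: differentiable_pair; first exact: ex_diff.
  exact: differentiable_cst.
have /nbhs_ballP[r /= r0 rD] := c Dom (open_near rescaled_dom_flow_open D).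
near=> u => v /andP[v0 v1]; apply: rD.
rewrite /ball /= opprD addrA subrr sub0r normrN normrM (ger0_norm v0).
apply: le_lt_trans (_ : `|u| < r); first by rewrite ler_piMr.
by near: u; apply: filterS (near_norm_lt (0 : R) r0) => u; rewrite sub0r normrN.
Unshelve. all: by end_near. Qed.

(** The flow over one period is repeated by reducing time modulo [T]; differentiability at the
    multiples of [T] is the point to check. *)
Lemma periodic_solution e x T : 0 < T -> Dom (T, (e, x)) -> Phi (T, (e, x)) = x ->
  exists c, [/\ c 0 = x, forall t, rescaled_solves e c t & forall t, c (t + T) = c t].
Proof.
move=> T0 D PT; pose n t : R := (Num.floor (t / T))%:~R.
have nP t : n t * T <= t < n t * T + T.
  have /andP[n1 n2] := floor_itv (t / T); rewrite -ler_pdivlMr// n1 /=.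
  by rewrite -{2}[T]mul1r -mulrDl -ltr_pdivrMr// -[1]/(1%:~R) -intrD.
have nE t (m : int) : m%:~R * T <= t < m%:~R * T + T -> n t = m%:~R.
  move=> /andP[m1 m2]; congr (_%:~R); apply: floor_def.
  by rewrite ler_pdivlMr// m1 /= ltr_pdivrMr// intrD mulrDl mul1r.
have Dr t : Dom (- (n t * T) + t, (e, x)).
  apply: (flow_unit D); have /andP[n1 n2] := nP t.
  by rewrite addrC subr_ge0 n1 /= lerBlDl ltW.
(* The flow extends slightly beyond both ends of the period, and the two extensions agree; this
   glues successive periods. *)
have back : \forall u \near (0 : R), Phi (T + u, (e, x)) = Phi (u, (e, x)).
  apply: filterS (flow_dom_near_time D) => u Du.
  by have [_] := rescaled_flow_shift D Du; rewrite PT.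
pose c t := Phi (- (n t * T) + t, (e, x)); exists c; split.
- have n0 : n 0 = 0 by apply: (nE 0 0); rewrite mul0r lexx add0r.
  rewrite /c n0 mul0r oppr0 addr0; by have [] := rescaled_flow_start D.
- move=> t; have [Dt Pt] := rescaled_flow_solves (Dr t); split => //.
  have := is_derive_addl Pt; apply: near_eq_is_derive.
  (* In the first case [t] is a multiple of [T] and the integer part drops by 1 just before it;
     otherwise it is constant nearby. *)
  have [/andP[n1 n2]] := nP t; rewrite le_eqVlt in n1; case/orP: n1 => [/eqP n1|n1].
    have near1 : \forall u \near t, t - T <= u < t + T.
      near=> u; have : `|t - u| < T by near: u; exact: (near_norm_lt t T0).
      by rewrite ltr_distlC => /andP[u1 u2]; rewrite ltW//= -ltrBlDr.
    have near2 : \forall u \near t, Phi (T + (u - t), (e, x)) = Phi (u - t, (e, x)).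
      have /nbhs_ballP[r /= r0 rB] := back; near=> u; apply: rB.
      by rewrite /ball /= sub0r opprB; near: u; exact: (near_norm_lt t r0).
    near=> u; rewrite n1 [_ + u]addrC.
    have /andP[u1 u2] : t - T <= u < t + T by near: u.
    have [tu|ut] := leP t u.
      by rewrite /c (nE u (Num.floor (t / T))) -/(n t) n1 ?tu//; congr (Phi (_, _)); rewrite addrC.
    rewrite /c (nE u (Num.floor (t / T) - 1)) intrD mulrDl -/(n t) n1 mulN1r ?u1 ?subrK//.
    by rewrite -(near near2 u)//; congr (Phi (_, _)); ring.
  have near1 : \forall u \near t, n t * T < u < n t * T + T.
    have r0 : 0 < Num.min (t - n t * T) (n t * T + T - t) by rewrite lt_min !subr_gt0 n1.
    near=> u; have : `|t - u| < Num.min (t - n t * T) (n t * T + T - t).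
      by near: u; exact: (near_norm_lt t r0).
    rewrite lt_min !ltr_distlC => /andP[/andP[u1 _] /andP[_ u2]].
    by apply/andP; split; lra.
  near=> u; have /andP[u1 u2] : n t * T < u < n t * T + T by near: u.
  by rewrite /c (nE u (Num.floor (t / T))) -/(n t) ?u2 ?ltW.
move=> t; have nT : n (t + T) = n t + 1.
  rewrite /n -[1]/(1%:~R) -intrD; apply: (nE); rewrite intrD mulrDl mul1r.
  by have /andP[n1 n2] := nP t; rewrite lerD2r n1 ltrD2r.
by rewrite /c nT; congr (Phi (_, _)); ring.
Unshelve. all: by end_near. Qed.

Lemma periodic_flow e x T : 0 < T -> Dom (T, (e, x)) -> Phi (T, (e, x)) = x ->
  forall t, Dom (t, (e, x)) /\ Phi (t + T, (e, x)) = Phi (t, (e, x)).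
Proof.
move=> T0 D PT; have [c [c0 cS cT]] := periodic_solution T0 D PT.
have cE t : Dom (t, (e, x)) /\ Phi (t, (e, x)) = c t.
  by rewrite -c0; apply: rescaled_flow_intro => u _; exact: cS.
by move=> t; split; [have [] := cE t|rewrite (cE _).2 (cE _).2].
Qed.

Lemma rescaled_flow_energy e x t : Dom (t, (e, x)) ->
  rescaled_ham (e, Phi (t, (e, x))) = rescaled_ham (e, x).
Proof.
move=> D; pose f u := rescaled_ham (e, Phi (t * u, (e, x))).
have fD (u : R) : 0 <= u <= 1 -> is_derive u (1 : R) f 0.
  move=> u01; have [Du Pu] := rescaled_flow_solves (rescaled_flow_star D u01).
  have tD : is_derive u (1 : R) (fun u : R => t * u) t.
    by apply: is_derive_eq (is_deriveZ _ (is_derive_id u (1 : R))) _; exact: mulr1.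
  have := is_derive_comp_diff (is_derive_comp_real tD Pu) (is_diff_slice Du).
  move=> h; apply: is_derive_eq h _.
  rewrite (linear_snd_scale ('d rescaled_ham (e, Phi (t * u, (e, x)))) t _).
  by rewrite (rescaled_field_energy (e, Phi (t * u, (e, x)))) scaler0.
have := @is_derive0_cst R _ findim_real f 1 fD 1; rewrite lexx ler01 => /(_ isT).
rewrite /f mulr1 mulr0 => ->; by have [_ ->] := rescaled_flow_start D.
Qed.

End PeriodicFlow.

(** * Curves in a common level set with prescribed velocity *)

Section TangentCurve.
Context {R : realType}.

Lemma is_derive_uniq (V : normedModType R) (c : R -> V) (t : R) (a b : V) :
  is_derive t (1 : R) c a -> is_derive t (1 : R) c b -> a = b.
Proof. by case=> _ <- [_ <-]. Qed.

Lemma near_locally_cst (V W : normedModType R) (f : V -> W) (df : V -> W) (c : R -> V) (d : V) :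
  is_diff (c 0) f df -> is_derive (0 : R) (1 : R) c d ->
  (\forall r \near (0 : R), f (c r) = f (c 0)) -> df d = 0.
Proof.
move=> fD cD fc; apply: is_derive_uniq (is_derive_comp_diff cD fD) _.
apply: near_eq_is_derive (is_derive_cst (f (c 0)) _ _).
by apply: filterS fc => r.
Qed.

(* The implicit function theorem corrects the line through [x] in the directions
   of [w1] and [w2]. *)
Lemma tangent_curve (V : normedModType R) (fV : findim V) (A : set V) (f g : V -> R)
    (x v w1 w2 : V) :
  open A -> smooth_on A f -> smooth_on A g -> A x ->
  'd f x w1 != 0 -> 'd f x w2 = 0 -> 'd g x w2 != 0 -> 'd f x v = 0 -> 'd g x v = 0 ->
  exists y : R -> V, [/\ y 0 = x, is_derive (0 : R) (1 : R) y v &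
    \forall r \near (0 : R), [/\ A (y r), f (y r) = f x & g (y r) = g x]].
Proof.
move=> oA fA gA Ax f1 f2 g2 fv gv.
pose L (p : R * (R * R)) : V := x + (p.1 *: v + (p.2.1 *: w1 + p.2.2 *: w2)).
pose dL (p : R * (R * R)) : V := p.1 *: v + (p.2.1 *: w1 + p.2.2 *: w2).
have oT : open [set: R * (R * R)] by exact: openT.
have fP : findim ((R * (R * R))%type : normedModType R).
  exact: findim_prod findim_real (findim_prod findim_real findim_real).
have Lk k : class_C k setT L.
  have k1 : class_C k setT (fun p : R * (R * R) => p.1).
    by apply: class_C_fst => //; exact: class_C_id.
  have k2 : class_C k setT (fun p : R * (R * R) => p.2).
    by apply: class_C_snd => //; exact: class_C_id.
  apply: class_C_add => //; first exact: class_C_cst.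
  apply: class_C_add => //; first by apply: class_C_scale => //; exact: class_C_cst.
  apply: class_C_add => //; apply: class_C_scale => //; try exact: class_C_cst.
    exact: class_C_fst.
  exact: class_C_snd.
have lin : linear dL.
  move=> a [p1 [p2 p3]] [q1 [q2 q3]]; rewrite /dL /=.
  by rewrite -![_ *: _ : R]/(_ * _); lincomb R.
pose l : {linear (R * (R * R))%type -> V} := HB.pack dL (GRing.isLinear.Build _ _ _ _ _ lin).
have lD p : is_diff p L dL.
  have lc : continuous l by exact: (linear_continuous_findim fP).
  have lD : is_diff p dL dL := is_diff_linear p lc.
  apply: is_diff_eq (is_diffD (is_diff_cst x p) lD) _.
  by apply/funext => q /=; rewrite add0r.
pose A' := [set p | A (L p)].
have oA' : open A'.
  rewrite openE => p Ap; rewrite /interior.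
  exact: (class_C_continuous (Lk 0%N) (I : setT p) (open_near oA Ap)).
have A'T : A' `<=` setT by [].
pose G p : R * R := (f (L p) - f x, g (L p) - g x).
have fLk k : class_C k A' (fun p => f (L p)).
  exact: (class_C_comp fV oA' (fun p Ap => Ap) (class_C_sub A'T (Lk k)) (fA k)).
have gLk k : class_C k A' (fun p => g (L p)).
  exact: (class_C_comp fV oA' (fun p Ap => Ap) (class_C_sub A'T (Lk k)) (gA k)).
have GA : smooth_on A' G.
  move=> k; apply: class_C_pair => //; apply: class_C_add => //; exact: class_C_cst.
have L0 : L (0, 0) = x by rewrite /L /= !scale0r !addr0.
have Ax0 : A (L (0, 0)) by rewrite L0.
have G0 : G (0, 0) = 0 by rewrite /G L0 !subrr.
have fD : is_diff (L (0, 0)) f ('d f x) by rewrite L0; exact: class_C_is_diff (fA 1%N) Ax.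
have gD : is_diff (L (0, 0)) g ('d g x) by rewrite L0; exact: class_C_is_diff (gA 1%N) Ax.
have GD : is_diff (0, 0) G (fun q => ('d f x (dL q), 'd g x (dL q))).
  have h1 := is_diffB (is_diff_comp (lD _) fD) (is_diff_cst (f x) (0, 0)).
  have h2 := is_diffB (is_diff_comp (lD _) gD) (is_diff_cst (g x) (0, 0)).
  apply: is_diff_eq (is_diff_pair h1 h2) _.
  by apply/funext => q /=; congr (_, _); exact: subr0.
have lf (a b c : R) : 'd f x (dL (a, (b, c))) = b * 'd f x w1.
  by rewrite /dL /= !linearD !linearZ /= fv f2 !scaler0 add0r addr0.
have lg (a b c : R) : 'd g x (dL (a, (b, c))) = b * 'd g x w1 + c * 'd g x w2.
  by rewrite /dL /= !linearD !linearZ /= gv !scaler0 add0r.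
have Ginj w : 'd G (0, 0) (0, w) = 0 -> w = 0.
  case: w => a b; rewrite (is_diffE GD) => /pair_equal_spec[].
  rewrite lf lg => /eqP; rewrite mulf_eq0 (negPf f1) orbF => /eqP ->.
  rewrite mul0r add0r => /eqP; rewrite mulf_eq0 (negPf g2) orbF => /eqP ->.
  by [].
have [e0 [z [e00 zk z0 zG _]]] := implicit_function
  (findim_prod findim_real findim_real) oA' GA Ax0 G0 Ginj.
pose y r := L (r, z r); exists y.
have y0 : y 0 = x by rewrite /y z0 L0.
have nearA : \forall r \near (0 : R), [/\ A (y r), f (y r) = f x & g (y r) = g x].
  apply: filterS (near_norm_lt (0 : R) e00) => r; rewrite sub0r normrN => /zG[Ar].
  by move=> /pair_equal_spec[/subr0_eq ? /subr0_eq ?].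
have zD : is_derive (0 : R) (1 : R) z ('d z 0 1).
  have z1 : [set e : R | `|e| < e0] 0 by rewrite /= normr0.
  exact: (is_diff_derive (1 : R) (class_C_is_diff (zk 1%N) z1)).
case: ('d z 0 1) zD => a b zD.
have yD : is_derive (0 : R) (1 : R) y (dL (1, (a, b))).
  exact: (is_derive_comp_diff (is_derive_pair (is_derive_id _ _) zD) (lD (0, z 0))).
(* As [f] and [g] are constant along [y], the corrections have no velocity at 0, so that [y] leaves
   [x] with velocity [v]. *)
have a0 : a = 0.
  have fy : is_diff (y 0) f ('d f x) by rewrite y0; exact: class_C_is_diff (fA 1%N) Ax.
  have := near_locally_cst fy yD _; rewrite lf => h; apply/eqP.
  have := h _; rewrite y0 => /(_ _)/eqP; rewrite mulf_eq0 (negPf f1) orbF; apply.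
  by apply: filterS nearA => r [].
have b0 : b = 0.
  have gy : is_diff (y 0) g ('d g x) by rewrite y0; exact: class_C_is_diff (gA 1%N) Ax.
  have := near_locally_cst gy yD _; rewrite lg a0 mul0r add0r => h; apply/eqP.
  have := h _; rewrite y0 => /(_ _)/eqP; rewrite mulf_eq0 (negPf g2) orbF; apply.
  by apply: filterS nearA => r [].
split=> //; rewrite (_ : v = dL (1, (a, b)))//.
by rewrite /dL a0 b0 /= scale1r !scale0r !addr0.
Qed.

End TangentCurve.

(** * Non-degeneracy of Hill's orbit in terms of its monodromy *)

Section HillOrbit.
Context {R : realType} (gamma0 : R -> phase R) (T0 : R).
Hypothesis per : periodic_orbit (hill R) gamma0 T0.

Local Notation Phi := (flow_map (@rescaled_dom R) rescaled_field).
Local Notation Dom := (flow_dom (@rescaled_dom R) rescaled_field).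
Local Notation x0 := (gamma0 0).
Local Notation field0 := (rescaled_field (0, x0)).
Local Notation dH v := ('d rescaled_ham (0, x0) (0, v)).
Local Notation mono v := ('d Phi (T0, (0, x0)) (0, (0, v))).

Lemma rescaled_field_neq0 (p : R * phase R) : rescaled_field p != 0 ->
  exists w, 'd rescaled_ham p (0, w) != 0.
Proof.
move=> p0; apply: contrapT => /forallNP wH; case/eqP: p0.
rewrite /rescaled_field -[RHS](scale0r (symp_grad (fun=> 0))) -symp_gradZ.
congr symp_grad; apply/funext => k; rewrite mul0r.
by apply: contrapT => /eqP; exact: wH.
Qed.

Lemma linear_sndB (E V W : normedModType R) (f : {linear (E * V)%type -> W}) (b : R) (v w : V) :
  f (0, v - b *: w) = f (0, v) - b *: f (0, w).
Proof.
rewrite -linearZ -linearB; congr (f _).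
by apply: injective_projections; rewrite //= scaler0 subrr.
Qed.

Lemma orbit_dom t : rescaled_dom (0, gamma0 t).
Proof. by have [_ /(_ t)/hill_solves[]] := per. Qed.

Lemma orbit_flow u t : Dom (t, (0, gamma0 u)) /\ Phi (t, (0, gamma0 u)) = gamma0 (u + t).
Proof.
have [_ gS _] := per.
have [r _|] := @rescaled_flow_intro R 0 (fun s => gamma0 (u + s)) t.
  have /hill_solves[D gD] := gS (u + t * r); split => //; exact: is_derive_addl.
by rewrite addr0.
Qed.

Lemma orbit_flow0 t : Dom (t, (0, x0)) /\ Phi (t, (0, x0)) = gamma0 t.
Proof. by have := orbit_flow 0 t; rewrite add0r. Qed.

Lemma orbit_period t : gamma0 (t + T0) = gamma0 t.
Proof. by have [_ _] := per. Qed.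

Lemma flow_diff_split t e x (a : R) v : Dom (t, (e, x)) ->
  'd Phi (t, (e, x)) (a, (0, v)) =
  a *: rescaled_field (e, Phi (t, (e, x))) + 'd Phi (t, (e, x)) (0, (0, v)).
Proof.
move=> D; have PD : is_diff (t, (e, x)) Phi ('d Phi (t, (e, x))).
  exact: (class_C_is_diff (rescaled_flow_smooth 1) D).
have [_ tD] := rescaled_flow_solves D.
have cD : is_derive t (1 : R) (fun s : R => (s, (e, x))) (1, 0).
  exact: (is_derive_pair (is_derive_id t (1 : R)) (is_derive_cst _ _ _)).
have E := is_derive_uniq (is_derive_comp_diff cD PD) tD.
rewrite -E -linearZ -linearD; congr ('d Phi _ _).
by apply: injective_projections; rewrite /= ?scaler0 ?add0r// addr0 -[LHS]mulr1.
Qed.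

(** Obtained by differentiating in [u] the periodicity of the flow along [gamma0 u]. *)
Lemma monodromy_field : mono field0 = field0.
Proof.
have [D0 P0] := orbit_flow0 T0; have [_ gS _] := per.
have /hill_solves[_ gD] := gS 0; have FD := flow_slice_diff D0.
have := is_derive_comp_diff gD FD => h.
apply: (is_derive_uniq h); apply: near_eq_is_derive gD.
by near=> u; rewrite /= (orbit_flow u T0).2 orbit_period.
Unshelve. all: by end_near. Qed.

Lemma monodromy_energy v : dH (mono v) = dH v.
Proof.
have [D0 P0] := orbit_flow0 T0; have FD := flow_slice_diff D0.
have P0' : Phi (T0, (0, x0)) = x0 by rewrite P0 -[T0]add0r orbit_period.
have HD : is_diff (Phi (T0, (0, x0))) (fun x => rescaled_ham (0, x))
    (fun v => 'd rescaled_ham (0, x0) (0, v)).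
  by rewrite P0'; exact: (is_diff_slice (orbit_dom 0)).
have E1 := is_diffE (is_diff_comp FD HD).
have E2 := is_diffE (is_diff_near_eq _ (is_diff_slice (orbit_dom 0))).
have E3 : (fun v => dH (mono v)) = (fun v => dH v).
  rewrite -[LHS]E1; apply: E2.
  by apply: filterS (flow_dom_near D0) => y Dy /=; rewrite rescaled_flow_energy.
exact: (congr1 (fun f => f v) E3).
Qed.

(** Off the section, [psi] and [tau] are arbitrary smooth extensions, so that
    [psi y = Phi (tau y, (0, y))] can only be differentiated along a curve in the section.
    [tangent_curve] provides one with velocity [v], correcting the energy with some [w] and the
    section equation with the field, which is tangent to the energy level. *)
Lemma return_map_diff (U : set (phase R)) s W tau psi v :
  open U -> smooth_on U s ->
  level_section (hill R) (ham (hill R) x0) U s x0 ->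
  return_map (hill R) (ham (hill R) x0) U s W tau psi x0 T0 ->
  'd s x0 field0 != 0 -> dH v = 0 -> 'd s x0 v = 0 ->
  exists a : R, 'd psi x0 v = a *: field0 + mono v.
Proof.
move=> oU sU [Ux0 _ sx0] [[oW Wx0] tW pW [tx0 px0] ret] s1 Hv sv.
pose A := U `&` [set x | rescaled_dom (0, x)].
have cH : continuous (fun x : phase R => ((0 : R), x)).
  move=> x; apply: differentiable_continuous; apply: differentiable_pair => //.
have oA : open A.
  apply: openI => //; rewrite openE => x Dx; rewrite /interior.
  exact: (cH x rescaled_dom (open_near rescaled_dom_open Dx)).
pose H0 (x : phase R) := rescaled_ham (0, x).
have Hk : smooth_on A H0.
  move=> k; have i1 x : A x -> rescaled_dom (0, x) by case.
  have i2 : class_C k A (fun x => ((0 : R), x)).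
    by apply: class_C_pair => //; [exact: class_C_cst|exact: class_C_id].
  exact: (class_C_comp (findim_prod findim_real (findim_rV 6)) oA i1 i2 (rescaled_ham_smooth k)).
have sA : smooth_on A s by move=> k; apply: class_C_sub (sU k) => x [].
have HD : 'd H0 x0 = (fun v => dH v) :> (_ -> _) := is_diffE (is_diff_slice (orbit_dom 0)).
have [w w0] : exists w, dH w != 0.
  by apply: rescaled_field_neq0; apply: contraNneq s1 => ->; rewrite linear0.
have Ax0 : A x0 by split => //; exact: orbit_dom.
have h1 : 'd H0 x0 w != 0 by rewrite HD.
have h2 : 'd H0 x0 field0 = 0 by rewrite HD; exact: (rescaled_field_energy (0, x0)).
have h3 : 'd H0 x0 v = 0 by rewrite HD.
have [y [y0 yD yA]] := tangent_curve (findim_rV 6) oA Hk sA Ax0 h1 h2 s1 h3 sv.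
exists ('d tau x0 v).
have [D0 P0] := orbit_flow0 T0.
have P0' : Phi (T0, (0, x0)) = x0 by rewrite P0 -[T0]add0r orbit_period.
have E := flow_diff_split ('d tau x0 v) v D0; rewrite P0' in E.
apply: (etrans _ E).
have yc : {for 0, continuous y} := is_derive_continuous yD.
have nearE : \forall r \near (0 : R), Phi (tau (y r), (0, y r)) = psi (y r).
  have Wy : \forall r \near (0 : R), W (y r) by apply: yc; rewrite y0; exact: (open_near oW Wx0).
  apply: filterS2 Wy yA => r Wr [[Ur Dr] Hr sr].
  have lr : level_section (hill R) (ham (hill R) x0) U s (y r).
    by split; [|move: Hr; rewrite /H0 !rescaled_ham0|rewrite sr].
  by have [t0 /(flows_to_hill (ltW t0))[]] := ret _ Wr lr.
have pD : is_diff (y 0) psi ('d psi x0) by rewrite y0; exact: class_C_is_diff (pW 1%N) Wx0.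
have tD : is_diff (y 0) tau ('d tau x0) by rewrite y0; exact: class_C_is_diff (tW 1%N) Wx0.
have PD : is_diff (tau (y 0), (0, y 0)) Phi ('d Phi (T0, (0, x0))).
  by rewrite y0 tx0; exact: (class_C_is_diff (rescaled_flow_smooth 1) D0).
apply: (is_derive_uniq (is_derive_comp_diff yD pD)).
apply: near_eq_is_derive nearE _.
exact: (is_derive_comp_diff (is_derive_pair (is_derive_comp_diff yD tD)
  (is_derive_pair (is_derive_cst (0 : R) _ _) yD)) PD).
Qed.

(** A form of non-degeneracy without section: modulo the field, the monodromy has no fixed vector
    tangent to the energy level. It applies to the section of the continuation problem, whichever
    section witnesses the hypothesis. *)
Lemma nondegenerate_kernel : nondegenerate_orbit (hill R) gamma0 T0 ->
  (exists w, dH w != 0) /\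
  forall v (a : R), dH v = 0 -> v = a *: field0 + mono v -> exists b : R, v = b *: field0.
Proof.
move=> [U [s [W [tau [psi [B [M [[[oU Ud sU tr] lev] ret [rB tB] BJ d0]]]]]]]].
have Dh : hdom (hill R) x0 by exact/hill_dom/orbit_dom.
have s1 : 'd s x0 field0 != 0 by rewrite -hill_fieldE//; exact: tr.
have tP v : (v <= B)%MS <-> dH v = 0 /\ 'd s x0 v = 0.
  by have := tB v; rewrite (is_diffE (hill_diff Dh)).
split; first by apply: rescaled_field_neq0; apply: contraNneq s1 => ->; rewrite linear0.
(* Subtracting this multiple of the field makes the vector tangent to the section. *)
move=> v a Hv vE; pose b := 'd s x0 v / 'd s x0 field0; exists b.
pose u := v - b *: field0.
have Hu : dH u = 0.
  apply: (etrans (linear_sndB ('d rescaled_ham (0, x0)) b v field0)).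
  by rewrite Hv (rescaled_field_energy (0, x0)) scaler0 subrr.
have su : 'd s x0 u = 0.
  by rewrite linearB linearZ /= /b -[_ *: _]/(_ * _) divfK// subrr.
have [c psiu] := return_map_diff oU sU lev ret s1 Hu su.
have uB : (u <= B)%MS by apply/tP.
have [z uz] : exists z, u = z *m B by exact/submxP.
have psiuE : 'd psi x0 u = z *m M *m B by rewrite uz -mulmxA -BJ mulmxA mul_rV_lin1.
have [_ s2] : dH ('d psi x0 u) = 0 /\ 'd s x0 ('d psi x0 u) = 0.
  by apply/tP; rewrite psiuE submxMl.
have uE : mono u = u - a *: field0.
  have -> : mono u = mono v - b *: mono field0.
    have := linear_sndB ('d Phi (T0, (0, x0))) b (0, v) (0, field0).
    by apply: etrans; congr ('d Phi _ (_, (_, _))); rewrite /= scaler0 subrr.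
  by rewrite monodromy_field /u {2}vE; lincomb R.
have psiu2 : 'd psi x0 u = u + (c - a) *: field0.
  by rewrite psiu uE; lincomb R.
(* The return map preserves the tangent space of the section, to which the field is transverse;
   hence [u] is fixed by the differential of [psi]. *)
have ca : c - a = 0.
  apply/eqP; move: s2; rewrite psiu2 linearD su add0r linearZ /= -[_ *: _]/(_ * _).
  by move=> /eqP; rewrite mulf_eq0 (negPf s1) orbF.
have zM : z *m (M - 1%:M) = 0.
  have : z *m M *m B = z *m B by rewrite -psiuE psiu2 ca scale0r addr0 uz.
  by move=> /(row_free_inj rB) zz; rewrite mulmxBr zz mulmx1 subrr.
have z0 : z = 0.
  have Mu : M - 1%:M \in unitmx by rewrite unitmxE unitfE.
  by rewrite -[z](mulmxK Mu) zM mul0mx.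
by move: uz; rewrite z0 mul0mx => /subr0_eq.
Qed.

End HillOrbit.

(** * Continuation of the closed orbit in the rescaled parameter *)

Section Continuation.
Context {R : realType}.

(** Partial differentials are packaged as linear maps so that the generic linearity lemmas apply to
    them. *)
Definition partial_snd (E V W : normedModType R) (f : {linear (E * V)%type -> W}) (v : V) : W :=
  f (0, v).

Lemma partial_snd_linear (E V W : normedModType R) (f : {linear (E * V)%type -> W}) :
  linear (partial_snd f).
Proof.
move=> a u v; rewrite /partial_snd -linearP; congr (f _).
by apply: injective_projections; rewrite //= scaler0 addr0.
Qed.

HB.instance Definition _ (E V W : normedModType R) (f : {linear (E * V)%type -> W}) :=
  GRing.isLinear.Build R V W _ (partial_snd f) (partial_snd_linear f).

Lemma is_diff_fst (V W W' : normedModType R) (f df : V -> W * W') (x : V) :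
  is_diff x f df -> is_diff x (fun y => (f y).1) (fun v => (df v).1).
Proof.
move=> fD; have c : continuous (fst : W * W' -> W) by move=> y; exact: cvg_fst.
exact: (is_diff_comp fD (is_diff_linear (l := fst) (f x) c)).
Qed.

Lemma is_diff_snd (V W W' : normedModType R) (f df : V -> W * W') (x : V) :
  is_diff x f df -> is_diff x (fun y => (f y).2) (fun v => (df v).2).
Proof.
move=> fD; have c : continuous (snd : W * W' -> W') by move=> y; exact: cvg_snd.
exact: (is_diff_comp fD (is_diff_linear (l := snd) (f x) c)).
Qed.

Lemma class_C_near_open k (V W : normedModType R) (A : set V) (B : set W) (f : V -> W) (x : V) :
  class_C k A f -> A x -> open B -> B (f x) -> \forall y \near x, B (f y).
Proof. by move=> fA Ax oB Bfx; exact: (class_C_continuous fA Ax (open_near oB Bfx)). Qed.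

Context (gamma0 : R -> phase R) (T0 h : R) (U : set (phase R)) (s : phase R -> R).
Hypotheses (per : periodic_orbit (hill R) gamma0 T0)
  (energy : forall t, ham (hill R) (gamma0 t) = h)
  (nondeg : nondegenerate_orbit (hill R) gamma0 T0)
  (section0 : surface_of_section (hill R) h U s)
  (x0_section : level_section (hill R) h U s (gamma0 0)).

Local Notation Phi := (flow_map (@rescaled_dom R) rescaled_field).
Local Notation Dom := (flow_dom (@rescaled_dom R) rescaled_field).
Local Notation x0 := (gamma0 0).
Local Notation field0 := (rescaled_field (0, x0)).

Definition closed_orbit e x T : Prop :=
  [/\ U x, Dom (T, (e, x)), Phi (T, (e, x)) = x, s x = 0 & rescaled_ham (e, x) = h].

Lemma section_open : open U. Proof. by case: section0. Qed.

Lemma section_smooth : smooth_on U s. Proof. by case: section0. Qed.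

Lemma section_x0 : U x0. Proof. by case: x0_section. Qed.

Lemma section_transverse : 'd s x0 field0 != 0.
Proof.
have [_ _ _ /(_ _ x0_section)] := section0; rewrite hill_fieldE//.
exact/hill_dom/(orbit_dom per).
Qed.

Lemma rescaled_energy0 t : rescaled_ham (0, gamma0 t) = h.
Proof. by rewrite rescaled_ham0; exact: energy. Qed.

Lemma flow_x0 : Phi (T0, (0, x0)) = x0.
Proof. by rewrite (orbit_flow0 per T0).2 -[T0]add0r (orbit_period per). Qed.

Lemma closed_orbit0 : closed_orbit 0 x0 T0.
Proof.
split; [exact: section_x0|exact: (orbit_flow0 per T0).1|exact: flow_x0| |exact: rescaled_energy0].
by case: x0_section.
Qed.

(* Energy conservation makes the equations [Phi (T, (e, x)) = x], [s x = 0],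
   [rescaled_ham (e, x) = h] dependent; adding [w] times an unknown real number to
   the first one makes the system square, and that number is 0 for all solutions. *)
Definition closing (w : phase R) (p : R * (phase R * R * R)) : phase R * R * R :=
  ((Phi (p.2.1.2, (p.1, p.2.1.1)) - p.2.1.1 + p.2.2 *: w, s p.2.1.1),
   rescaled_ham (p.1, p.2.1.1) - h).

Definition closing_dom : set (R * (phase R * R * R)) :=
  [set p | Dom (p.2.1.2, (p.1, p.2.1.1)) /\ U p.2.1.1].

Lemma class_C_closing_proj k (A : set (R * (phase R * R * R))) : open A ->
  [/\ class_C k A (fun p => p.1), class_C k A (fun p => p.2.1.1),
      class_C k A (fun p => p.2.1.2) & class_C k A (fun p => p.2.2)].
Proof.
move=> oA; have c2 : class_C k A (fun p => p.2) by apply: class_C_snd => //; exact: class_C_id.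
split; first by apply: class_C_fst => //; exact: class_C_id.
- by do 2!apply: class_C_fst => //.
- by apply: class_C_snd => //; apply: class_C_fst.
- exact: class_C_snd.
Qed.

Lemma closing_dom_open : open closing_dom.
Proof.
rewrite openE => p [Dp Up]; rewrite /interior.
have oT : open [set: R * (phase R * R * R)] := openT.
have [c1 c2 c3 c4] := class_C_closing_proj 0 oT.
have c5 := class_C_pair oT c3 (class_C_pair oT c1 c2).
have nD : \forall q \near p, Dom (q.2.1.2, (q.1, q.2.1.1)) :=
  class_C_continuous c5 (I : setT p) (open_near rescaled_dom_flow_open Dp).
have nU : \forall q \near p, U q.2.1.1 :=
  class_C_continuous c2 (I : setT p) (open_near section_open Up).
by apply: filterS2 nD nU => q Dq Uq; split.
Qed.

Lemma closing_smooth w : smooth_on closing_dom (closing w).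
Proof.
move=> k; have oA := closing_dom_open; have [c1 c2 c3 c4] := class_C_closing_proj k oA.
have i1 p : closing_dom p -> Dom (p.2.1.2, (p.1, p.2.1.1)) by case.
have i2 p : closing_dom p -> U p.2.1.1 by case.
have i3 p : closing_dom p -> rescaled_dom (p.1, p.2.1.1) by case=> /rescaled_flow_start[].
have fP : findim ((R * phase R)%type : normedModType R) := findim_prod findim_real (findim_rV 6).
have c12 := class_C_pair oA c1 c2; have c312 := class_C_pair oA c3 c12.
apply: class_C_pair => //; first apply: class_C_pair => //.
- apply: class_C_add => //; last by apply: class_C_scale => //; exact: class_C_cst.
  apply: class_C_add => //; last exact: class_C_opp.
  exact: (class_C_comp (findim_prod findim_real fP) oA i1 c312 (rescaled_flow_smooth k)).
- exact: (class_C_comp (findim_rV 6) oA i2 c2 (section_smooth k)).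
apply: class_C_add => //; last exact: class_C_cst.
exact: (class_C_comp fP oA i3 c12 (rescaled_ham_smooth k)).
Qed.

Lemma closing_diff w : is_diff (0, (x0, T0, 0)) (closing w) (fun q =>
  (('d Phi (T0, (0, x0)) (q.2.1.2, (q.1, q.2.1.1)) - q.2.1.1 + q.2.2 *: w,
    'd s x0 q.2.1.1), 'd rescaled_ham (0, x0) (q.1, q.2.1.1))).
Proof.
pose p0 : R * (phase R * R * R) := (0, (x0, T0, 0)).
have dI : is_diff p0 (fun p : R * (phase R * R * R) => p) id by exact: is_diff_id.
have d1 := is_diff_fst dI; have d2 := is_diff_snd dI.
have dx := is_diff_fst (is_diff_fst d2); have dT := is_diff_snd (is_diff_fst d2).
have dl := is_diff_snd d2; have dp := is_diff_pair d1 dx.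
have [_ D0 P0 s0 H0] := closed_orbit0.
have PD : is_diff (T0, (0, x0)) Phi ('d Phi (T0, (0, x0))).
  exact: (class_C_is_diff (rescaled_flow_smooth 1) D0).
have HD : is_diff (0, x0) rescaled_ham ('d rescaled_ham (0, x0)).
  exact: (class_C_is_diff (rescaled_ham_smooth 1) (orbit_dom per 0)).
have sD : is_diff x0 s ('d s x0) := class_C_is_diff (section_smooth 1) section_x0.
have fD := is_diffB (is_diff_comp (is_diff_pair dT dp) PD) dx.
have gD := is_diffD fD (is_diff_scale dl (is_diff_cst w p0)).
have hD := is_diffB (is_diff_comp dp HD) (is_diff_cst h p0).
apply: is_diff_eq (is_diff_pair (is_diff_pair gD (is_diff_comp dx sD)) hD) _.
apply/funext => q; congr ((_, _), _); last exact: subr0.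
by rewrite -[in RHS](add0r (q.2.2 *: w)) -[X in _ = _ + (X + _)](scaler0 _ (0 : R)).
Qed.

(** The differential of the energy kills the field and is invariant under the monodromy, so applied
    to the first equation it leaves [lam = 0]. Then non-degeneracy makes [xi] a multiple of the
    field, the section equation makes it 0, and a nonzero field forces [tau = 0]. *)
Lemma closing_injective w : 'd rescaled_ham (0, x0) (0, w) != 0 ->
  forall v, 'd (closing w) (0, (x0, T0, 0)) (0, v) = 0 -> v = 0.
Proof.
move=> w0 [[xi tau] lam]; rewrite (is_diffE (closing_diff w)) /=.
pose l : {linear phase R -> R} := partial_snd ('d rescaled_ham (0, x0)).
pose m : {linear phase R -> phase R} := partial_snd (partial_snd ('d Phi (T0, (0, x0)))).
have [_ D0 P0 _ _] := closed_orbit0.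
move=> /pair_equal_spec[/pair_equal_spec[E1 E2] E3].
have := flow_diff_split tau xi D0; rewrite P0 => E4; rewrite E4 in E1.
change (tau *: field0 + m xi - xi + lam *: w = 0) in E1.
change (l xi = 0) in E3; change (is_true (l w != 0)) in w0.
have l0 : l field0 = 0 := rescaled_field_energy (0, x0).
have lm : l (m xi) = l xi := monodromy_energy per xi.
have lam0 : lam = 0.
  have := congr1 l E1; rewrite linearD linearB linearD !linearZ /= l0 lm.
  rewrite scaler0 add0r subrr add0r linear0 -[_ *: _]/(_ * _) => /eqP.
  by rewrite mulf_eq0 (negPf w0) orbF => /eqP.
rewrite lam0 scale0r addr0 in E1; have E5 := subr0_eq E1.
have [_ /(_ xi tau E3 (esym E5))[b xb]] := nondegenerate_kernel per nondeg.
have b0 : b = 0.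
  move: E2; rewrite xb linearZ /= -[_ *: _]/(_ * _) => /eqP.
  by rewrite mulf_eq0 (negPf section_transverse) orbF => /eqP.
have xi0 : xi = 0 by rewrite xb b0 scale0r.
move: E5; rewrite xi0 linear0 addr0 => /eqP; rewrite scaler_eq0 => /orP[/eqP ->|/eqP f0].
  by rewrite lam0.
by have := section_transverse; rewrite f0 linear0 eqxx.
Qed.

(** At a zero the flow takes [x] to [x - lam w], so both have the same energy; yet along [w] the
    energy varies at a rate close to [d], which is not 0. *)
Lemma near_closing_zero w : 'd rescaled_ham (0, x0) (0, w) != 0 ->
  \forall p \near (0, (x0, T0, 0)), closing_dom p -> closing w p = 0 ->
    p.2.2 = 0 /\ closed_orbit p.1 p.2.1.1 p.2.1.2.
Proof.
(* With the tolerance [|d| / (2 K)], the error on the displacement [lam w] is at most half of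
   [|lam| |d|]. *)
move=> w0; pose d := 'd rescaled_ham (0, x0) (0, w); pose K := `|w| + 1.
have K0 : 0 < K by rewrite ltr_wpDl.
have d0 : 0 < `|d| by rewrite normr_gt0.
have eta0 : 0 < `|d| / (2 * K) by rewrite divr_gt0 ?mulr_gt0.
have fP : findim ((R * phase R)%type : normedModType R) := findim_prod findim_real (findim_rV 6).
have [r r0 [_ _ rP]] := strict_diff fP findim_real (@rescaled_dom_open R)
  (rescaled_ham_smooth 1) (orbit_dom per 0) eta0.
have oT : open [set: R * (phase R * R * R)] := openT.
have [c1 c2 c3 c4] := class_C_closing_proj 0 oT.
have c5 := class_C_pair oT c1 c2.
have c6 : class_C 0 setT (fun p : R * (phase R * R * R) => (p.1, p.2.1.1 - p.2.2 *: w)).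
  have cw := class_C_opp oT (class_C_scale oT c4 (class_C_cst 0 _ w)).
  exact: (class_C_pair oT c1 (class_C_add oT c2 cw)).
have n6 : \forall p \near ((0 : R), (x0, T0, (0 : R))),
    ball ((0 : R), x0) r (p.1, p.2.1.1 - p.2.2 *: w).
  apply: (class_C_continuous c6 (I : setT _)); rewrite /= scale0r subr0.
  exact: (nbhsx_ballx _ r r0).
have n5 : \forall p \near ((0 : R), (x0, T0, (0 : R))), ball ((0 : R), x0) r (p.1, p.2.1.1).
  exact: (class_C_continuous c5 (I : setT (0, (x0, T0, 0))) (nbhsx_ballx _ r r0)).
apply: filterS2 n5 n6 => -[e [[x T] lam]] /= B5 B6 [/= Dp Up].
move=> /pair_equal_spec[/pair_equal_spec[E1 E2] /subr0_eq E3].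
have PE : Phi (T, (e, x)) = x - lam *: w.
  by apply/eqP; rewrite -subr_eq0 opprB addrA addrAC; apply/eqP.
have lam0 : lam = 0.
  have := rP _ _ B5 B6; rewrite -PE (rescaled_flow_energy Dp) subrr sub0r normrN PE.
  have -> : (e, x) - (e, x - lam *: w) = (0, lam *: w).
    by apply: injective_projections; rewrite /= ?subrr// opprB addrC subrK.
  rewrite (linear_snd_scale ('d rescaled_ham (0, x0)) lam w) -/d.
  rewrite prod_normE /= normr0 (max_idPr (normr_ge0 _)) !normrZ => hl.
  apply/eqP; rewrite -normr_le0 leNgt; apply/negP => l1.
  have : `|d| / (2 * K) * (`|lam| * `|w|) <= `|d| / (2 * K) * (`|lam| * K).
    by rewrite (ler_wpM2l (ltW eta0))// (ler_wpM2l (ltW l1))// lerDl.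
  have -> : `|d| / (2 * K) * (`|lam| * K) = `|lam| * `|d| / 2 by field; rewrite gt_eqF.
  have ld : 0 < `|lam| * `|d| by rewrite mulr_gt0.
  by lra.
by split => //; split => //; rewrite PE lam0 scale0r subr0.
Qed.

(** Negative [e] are included, so that the expansions at 0 are ordinary differentiability. The
    uniqueness clause is what will identify reflected orbits with members of the family. *)
Theorem rescaled_continuation : exists (e0 : R) (X : R -> phase R) (T : R -> R),
  [/\ 0 < e0, smooth_on [set e : R | `|e| < e0] X /\ smooth_on [set e : R | `|e| < e0] T,
    X 0 = x0 /\ T 0 = T0,
    forall e, `|e| < e0 -> 0 < T e /\ closed_orbit e (X e) (T e) &
    \forall r \near 0^'+, forall e x t, `|e| < r -> `|x - x0| < r -> `|t - T0| < r ->
      closed_orbit e x t -> x = X e].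
Proof.
have [[w w0] _] := nondegenerate_kernel per nondeg.
have fZ : findim ((phase R * R * R)%type : normedModType R).
  exact: findim_prod (findim_prod (findim_rV 6) findim_real) findim_real.
have [U0 D0 P0 s0 H0] := closed_orbit0.
have G0 : closing w (0, (x0, T0, 0)) = 0.
  by rewrite /closing /= P0 s0 H0 scale0r !subrr addr0.
have A0 : closing_dom (0, (x0, T0, 0)) by split.
have [e1 [z [e10 zk z0 zG zU]]] := implicit_function fZ closing_dom_open (closing_smooth w)
  A0 G0 (closing_injective w0).
have zc : {for 0, continuous z} by apply: (class_C_continuous (zk 0%N)); rewrite /= normr0.
have oe (d : R) : open [set e : R | `|e| < d].
  apply: (@open_comp _ _ (fun e : R => `|e|) [set x | x < d]); last exact: open_lt.
  by move=> x _; exact: norm_continuous.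
have pk k := class_C_pair (oe e1) (class_C_id k [set e : R | `|e| < e1]) (zk k).
have Xk k := class_C_fst (oe e1) (class_C_fst (oe e1) (zk k)).
have Tk k := class_C_snd (oe e1) (class_C_fst (oe e1) (zk k)).
have e01 : [set e : R | `|e| < e1] 0 by rewrite /= normr0.
have near1 : \forall e \near (0 : R), closing_dom (e, z e) -> closing w (e, z e) = 0 ->
    (z e).2 = 0 /\ closed_orbit e (z e).1.1 (z e).1.2.
  have n0 : \forall p \near (0, z 0), closing_dom p -> closing w p = 0 ->
      p.2.2 = 0 /\ closed_orbit p.1 p.2.1.1 p.2.1.2 by rewrite z0; exact: near_closing_zero.
  exact: (class_C_continuous (pk 0%N) e01 n0).
have near2 : \forall e \near (0 : R), 0 < (z e).1.2.
  have T00 : 0 < T0 by case: per.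
  by apply: (class_C_near_open (Tk 0%N) e01 (@open_gt _ 0)); rewrite z0.
have /nbhs_ballP[e2 /= e20 e2P] : \forall e \near (0 : R),
    [/\ `|e| < e1, 0 < (z e).1.2 & closed_orbit e (z e).1.1 (z e).1.2].
  apply: filterS3 (near_norm_lt (0 : R) e10) near1 near2 => e.
  by rewrite sub0r normrN => /[dup] ee /zG[ze ze0] /(_ ze ze0)[].
have e2B e : `|e| < e2 -> [/\ `|e| < e1, 0 < (z e).1.2 & closed_orbit e (z e).1.1 (z e).1.2].
  by move=> ee; apply: e2P; rewrite /ball /= sub0r normrN.
exists e2, (fun e => (z e).1.1), (fun e => (z e).1.2); split => //.
- by split=> k; [apply: class_C_sub (Xk k)|apply: class_C_sub (Tk k)] => e /e2B[].
- by rewrite z0.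
- by move=> e /e2B[].
apply: filterS zU => r rP e x t er xr tr [Ux Dx Px sx Hx].
suff <- : (x, t, 0) = z e by [].
apply: rP => //; last by rewrite /closing /= Px sx Hx scale0r !subrr addr0.
have -> : (x, t, 0) - (x0, T0, 0) = (x - x0, t - T0, (0 : R)).
  by apply: injective_projections; rewrite //= subrr.
by rewrite prod_normE /= prod_normE /= normr0 !gt_max xr tr (le_lt_trans (normr_ge0 e)).
Qed.

End Continuation.

(** * The cube root as change of parameter *)

Section CubeRoot.
Context {R : realType}.

Lemma cuberoot_lt (d mu : R) : 0 < d -> 0 <= mu -> mu < d ^+ 3 -> mu `^ 3^-1 < d.
Proof.
rewrite le_eqVlt => d0 /orP[/eqP <-|mu0 mud].
  by rewrite powR0// invr_eq0 pnatr_eq0.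
by rewrite -(@ltr_pXn2r _ 3)// ?nnegrE ?powR_ge0 ?ltW// (cuberoot3 mu0).
Qed.

Lemma near_cuberoot (P : R -> Prop) : (\forall e \near (0 : R), P e) ->
  \forall mu \near 0^'+, P (mu `^ 3^-1).
Proof.
move=> /nbhs_ballP[d /= d0 dP]; near=> mu; apply: dP.
have mu0 : 0 < mu by near: mu; exact: nbhs_right_gt.
have mud : mu < d ^+ 3 by near: mu; apply: nbhs_right_lt; exact: exprn_gt0.
rewrite -ball_normE /= sub0r normrN gtr0_norm ?cuberoot_gt0//.
by apply: cuberoot_lt => //; exact: ltW.
Unshelve. all: by end_near. Qed.

(** Only nonnegative numbers are approached, powers of negative bases being default values. *)
Lemma cuberoot_cvg (I : set R) (mu : R) : I `<=` [set nu | 0 <= nu] -> 0 <= mu ->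
  nu `^ 3^-1 @[nu --> within I (nbhs mu)] --> mu `^ 3^-1.
Proof.
move=> I0; rewrite le_eqVlt => /orP[/eqP <-|mu0].
  rewrite powR0 ?invr_eq0 ?pnatr_eq0//; apply/cvgrPdist_lt => d d0.
  rewrite near_withinE; near=> nu => /I0 /= nu0.
  rewrite sub0r normrN ger0_norm ?powR_ge0//; apply: cuberoot_lt => //.
  by near: nu; apply: (open_near (@open_lt _ (d ^+ 3))); rewrite /= exprn_gt0.
have c := class_C_continuous (class_C_powR_real 0 3^-1) mu0.
exact: (cvg_within_filter _ c).
Unshelve. all: by end_near. Qed.

End CubeRoot.

(** * The family of orbits and its properties *)

Section NearbyFamily.
Context {R : realType}.

Lemma open_preimage_class_C k (V W : normedModType R) (A : set V) (B : set W) (f : V -> W) :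
  open A -> class_C k A f -> open B -> open [set x | A x /\ B (f x)].
Proof.
move=> oA fA oB; rewrite openE => x [Ax Bfx]; rewrite /interior.
have nB := class_C_near_open fA Ax oB Bfx.
by apply: filterS2 (open_near oA Ax) nB => y Ay By; split.
Qed.

Lemma class_C_lipschitz_at (W : normedModType R) (A : set R) (f : R -> W) :
  class_C 1 A f -> A 0 -> exists2 K : R, 0 < K & \forall e \near (0 : R), `|f e - f 0| <= K * `|e|.
Proof.
move=> fA A0; have fD := class_C_is_diff fA A0.
exists (`|'d f 0 (1 : R)| + 1); first by rewrite ltr_wpDl.
apply: filterS (is_diff_near_le fD ltr01) => e; rewrite addr0 mul1r => h.
have -> : f e - f 0 = (f e - f 0 - 'd f 0 e) + 'd f 0 e by rewrite subrK.
apply: (le_trans (ler_normD _ _)); rewrite mulrDl mul1r addrC lerD//.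
by rewrite -[X in 'd f 0 X]mulr1 -[X in 'd f 0 X]/(e *: 1) linearZ normrZ mulrC.
Qed.

Lemma norm_lt_open (d : R) : open [set e : R | `|e| < d].
Proof.
apply: (@open_comp _ _ (fun e : R => `|e|) [set x | x < d]); last exact: open_lt.
by move=> x _; exact: norm_continuous.
Qed.

Lemma near_dist_lt (t r : R) : 0 < r -> \forall u \near t, `|u - t| < r.
Proof. by move=> r0; apply: filterS (near_norm_lt t r0) => u; rewrite distrC. Qed.

Lemma near0_lt (r : R) : 0 < r -> \forall u \near (0 : R), `|u| < r.
Proof. by move=> r0; apply: filterS (near_dist_lt 0 r0) => u; rewrite subr0. Qed.

(** By strict differentiability the injectivity in [t] is uniform in [e]; applied to the section
    function, it excludes returns at times close to 0 and to [T0]. *)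
Lemma partial_injective (A : set (R * R)) (f : R * R -> R) (t0 : R) :
  open A -> class_C 1 A f -> A (0, t0) -> 'd f (0, t0) (0, 1) != 0 ->
  exists2 r : R, 0 < r & forall e t t', `|e| < r -> `|t - t0| < r -> `|t' - t0| < r ->
    f (e, t) = f (e, t') -> t = t'.
Proof.
move=> oA fA A0 d0; set d := 'd f (0, t0) (0, 1) in d0.
have eta0 : 0 < `|d| / 2 by rewrite divr_gt0 ?normr_gt0.
have [r r0 [_ _ rP]] := strict_diff (findim_prod findim_real findim_real) findim_real
  oA fA A0 eta0.
exists r => // e t t' er tr t'r ff.
have B u : `|u - t0| < r -> ball (0, t0) r (e, u).
  by move=> ur; split; rewrite /ball /= ?sub0r ?normrN// distrC.
have := rP _ _ (B t tr) (B t' t'r); rewrite ff subrr sub0r normrN.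
have -> : (e, t) - (e, t') = (0, (t - t') *: (1 : R)).
  by apply: injective_projections; rewrite /= ?subrr// -[_ *: _]/(_ * _) mulr1.
rewrite linear_snd_scale -/d normrZ prod_normE /= normr0 (max_idPr (normr_ge0 _)).
rewrite normrZ normr1 mulr1 => hl; apply/eqP; rewrite -subr_eq0 -normr_le0 leNgt.
apply/negP => l1; have : 0 < `|t - t'| * `|d| by rewrite mulr_gt0// normr_gt0.
by lra.
Qed.

Context (gamma0 : R -> phase R) (T0 h : R) (U : set (phase R)) (s : phase R -> R).
Hypotheses (per : periodic_orbit (hill R) gamma0 T0)
  (section0 : surface_of_section (hill R) h U s)
  (x0_section : level_section (hill R) h U s (gamma0 0)).

Local Notation Phi := (flow_map (@rescaled_dom R) rescaled_field).
Local Notation Dom := (flow_dom (@rescaled_dom R) rescaled_field).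
Local Notation x0 := (gamma0 0).
Local Notation field0 := (rescaled_field (0, x0)).

Context (e0 : R) (X : R -> phase R) (T : R -> R).
Hypotheses (e00 : 0 < e0) (Xk : smooth_on [set e : R | `|e| < e0] X)
  (Tk : smooth_on [set e : R | `|e| < e0] T) (X0 : X 0 = x0) (T00 : T 0 = T0)
  (closedX : forall e, `|e| < e0 -> 0 < T e /\ closed_orbit h U s e (X e) (T e))
  (uniqueX : \forall r \near 0^'+, forall e x t, `|e| < r -> `|x - x0| < r -> `|t - T0| < r ->
      closed_orbit h U s e x t -> x = X e).

Definition family (p : R * R) : phase R := Phi (p.2, (p.1, X p.1)).

Lemma param0 : [set e : R | `|e| < e0] 0.
Proof. by rewrite /= normr0. Qed.

Lemma family_dom_open : open [set p : R * R | `|p.1| < e0].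
Proof. exact: (open_fst (@norm_lt_open e0)). Qed.

Lemma family_periodic e t : `|e| < e0 ->
  Dom (t, (e, X e)) /\ family (e, t + T e) = family (e, t).
Proof. by move=> /closedX[Te [_ D P _ _]]; exact: (periodic_flow Te D P t). Qed.

Lemma family_start e : `|e| < e0 -> family (e, 0) = X e.
Proof. by move=> /(family_periodic 0)[/rescaled_flow_start[]]. Qed.

Lemma family_return e : `|e| < e0 -> family (e, T e) = X e.
Proof. by move=> ee; rewrite -(family_start ee) -(family_periodic 0 ee).2 add0r. Qed.

Lemma family0 t : family (0, t) = gamma0 t.
Proof. by rewrite /family /= X0 (orbit_flow0 per t).2. Qed.

Lemma family_energy e t : `|e| < e0 -> rescaled_ham (e, family (e, t)) = h.
Proof.
move=> ee; have [D _] := family_periodic t ee.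
by rewrite rescaled_flow_energy//; have [_ []] := closedX ee.
Qed.

Lemma class_C_family_param k : class_C k [set p : R * R | `|p.1| < e0] (fun p => p.1).
Proof. by apply: class_C_fst; [exact: family_dom_open|exact: class_C_id]. Qed.

Lemma family_start_smooth : smooth_on [set p : R * R | `|p.1| < e0] (fun p => X p.1).
Proof.
move=> k; have i1 (p : R * R) : `|p.1| < e0 -> `|p.1| < e0 by [].
exact: (class_C_comp findim_real family_dom_open i1 (class_C_family_param k) (Xk k)).
Qed.

Lemma family_smooth : smooth_on [set p : R * R | `|p.1| < e0] family.
Proof.
move=> k; have oA := family_dom_open; have c1 := class_C_family_param k.
have c2 : class_C k [set p : R * R | `|p.1| < e0] (fun p => p.2).
  by apply: class_C_snd => //; exact: class_C_id.
have i2 (p : R * R) : `|p.1| < e0 -> Dom (p.2, (p.1, X p.1)).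
  by move=> pe; exact: (family_periodic p.2 pe).1.
have fP := findim_prod (@findim_real R) (findim_prod (@findim_real R) (findim_rV 6)).
exact: (class_C_comp fP oA i2 (class_C_pair oA c2 (class_C_pair oA c1 (family_start_smooth k)))
  (rescaled_flow_smooth k)).
Qed.

(** Applied to [s] and to [s \o refl a]: transversality of the section becomes a nonzero derivative
    in time. *)
Lemma family_observable (B : set (phase R)) (f : phase R -> R) (t0 : R) :
  open B -> smooth_on B f -> B (gamma0 t0) ->
  let A := [set p : R * R | `|p.1| < e0 /\ B (family p)] in
  [/\ open A, A (0, t0), smooth_on A (fun p => f (family p)) &
    'd (fun p => f (family p)) (0, t0) (0, 1) = 'd f (gamma0 t0) (rescaled_field (0, gamma0 t0))].
Proof.
move=> oB fB Bt A.
have oA : open A := open_preimage_class_C family_dom_open (family_smooth 0) oB.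
have A0 : A (0, t0) by split; [rewrite /= normr0|rewrite family0].
have fA : smooth_on A (fun p => f (family p)).
  move=> k; have i1 p : A p -> B (family p) by case.
  apply: (class_C_comp (findim_rV 6) oA i1 _ (fB k)).
  by apply: class_C_sub (family_smooth k) => p [].
split=> //.
have fD := class_C_is_diff (fA 1%N) A0.
have cD : is_derive t0 (1 : R) (fun t : R => ((0 : R), t)) (0, 1).
  exact: (is_derive_pair (is_derive_cst _ _ _) (is_derive_id _ _)).
apply: (is_derive_uniq (is_derive_comp_diff cD fD)).
have [_ gS _] := per; have /hill_solves[_ gD] := gS t0.
have := is_derive_comp_diff gD (class_C_is_diff (fB 1%N) Bt).
by congr is_derive; apply/funext => t; rewrite /= family0.
Qed.

Lemma section_injective t0 : gamma0 t0 = x0 ->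
  exists2 r : R, 0 < r & forall e t t', `|e| < r -> `|t - t0| < r -> `|t' - t0| < r ->
    family (e, t) = family (e, t') -> t = t'.
Proof.
move=> gt0; have Ut : U (gamma0 t0) by rewrite gt0; exact: (section_x0 x0_section).
have [oA A0 sA dA] := family_observable (section_open section0) (section_smooth section0) Ut.
have [|r r0 rP] := partial_injective oA (sA 1%N) A0.
  by rewrite dA gt0; exact: (section_transverse per section0 x0_section).
by exists r => // e t t' er tr t'r ff; apply: rP er tr t'r _; rewrite ff.
Qed.

Lemma family_period_near (r : R) : 0 < r -> \forall e \near (0 : R), `|T e - T0| < r.
Proof.
move=> r0; have n : \forall t \near T 0, `|t - T0| < r by rewrite T00; exact: near_dist_lt.
exact: (class_C_continuous (Tk 0%N) param0 n).
Qed.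

Lemma family_least_period : least_period gamma0 T0 ->
  \forall e \near (0 : R), forall t : R, 0 < t < T e -> family (e, t) <> X e.
Proof.
move=> least; have [T0p _ _] := per.
(* The period depends on [e], whereas compactness needs a fixed segment; the first two alternatives
   absorb the times outside one period. *)
pose P (e t : R) := [\/ t <= 0, T e <= t | family (e, t) <> X e].
have nearP : \forall e \near (0 : R), forall t : R, 0 <= t <= T0 + 1 -> P e t.
  suff loc (t : R) : 0 <= t <= T0 + 1 -> \forall t' \near t & e \near (0 : R), P e t'.
    exact: (near_itv _ loc).
  move=> /andP[t0 _].
  have [gt0|gt0] := EM (gamma0 t = x0); last first.
    have [D0 _] := family_periodic t param0.
    pose g (p : R * R) := family p - X p.1.
    have oA := family_dom_open.
    have gk : class_C 0 [set p : R * R | `|p.1| < e0] g.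
      apply: class_C_add oA (family_smooth 0) (class_C_opp oA _).
      exact: family_start_smooth.
    have g0 : g (0, t) != 0 by rewrite /g family0 X0 subr_eq0; exact/eqP.
    have gN : \forall y \near g (0, t), y != 0.
      have g1 : 0 < `|g (0, t)| by rewrite normr_gt0.
      apply: filterS (near_norm_lt _ g1) => y; apply: contraTneq => ->.
      by rewrite subr0 ltxx.
    have A0 : [set p : R * R | `|p.1| < e0] (0, t) by rewrite /= normr0.
    have := class_C_continuous gk A0 gN.
    move=> [[/= B1 B2] [/= B1n B2n] BB]; near=> t' e; constructor 3.
    have /= := BB (e, t') _; rewrite subr_eq0 => h2; apply/eqP; apply: h2; split => /=.
      by near: e.
    by near: t'.
  have [r r0 rP] := section_injective gt0.
  have [tz|tnz] := eqVneq t 0.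
    near=> t' e; have [ff|] := EM (family (e, t') = X e); last by constructor 3.
    have ee : `|e| < e0 by near: e; exact: near0_lt.
    have er : `|e| < r by near: e; exact: near0_lt.
    have tr : `|t' - t| < r by near: t'; exact: near_dist_lt.
    have zr : `|0 - t| < r by rewrite tz subrr normr0.
    by constructor 1; rewrite (rP e t' 0)// ff family_start.
  have [tT|tT] := eqVneq t T0.
    near=> t' e; have [ff|] := EM (family (e, t') = X e); last by constructor 3.
    have ee : `|e| < e0 by near: e; exact: near0_lt.
    have er : `|e| < r by near: e; exact: near0_lt.
    have tr : `|t' - t| < r by near: t'; exact: near_dist_lt.
    have zr : `|T e - t| < r by near: e; rewrite tT; exact: family_period_near.
    by constructor 2; rewrite (rP e t' (T e))// ff family_return.
  have tp : 0 < t by rewrite lt_neqAle eq_sym tnz.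
  (* A return of [gamma0] at a positive time is a period, hence not less than [T0]. *)
  have Tt : T0 < t.
    rewrite lt_neqAle eq_sym tT /=; apply: least tp _ => u.
    by rewrite -[in RHS](orbit_flow0 per u).2 addrC -(orbit_flow per t u).2 gt0.
  have d0 : 0 < (t - T0) / 2 by rewrite divr_gt0// subr_gt0.
  near=> t' e; constructor 2; rewrite /=.
  have : `|T e - T0| < (t - T0) / 2 by near: e; exact: family_period_near.
  have : `|t' - t| < (t - T0) / 2 by near: t'; exact: near_dist_lt.
  by rewrite !ltr_norml => /andP[h1 h2] /andP[h3 h4]; lra.
near=> e => t /andP[t0 tT].
have Te : `|T e - T0| < 1 by near: e; exact: family_period_near.
have : P e t.
  apply: (near nearP e) => //; rewrite (ltW t0) /= (le_trans (ltW tT))//.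
  by move: Te; rewrite ltr_norml => /andP[_ hT]; lra.
by case=> //; [rewrite leNgt t0|rewrite leNgt tT].
Unshelve. all: by end_near. Qed.

(* The family is invariant under the reversing symmetry because the reflected
   orbit is another closed orbit near the original one. *)
Lemma family_symmetric (a : R) : a ^+ 2 = 1 -> symmetric_orbit (refl a) gamma0 ->
  \forall e \near (0 : R), symmetric_orbit (refl a) (fun t => family (e, t)).
Proof.
(* Reflection exchanges the times [t] and [c - t]; thus the reflected Hill orbit meets [x0] at the
   image of [gamma0 c]. *)
move=> a2 [t0 sym]; pose c := t0 + t0.
have symc t : refl a (gamma0 t) = gamma0 (c - t).
  have := sym (t - t0); rewrite addrC subrK => ->; congr gamma0; rewrite /c; ring.
have gc : refl a (gamma0 c) = x0 by rewrite symc subrr.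
have rc : continuous (refl a : phase R -> phase R) := @refl_continuous R a.
have rk k : class_C k setT (refl a : phase R -> phase R) := class_C_lin k setT rc.
pose B := [set x | setT x /\ U (refl a x)].
have oU := section_open section0; have sU := section_smooth section0.
have oB : open B := open_preimage_class_C openT (rk 0%N) oU.
have sB : smooth_on B (fun x => s (refl a x)).
  move=> k; have i1 x : B x -> U (refl a x) by case.
  by apply: (class_C_comp (findim_rV 6) oB i1 _ (sU k)); apply: class_C_sub (rk k).
have Bc : B (gamma0 c) by split => //; rewrite gc; exact: (section_x0 x0_section).
have [oA A0 sA dA] := family_observable oB sB Bc.
have rD (x : phase R) : is_diff x (refl a) (refl a) := is_diff_linear x rc.
have G0 : s (refl a (family (0, c))) = 0 by rewrite family0 gc; case: x0_section.
have d1 : 'd (fun p => s (refl a (family p))) (0, c) (0, 1) = - 'd s x0 field0.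
  have sD : is_diff (refl a (gamma0 c)) s ('d s x0).
    by rewrite gc; exact: (class_C_is_diff (sU 1%N) (section_x0 x0_section)).
  rewrite dA -linearN -gc rescaled_field_refl//; last exact: (orbit_dom per).
  rewrite opprK gc; have E := is_diffE (is_diff_comp (rD (gamma0 c)) sD).
  exact: (congr1 (fun f => f (rescaled_field (0, gamma0 c))) E).
have dG v : 'd (fun p => s (refl a (family p))) (0, c) (0, v) = 0 -> v = 0.
  have -> : ((0 : R), v) = (0, v *: (1 : R)) by congr (_, _); rewrite -[_ *: _]/(_ * _) mulr1.
  rewrite linear_snd_scale d1 -[_ *: _]/(_ * _) => /eqP; rewrite mulf_eq0 oppr_eq0.
  by rewrite (negPf (section_transverse per section0 x0_section)) orbF => /eqP.
(* For [e] other than 0, the time at which the reflection of the orbit lies on the section moves to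
   [th e]; uniqueness requires a starting point on the section. *)
have [e1 [th [e10 thk th0 thG _]]] := implicit_function findim_real oA sA A0 G0 dG.
have thc : {for 0, continuous th} by apply: (class_C_continuous (thk 0%N)); rewrite /= normr0.
pose c' e u := refl a (family (e, th e - u)).
have c'S e t : `|e| < e0 -> rescaled_solves e (c' e) t.
  move=> ee; have [D _] := family_periodic (th e - t) ee.
  have [Dr Fr] := rescaled_flow_solves D; split; first exact: rescaled_dom_refl.
  have gD : is_derive t (1 : R) (fun u => th e - u) (-1).
    apply: is_derive_eq (is_deriveB (is_derive_cst _ _ _) (is_derive_id t (1 : R))) _.
    by rewrite sub0r.
  have := is_derive_comp_diff (is_derive_comp_real gD Fr) (rD _).
  by rewrite scaleN1r linearN -rescaled_field_refl.
have flowc e t : `|e| < e0 -> Dom (t, (e, c' e 0)) /\ Phi (t, (e, c' e 0)) = c' e t.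
  by move=> ee; apply: rescaled_flow_intro => u _; exact: c'S.
have [r r0 rP] : exists2 r : R, 0 < r & forall e x t, `|e| < r -> `|x - x0| < r ->
    `|t - T0| < r -> closed_orbit h U s e x t -> x = X e.
  near (0 : R)^'+ => r; exists r; first by near: r; exact: nbhs_right_gt.
  by near: r.
have near1 : \forall e \near (0 : R), `|c' e 0 - x0| < r.
  have pk := class_C_pair (@norm_lt_open e1) (class_C_id 0 [set e : R | `|e| < e1]) (thk 0%N).
  have rF := class_C_comp_lin family_dom_open rc (family_smooth 0).
  have n1 : \forall y \near refl a (family (0, th 0)), `|y - x0| < r.
    by rewrite th0 family0 gc; apply: filterS (near_norm_lt x0 r0) => y; rewrite distrC.
  have A1 : [set p : R * R | `|p.1| < e0] (0, th 0) by rewrite /= normr0.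
  have e01 : [set e : R | `|e| < e1] 0 by rewrite /= normr0.
  have n2 : \forall e \near (0 : R), `|refl a (family (e, th e)) - x0| < r.
    exact: (class_C_continuous pk e01 (class_C_continuous rF A1 n1)).
  by apply: filterS n2 => e; rewrite /c' subr0.
near=> e.
have ee : `|e| < e0 by near: e; exact: near0_lt.
have [[_ Uc] sc] : [set p : R * R | `|p.1| < e0 /\ B (family p)] (e, th e) /\
    s (refl a (family (e, th e))) = 0.
  by apply: thG; near: e; exact: near0_lt.
have [Dc Pc] := flowc e (T e) ee.
have Xc : c' e 0 = X e.
  apply: (rP e _ (T e)).
  - by near: e; exact: near0_lt.
  - by near: e.
  - by near: e; exact: family_period_near.
  have cE : c' e (T e) = c' e 0.
    by rewrite /c' subr0 -[in LHS](family_periodic (th e - T e) ee).2 subrK.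
  split; rewrite ?Pc//; rewrite /c' ?subr0//; first by case: Uc.
  by rewrite rescaled_ham_refl// family_energy.
(* Reflection exchanges the times [u] and [th e - u] of the orbit, whose midpoint is [th e / 2]. *)
exists (th e / 2) => t; have [_] := flowc e (th e / 2 - t) ee.
rewrite Xc {1}/c' => E; rewrite /family /= E.
by rewrite /family /=; congr (refl a (Phi (_, _))); field.
Unshelve. all: by end_near. Qed.

(** Provides one neighbourhood of [x0] on which the section stays transverse for all small
    parameters. *)
Lemma transverse_near : exists2 r : R, 0 < r & forall e x, `|e| < r -> `|x - x0| < r ->
  [/\ U x, rescaled_dom (e, x) & 'd s x (rescaled_field (e, x)) != 0].
Proof.
have oU := section_open section0; have sU := section_smooth section0.
have oD := @rescaled_dom_open R.
have c2 k : class_C k rescaled_dom (fun p : R * phase R => p.2).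
  by apply: class_C_snd => //; exact: class_C_id.
pose A := [set p : R * phase R | rescaled_dom p /\ U p.2].
have oA : open A := open_preimage_class_C oD (c2 0%N) oU.
have [n [b [l [lc le ld]]]] := findim_rV 6 : findim (phase R : normedModType R).
pose f (p : R * phase R) := 'd s (p.2) (rescaled_field p).
have fA : class_C 0 A f.
  have -> : f = (fun p => \sum_i l i (rescaled_field p) *: 'd s (p.2) (b i)).
    apply/funext => p; rewrite /f [in LHS](le (rescaled_field p)) linear_sum.
    by apply: eq_bigr => i _; rewrite linearZ.
  have AD : A `<=` rescaled_dom by move=> p [].
  apply: class_C_sum => // i; apply: class_C_scale => //.
    exact: (class_C_comp_lin oA (lc i) (class_C_sub AD (rescaled_field_smooth 0))).
  have i1 p : A p -> U p.2 by case.
  exact: (class_C_comp (findim_rV 6) oA i1 (class_C_sub AD (c2 0%N)) (class_C_diff (b i) (sU 1%N))).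
have A0 : A (0, x0) by split; [exact: (orbit_dom per)|exact: (section_x0 x0_section)].
have f0 : f (0, x0) != 0 := section_transverse per section0 x0_section.
have near1 : \forall p \near (0, x0), A p /\ f p != 0.
  by apply: filterS2 (open_near oA A0) (class_C_near_open fA A0 open_neq0 f0) => p Ap fp.
have [r r0 rP] : exists2 r : R, 0 < r & ball ((0 : R), x0) r `<=` [set p | A p /\ f p != 0].
  exact/nbhs_ballP.
exists r; first exact: r0.
move=> e x er xr; have [[Dp Up] fp] : A (e, x) /\ f (e, x) != 0.
  by apply: rP; split; rewrite /= -ball_normE /= ?sub0r ?normrN// distrC.
split; [exact: Up|exact: Dp|exact: fp].
Qed.

Lemma monodromy_family_continuous i j :
  class_C 0 [set e : R | `|e| < e0] (fun e => flow_jacobian (T e, (e, X e)) i j).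
Proof.
have oe := @norm_lt_open e0.
have fP : findim ((R * (R * phase R))%type : normedModType R).
  exact: findim_prod findim_real (findim_prod findim_real (findim_rV 6)).
have i1 e : `|e| < e0 -> Dom (T e, (e, X e)) by move=> /closedX[_ []].
have c := class_C_pair oe (Tk 0) (class_C_pair oe (class_C_id 0 [set e : R | `|e| < e0]) (Xk 0)).
have d := class_C_diff ((0 : R), ((0 : R), delta_mx ord0 i : phase R)) (rescaled_flow_smooth 1).
have c1 := class_C_pair oe (class_C_cst 0 _ (0 : R)) (class_C_comp fP oe i1 c d).
have oT : open [set: R * phase R] := openT.
under [X in class_C _ _ X]eq_fun do rewrite mxE.
exact: (class_C_comp (findim_prod findim_real (findim_rV 6)) oe (fun e _ => I) c1
  (class_C_phase_coord 0 j oT)).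
Qed.

Lemma family_gt0 mu : 0 < mu < e0 ^+ 3 -> 0 < mu `^ 3^-1 /\ `|mu `^ 3^-1| < e0.
Proof.
move=> /andP[mu0 mue]; have m0 := cuberoot_gt0 mu0; split=> //.
by rewrite gtr0_norm//; apply: cuberoot_lt; rewrite ?(ltW mu0).
Qed.

Definition orbit_family mu t : phase R := of_rescaled mu (family (mu `^ 3^-1, t)).

Lemma open_oo (a b : R) : open [set mu : R | a < mu < b].
Proof.
have -> : [set mu : R | a < mu < b] = [set mu | a < mu] `&` [set mu | mu < b].
  by apply/seteqP; split=> x /=; [move=> /andP[]|move=> [-> ->]].
by apply: openI; [exact: open_gt|exact: open_lt].
Qed.

Lemma orbit_family_smooth : smooth_on [set z : R * R | 0 < z.1 < e0 ^+ 3]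
  (fun z => orbit_family z.1 z.2).
Proof.
move=> k; set A := [set z : R * R | _].
have oA : open A by exact: (open_fst (@open_oo 0 (e0 ^+ 3))).
have c1 : class_C k A (fun z : R * R => z.1) by apply: class_C_fst => //; exact: class_C_id.
have c2 : class_C k A (fun z : R * R => z.2) by apply: class_C_snd => //; exact: class_C_id.
have i1 z : A z -> 0 < z.1 by move=> /andP[].
have ce := class_C_comp findim_real oA i1 c1 (class_C_powR_real k 3^-1).
have i2 z : A z -> `|z.1 `^ 3^-1| < e0 by move=> /family_gt0[].
have cf := class_C_comp (findim_prod findim_real findim_real) oA i2 (class_C_pair oA ce c2)
  (family_smooth k).
apply: class_C_add => //; first exact: class_C_scale.
have -> : (fun z : R * R => m_shift z.1) =
    (fun z => m_shift 0 + z.1 *: mk_phase (-1) 0 0 0 (-1) 0).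
  apply/funext => z; apply: phase_eq;
    by rewrite !(coordD, coordZ, mk_phase_coord) ?mulr0 ?addr0// subr0 mulrN1.
apply: class_C_add => //; first exact: class_C_cst.
by apply: class_C_scale => //; exact: class_C_cst.
Qed.

Lemma orbit_period_smooth : smooth_on [set mu : R | 0 < mu < e0 ^+ 3] (fun mu => T (mu `^ 3^-1)).
Proof.
move=> k; have oA := @open_oo 0 (e0 ^+ 3).
have i1 mu : 0 < mu < e0 ^+ 3 -> 0 < mu by move=> /andP[].
have ce := class_C_comp findim_real oA i1 (class_C_id k _) (class_C_powR_real k 3^-1).
have i2 mu : 0 < mu < e0 ^+ 3 -> `|mu `^ 3^-1| < e0 by move=> /family_gt0[].
exact: (class_C_comp findim_real oA i2 ce (Tk k)).
Qed.

Lemma orbit_family_periodic mu : 0 < mu < e0 ^+ 3 ->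
  periodic_orbit (cr3bp mu) (orbit_family mu) (T (mu `^ 3^-1)).
Proof.
move=> mue; have /andP[mu0 _] := mue; have [_ ee] := family_gt0 mue; split.
- by have [] := closedX ee.
- move=> t; apply/(cr3bp_solves (fun t => family (mu `^ 3^-1, t)) t mu0).
  exact: (rescaled_flow_solves (family_periodic t ee).1).
- by move=> t; rewrite /orbit_family (family_periodic t ee).2.
Qed.

Lemma orbit_family_energy mu t : 0 < mu < e0 ^+ 3 ->
  ham (cr3bp mu) (orbit_family mu t) = jacobi_energy h mu.
Proof.
move=> mue; have /andP[mu0 _] := mue; have [_ ee] := family_gt0 mue.
have [D _] := rescaled_flow_solves (family_periodic t ee).1.
by rewrite /orbit_family cr3bp_energy// family_energy.
Qed.

Lemma orbit_family_least_period mu : 0 < mu < e0 ^+ 3 ->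
  (forall t, 0 < t < T (mu `^ 3^-1) -> family (mu `^ 3^-1, t) <> X (mu `^ 3^-1)) ->
  least_period (orbit_family mu) (T (mu `^ 3^-1)).
Proof.
move=> mue lt T' T'0 per'; have /andP[mu0 _] := mue; have [_ ee] := family_gt0 mue.
rewrite leNgt; apply/negP => T'T; apply: (lt T'); first by rewrite T'0.
have /(can_inj (of_rescaledK mu0)) := per' 0.
by rewrite add0r family_start.
Qed.

Lemma orbit_family_symmetric (a mu : R) : 0 < mu ->
  symmetric_orbit (refl a) (fun t => family (mu `^ 3^-1, t)) ->
  symmetric_orbit (refl a) (orbit_family mu).
Proof.
by move=> mu0 [t0 sym]; exists t0 => t; rewrite /orbit_family -of_rescaled_refl sym.
Qed.

(** As the power of 0 with exponent 1/3 is 0, one matrix covers Hill's orbit and the CR3BP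
    orbits. *)
Lemma orbit_family_floquet mu l : 0 <= mu < e0 ^+ 3 ->
  (if mu == 0 then floquet_multipliers (hill R) gamma0 T0 l
   else floquet_multipliers (cr3bp mu) (orbit_family mu) (T (mu `^ 3^-1)) l) <->
  map_poly (real_complex R)
    (char_poly (flow_jacobian (T (mu `^ 3^-1), (mu `^ 3^-1, X (mu `^ 3^-1)))))
  = \prod_(z <- l) ('X - z%:P).
Proof.
move=> /andP[mu0 mue]; have [->|mun] := eqVneq mu 0.
  have p0 : (0 : R) `^ 3^-1 = 0 by rewrite powR0// invr_eq0 pnatr_eq0.
  rewrite p0 X0 T00 /floquet_multipliers /monodromy monodromy_hill//.
    by have [/ltW] := per.
  exact: (orbit_flow0 per T0).1.
have mup : 0 < mu by rewrite lt_neqAle eq_sym mun.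
have [_ ee] := family_gt0 (introT andP (conj mup mue)).
have [Te [_ D _ _ _]] := closedX ee.
rewrite /floquet_multipliers /monodromy /orbit_family family_start//.
by rewrite monodromy_cr3bp// ltW.
Qed.

Lemma orbit_family_multipliers_continuous (mu0 : R) : mu0 <= e0 ^+ 3 ->
  continuous_unordered [set mu : R | 0 <= mu < mu0]
    (fun mu => if mu == 0 then floquet_multipliers (hill R) gamma0 T0
               else floquet_multipliers (cr3bp mu) (orbit_family mu) (T (mu `^ 3^-1))).
Proof.
move=> mu0e; set I := [set mu : R | _].
have Ie mu : I mu -> 0 <= mu < e0 ^+ 3.
  by move=> /andP[m0 m1]; rewrite m0 (lt_le_trans m1).
pose M mu := flow_jacobian (T (mu `^ 3^-1), (mu `^ 3^-1, X (mu `^ 3^-1))).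
have fE mu l : I mu -> (if mu == 0 then floquet_multipliers (hill R) gamma0 T0
    else floquet_multipliers (cr3bp mu) (orbit_family mu) (T (mu `^ 3^-1))) l <->
    map_poly (real_complex R) (char_poly (M mu)) = \prod_(z <- l) ('X - z%:P).
  by move=> /Ie/(orbit_family_floquet l); case: eqP.
have Mc : continuous_unordered I (fun mu (l : 6.-tuple R[i]) =>
    map_poly (real_complex R) (char_poly (M mu)) = \prod_(z <- l) ('X - z%:P)).
  apply: continuous_eigenvalues => mu Imu i j.
  have /andP[m0 me] := Ie mu Imu.
  have IE : I `<=` [set nu | 0 <= nu] by move=> nu /andP[].
  have ee : [set e : R | `|e| < e0] (mu `^ 3^-1).
    by rewrite /= ger0_norm ?powR_ge0//; exact: cuberoot_lt.
  exact: (cvg_comp _ _ (cuberoot_cvg IE m0)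
    (class_C_continuous (@monodromy_family_continuous i j) ee)).
move=> mu Imu; have [l Ml lc] := Mc mu Imu; exists l; first exact/fE.
move=> e ep; apply: filterS (lc e ep) => nu nuP Inu.
by have [l' Ml' ll'] := nuP Inu; exists l' => //; exact/fE.
Qed.

Lemma orbit_family0 mu : 0 < mu < e0 ^+ 3 ->
  orbit_family mu 0 = of_rescaled mu (X (mu `^ 3^-1)).
Proof. by move=> /family_gt0[_ ee]; rewrite /orbit_family family_start. Qed.

Lemma near_lt_e03 : \forall mu \near 0^'+, 0 < mu < e0 ^+ 3.
Proof.
near=> mu; apply/andP; split; first by near: mu; exact: nbhs_right_gt.
by near: mu; apply: nbhs_right_lt; exact: exprn_gt0.
Unshelve. all: by end_near. Qed.

(** In rescaled coordinates the displacement is of order [e], and the homothety brings a second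
    factor [e]. *)
Lemma orbit_location_bigO :
  (fun mu => orbit_family mu 0 - m_shift mu - mu `^ (3^-1) *: x0)
    =O_ (0^'+) (fun mu => mu `^ (2 / 3)).
Proof.
have [K K0 XK] := class_C_lipschitz_at (Xk 1) param0.
apply/eqO_exP; exists K => //.
apply: filterS2 near_lt_e03 (near_cuberoot XK) => mu mue XKmu.
have /andP[mu0 _] := mue; have m0 := cuberoot_gt0 mu0.
rewrite orbit_family0// /of_rescaled addrK -scalerBr normrZ cuberoot2// -X0.
rewrite normrX expr2 mulrCA; exact: (ler_wpM2l (normr_ge0 _) XKmu).
Qed.

Lemma orbit_period_bigO : (fun mu => T (mu `^ (3^-1)) - T0) =O_ (0^'+) (fun mu => mu `^ (3^-1)).
Proof.
have [K K0 TK] := class_C_lipschitz_at (Tk 1) param0.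
apply/eqO_exP; exists K => //; apply: filterS (near_cuberoot TK) => mu; by rewrite T00.
Qed.

Lemma rescaled_section (mu c : R) (V : set (phase R)) : 0 < mu -> open V -> V `<=` U ->
  (forall x, V x -> rescaled_dom (mu `^ 3^-1, x) /\
    'd s x (rescaled_field (mu `^ 3^-1, x)) != 0) ->
  surface_of_section (cr3bp mu) c [set of_rescaled mu x | x in V] (s \o to_rescaled mu).
Proof.
move=> mu0 oV VU VP; have sU := section_smooth section0.
have tk k : class_C k setT (to_rescaled mu).
  apply: class_C_scale; [exact: openT|exact: class_C_cst|].
  apply: class_C_add; [exact: openT|exact: class_C_id|exact: class_C_cst].
have VE : [set of_rescaled mu x | x in V] = [set y | setT y /\ V (to_rescaled mu y)].
  apply/seteqP; split=> y /=; first by case=> x Vx <-; rewrite of_rescaledK.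
  by case=> _ Vy; exists (to_rescaled mu y); rewrite ?to_rescaledK.
have oW := open_preimage_class_C openT (tk 0%N) oV.
split.
- by rewrite VE.
- by move=> _ [x /VP[Dx _] <-]; exact/(cr3bp_dom _ mu0).
- rewrite VE => k.
  have i1 y : (setT y /\ V (to_rescaled mu y)) -> U (to_rescaled mu y) by case=> _ /VU.
  apply: (class_C_comp (findim_rV 6) oW i1 _ (sU k)).
  exact: class_C_sub (tk k).
move=> _ [[x Vx <-] _ _]; have [Dx dx] := VP x Vx.
have sD : is_diff (to_rescaled mu (of_rescaled mu x)) s ('d s x).
  by rewrite of_rescaledK//; exact: (class_C_is_diff (sU 1%N) (VU x Vx)).
rewrite (is_diffE (is_diff_comp (to_rescaled_diff mu _) sD)) cr3bp_fieldE//=.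
by rewrite scalerA mulVf ?scale1r// gt_eqF// cuberoot_gt0.
Qed.

Lemma orbit_family_on_section mu (V : set (phase R)) : 0 < mu < e0 ^+ 3 ->
  V (X (mu `^ 3^-1)) ->
  level_section (cr3bp mu) (jacobi_energy h mu) [set of_rescaled mu x | x in V]
    (s \o to_rescaled mu) (orbit_family mu 0).
Proof.
move=> mue VX; have /andP[mu0 _] := mue; have [_ ee] := family_gt0 mue.
split; [|exact: orbit_family_energy|].
  by rewrite orbit_family0//; exists (X (mu `^ 3^-1)).
by rewrite orbit_family0//= of_rescaledK//; have [_ []] := closedX ee.
Qed.

End NearbyFamily.

Unset Implicit Arguments.

Theorem theorem4 (R : realType) (gamma0 : R -> phase R) (T0 h : R)
  (x0 : phase R) (U : set (phase R)) (s : phase R -> R)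
  (gamma0_periodic : periodic_orbit (hill R) gamma0 T0)
  (gamma0_energy : forall t, ham (hill R) (gamma0 t) = h)
  (gamma0_nondegenerate : nondegenerate_orbit (hill R) gamma0 T0)
  (section0 : surface_of_section (hill R) h U s)
  (x0_section : level_section (hill R) h U s x0)
  (x0_gamma0 : gamma0 0 = x0) :
  exists (mu0 : R) (gamma : R -> R -> phase R) (T : R -> R) (V : set (phase R)),
    [/\ 0 < mu0,
        (smooth_on [set z : R * R | 0 < z.1 < mu0]
           (fun z : R * R => gamma z.1 z.2) /\
         smooth_on [set mu : R | 0 < mu < mu0] T),
        (forall mu, 0 < mu < mu0 -> periodic_orbit (cr3bp mu) (gamma mu) (T mu)),
        [/\ open V, V x0, V `<=` U,
        (forall mu, 0 < mu < mu0 ->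
           let Vmu := [set of_rescaled mu x | x in V] in
           let smu := s \o to_rescaled mu in
           surface_of_section (cr3bp mu) (jacobi_energy h mu) Vmu smu /\
           level_section (cr3bp mu) (jacobi_energy h mu) Vmu smu (gamma mu 0)) &
        (fun mu => gamma mu 0 - m_shift mu - mu `^ (3^-1) *: x0)
          =O_ (0^'+) (fun mu => mu `^ (2 / 3))] &
        [/\
        (fun mu => T mu - T0) =O_ (0^'+) (fun mu => mu `^ (3^-1)) /\
          (least_period gamma0 T0 ->
             forall mu, 0 < mu < mu0 -> least_period (gamma mu) (T mu)),
        forall mu, 0 < mu < mu0 ->
          forall t, ham (cr3bp mu) (gamma mu t) = jacobi_energy h mu,
        continuous_unordered [set mu : R | 0 <= mu < mu0]
          (fun mu => if mu == 0 then floquet_multipliers (hill R) gamma0 T0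
                     else floquet_multipliers (cr3bp mu) (gamma mu) (T mu)) &
        (symmetric_orbit (@r_y R) gamma0 -> forall mu, 0 < mu < mu0 ->
           symmetric_orbit (@r_y R) (gamma mu)) /\
        (symmetric_orbit (@r_yz R) gamma0 -> forall mu, 0 < mu < mu0 ->
           symmetric_orbit (@r_yz R) (gamma mu))]].
Proof.
subst x0.
have [e1 [X [T [e10 [Xk Tk] [X0 T00] closedX uniqueX]]]] := rescaled_continuation
  gamma0_periodic gamma0_energy gamma0_nondegenerate section0 x0_section.
have [r r0 rP] := transverse_near gamma0_periodic section0 x0_section.
pose F e t := family X (e, t).
(* Symmetry and minimality of the period are assumptions of parts of the conclusion only; placed
   under the neighbourhood quantifier, they let one threshold serve all parts. *)
have sym (a : R) : a ^+ 2 = 1 -> \forall e \near (0 : R),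
    symmetric_orbit (refl a) gamma0 -> symmetric_orbit (refl a) (F e).
  move=> a2; have [sy|nsy] := pselect (symmetric_orbit (refl a) gamma0); last first.
    by near=> e.
  have h1 := family_symmetric gamma0_periodic section0 x0_section e10 Xk Tk X0 T00
    closedX uniqueX a2 sy.
  by apply: filterS h1 => e he _; exact: he.
have least : \forall e \near (0 : R), least_period gamma0 T0 ->
    forall t : R, 0 < t < T e -> F e t <> X e.
  have [lp|nlp] := pselect (least_period gamma0 T0); last by near=> e.
  have h1 := family_least_period gamma0_periodic section0 x0_section e10 Xk Tk X0 T00 closedX lp.
  by apply: filterS h1 => e he _; exact: he.
have Xr : \forall e \near (0 : R), ball (gamma0 0) r (X e).
  have n : \forall x \near X 0, ball (gamma0 0) r x by rewrite X0; exact: nbhsx_ballx.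
  exact: (class_C_continuous (Xk 0%N) (param0 e10) n).
have /nbhs_ballP[d /= d0 dP] : \forall e \near (0 : R),
    [/\ `|e| < e1 /\ `|e| < r, ball (gamma0 0) r (X e),
      least_period gamma0 T0 -> forall t : R, 0 < t < T e -> F e t <> X e,
      symmetric_orbit (refl 1) gamma0 -> symmetric_orbit (refl 1) (F e) &
      symmetric_orbit (refl (- 1)) gamma0 -> symmetric_orbit (refl (- 1)) (F e)].
  near=> e; split; try by near: e.
  - by split; near: e; exact: near0_lt.
  - by near: e; apply: sym; rewrite expr1n.
  - by near: e; apply: sym; rewrite sqrrN expr1n.
(* Bounds on [e] become bounds on [mu] by cubing. *)
have good mu : 0 < mu < Num.min (d ^+ 3) (e1 ^+ 3) ->
    [/\ 0 < mu, 0 < mu < e1 ^+ 3 & ball 0 d (mu `^ 3^-1)].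
  rewrite lt_min => /andP[mu0 /andP[mud mue]]; rewrite mu0 mue; split => //.
  rewrite -ball_normE /= sub0r normrN gtr0_norm ?cuberoot_gt0//.
  by apply: cuberoot_lt => //; exact: ltW.
have ry : (@r_y R) = refl 1 by apply/funext => x; rewrite r_yE.
have ryz : (@r_yz R) = refl (- 1) by apply/funext => x; rewrite r_yzE.
have VE (x : phase R) : ball (gamma0 0) r x -> `|x - gamma0 0| < r.
  by rewrite -ball_normE /= distrC.
exists (Num.min (d ^+ 3) (e1 ^+ 3)), (orbit_family X), (fun mu => T (mu `^ 3^-1)),
  (ball (gamma0 0) r).
have mu0e : Num.min (d ^+ 3) (e1 ^+ 3) <= e1 ^+ 3 by rewrite ge_min lexx orbT.
split.
- by rewrite lt_min !exprn_gt0.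
- split=> k.
    apply: class_C_sub (orbit_family_smooth e10 Xk closedX k) => z /=.
    by case/good.
  by apply: class_C_sub (orbit_period_smooth e10 Tk k) => z /good[].
- by move=> mu /good[_ mue _]; exact: (orbit_family_periodic e10 closedX mue).
- split.
  + exact: ball_open.
  + exact: ballxx.
  + move=> x xr; have e00 : `|0 : R| < r by rewrite normr0.
    by have [] := rP 0 x e00 (VE x xr).
  + move=> mu /good[mu0 mue /dP[[_ er] Xmu _ _ _]] /=; split; last first.
      exact: (orbit_family_on_section e10 closedX mue Xmu).
    apply: (rescaled_section section0) => //; first exact: ball_open.
      move=> x xr; have e00 : `|0 : R| < r by rewrite normr0.
      by have [] := rP 0 x e00 (VE x xr).
    by move=> x /VE xr; have [] := rP _ x er xr.
  exact: (orbit_location_bigO e10 Xk X0 closedX).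
split.
- split; first exact: (orbit_period_bigO e10 Tk T00).
  move=> lp mu /good[_ mue /dP[_ _ /(_ lp) lt _ _]].
  exact: (orbit_family_least_period e10 closedX mue lt).
- by move=> mu /good[_ mue _] t; exact: (orbit_family_energy e10 closedX).
- exact: (orbit_family_multipliers_continuous gamma0_periodic e10 Xk Tk X0 T00 closedX mu0e).
rewrite ry ryz; split=> sy mu /good[mu0 _ /dP[_ _ _ s1 s2]].
  exact: (orbit_family_symmetric mu0 (s1 sy)).
exact: (orbit_family_symmetric mu0 (s2 sy)).
Unshelve. all: by end_near. Qed.
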